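(* Suppose the noise is ordinary smooth of order $\nu>0$ with constants $d_0,d_1>0$ (Assumption 1 of the context). Let $s\ge1$, $R>0$ and $\psi_N^{ad}=(N/\sqrt{\log\log N})^{-2s/(2s+2\nu+1)}$. Consider the set $\mathcal{L}=\{2^{j_0},2^{j_0+1},\dots,2^{j_m}\}$, where $j_0=\lceil\log_2(\log\log N)\rceil$ and $j_m=\lceil\log_2(N(\log\log N)^{-3/2})\rceil$, and the adaptive test statistic $$D_N=\mathbf{1}_{\{\max_{L\in\mathcal{L}}(|T_L|/t_L^2)>\sqrt{2/K_0}\}},\qquad t_L^2=L^{2\nu+1}\sqrt{\log\log N}/N,$$ where $T_L$ and the constant $K_0>0$ are as defined in the context. Then, if $\mathcal{C}>\sqrt{2K_0^{-1}}+((4\pi)^{-1}+R^2)2^{2s}$, $$\lim_{N\to\infty}\left\{\mathbb{P}_{f_0}(D_N=1)+\sup_{f\in H_1(s,R,\mathcal{C}\psi_N^{ad})}\mathbb{P}_f(D_N=0)\right\}=0.$$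
   Context: Model. $\mathbb{S}^2$ is the unit sphere of $\mathbb{R}^3$ with its surface (Lebesgue) measure $dx$ of total mass $4\pi$; $\|\cdot\|_2$ is the norm of $\mathbb{L}_2(\mathbb{S}^2)$. One observes $Z_i=\varepsilon_iX_i$, $i=1,\dots,N$, where the $\varepsilon_i$ are i.i.d. random rotations in $SO(3)$ with known density $f_\varepsilon$ with respect to the probability Haar measure, the $X_i$ are i.i.d. random variables on $\mathbb{S}^2$ with unknown density $f$ with respect to $dx$, and the $X_i$ are independent of the $\varepsilon_i$. The density of $Z_i$ is $f_Z=f_\varepsilon*f$, where $f_\varepsilon*f(\omega)=\int_{SO(3)}f_\varepsilon(u)f(u^{-1}\omega)\,du$. $\mathbb{P}_f$ denotes the probability when the $X_i$ have density $f$. The uniform density is $f_0=(4\pi)^{-1}\mathbf{1}_{\mathbb{S}^2}$. Fourier analysis. $(Y^l_m)_{l\ge0,\,-l\le m\le l}$ is the usual complex orthonormal basis of spherical harmonics of $\mathbb{L}_2(\mathbb{S}^2)$. For $f\in\mathbb{L}_2(\mathbb{S}^2)$, $f^{\star l}_m=\int_{\mathbb{S}^2}f(x)\overline{Y^l_m(x)}\,dx$. The rotational harmonics $D^l_{mn}$ on $SO(3)$ ($-l\le m,n\le l$) are the matrix coefficients with $\overline{Y^l_m(gx)}=\sum_{n=-l}^l D^l_{mn}(g)\overline{Y^l_n(x)}$. The rotational Fourier transform of $f_\varepsilon$ at order $l$ is the $(2l+1)\times(2l+1)$ matrix $f_\varepsilon^{\star l}$ with entries $(f_\varepsilon^{\star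 l})_{mn}=\int_{SO(3)}f_\varepsilon(g)D^l_{mn}(g)\,dg$, so that $(f_\varepsilon*f)^{\star l}=f_\varepsilon^{\star l}f^{\star l}$. $\|\cdot\|_{op}$ is the operator norm associated with the Euclidean norm. Assumption 1 (ordinary smooth noise of order $\nu$). For all $l\ge 0$ the matrix $f_\varepsilon^{\star l}$ is invertible, with inverse denoted $f^{\star l}_{\varepsilon^{-1}}$, and there are positive constants $d_0,d_1,\nu$ such that for all $l\ge1$: $\|f^{\star l}_{\varepsilon^{-1}}\|_{op}\le d_0^{-1}l^{\nu}$ and $\|f^{\star l}_{\varepsilon}\|_{op}\le d_1l^{-\nu}$. Sobolev classes and alternatives. $\|f\|_{W_s}^2=\sum_{l\ge0}\sum_{m=-l}^l(1+l(l+1))^s|f^{\star l}_m|^2$; $W_s(\mathbb{S}^2)$ is the completion of $C^\infty(\mathbb{S}^2)$ for this norm; for $R>0$, $W_s(\mathbb{S}^2,R)$ is the set of probability densities $f\in W_s(\mathbb{S}^2)$ with $\|f\|_{W_s}^2\le\frac1{4\pi}+R^2$. $H_1(s,R,\rho)$ is the set of $f\in W_s(\mathbb{S}^2,R)$ with $\|f-f_0\|_2^2\ge\rho$. Test statistic. $\Phi_{lm}(x)=\sum_{n=-l}^l(f^{\star l}_{\varepsilon^{-1}})_{mn}\overline{Y^l_n(x)}$ and $$T_L=\sum_{l=1}^L\sum_{m=-l}^l\frac{2}{N(N-1)}\sum_{1\le i_1<i_2\le N}\Phi_{lm}(Z_{i_1})\overline{\Phi_{lm}(Z_{i_2})}.$$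 The constant $K_0$. It is the constant of the following exponential inequality: there exist constants $K_0,K_1>0$ such that for sequences $u_N>0$ one has $\mathbb{P}_{f_0}(|T_L|>L^{2\nu+1}u_N/N)\le K_1\exp(-K_0u_N^2)$ provided that $u_NL^{-1}$, $LN^{-2}u_N^8$ and $LN^{-1}u_N^3$ are bounded. (The constants may depend on the bounds for these three sequences; here $K_0>0$ is a constant for which, with some $K_1>0$, the inequality holds for all large $N$, all $L\in\mathcal{L}$ and $u_N=\sqrt{2K_0^{-1}\log\log N}$.) $\lceil x\rceil$ is the smallest integer $\ge x$; $N$ is taken large enough that $\log\log N>0$ and $j_0\le j_m$. *)

(* Defs.v *)
From HB Require Import structures.
From mathcomp Require Import all_boot all_order all_algebra.
From mathcomp Require Import complex.
From mathcomp Require Import all_classical all_reals all_analysis.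
From mathcomp Require Import measurable_realfun.
Set Implicit Arguments.
Unset Strict Implicit.
Unset Printing Implicit Defensive.
Import Order.TTheory GRing.Theory Num.Theory.
Import numFieldNormedType.Exports.
Import ComplexField.Normc.
Local Open Scope classical_set_scope.
Local Open Scope ring_scope.
Local Open Scope complex_scope.

(* Matrices carry the product sigma-algebra, generated by the entries; for    *)
(* entries in R this is the Borel sigma-algebra.                              *)
Definition mx_display : measure_display -> measure_display.
Proof. exact. Qed.

Section measurable_matrix.
Context {d : measure_display} {T : measurableType d} {m n : nat}.

Definition mx_measurable : set_system 'M[T]_(m, n) :=
  <<s \bigcup_(ij in [set: 'I_m * 'I_n])
        preimage_set_system setT (fun A : 'M[T]_(m, n) => A ij.1 ij.2)
          measurable >>.

Let mx_set0 : mx_measurable set0.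
Proof. exact: sigma_algebra0. Qed.

Let mx_setC A : mx_measurable A -> mx_measurable (~` A).
Proof. exact: sigma_algebraC. Qed.

Let mx_bigcup (F : (set 'M[T]_(m, n))^nat) :
  (forall i, mx_measurable (F i)) -> mx_measurable (\bigcup_i (F i)).
Proof. exact: sigma_algebra_bigcup. Qed.

HB.instance Definition _ := @isMeasurable.Build (mx_display d)
  'M[T]_(m, n) mx_measurable mx_set0 mx_setC mx_bigcup.

End measurable_matrix.

(* The sphere and the rotation group are subsets of 'cV[R]_3 and 'M[R]_3.     *)
(* Functions on them are total functions on the ambient space, of which only  *)
(* the values on the subset are ever used.                                    *)
Definition sphere (R : realType) : set 'cV[R]_3 :=
  [set x | \sum_i x i 0 ^+ 2 = 1].
Arguments sphere {R}.

Definition SO3 (R : realType) : set 'M[R]_3 :=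
  [set g | g^T *m g = 1%:M /\ \det g = 1].
Arguments SO3 {R}.

(* p = (theta, phi) = (colatitude, longitude) *)
Definition spherical_coord (R : realType) (p : R * R) : 'cV[R]_3 :=
  \col_i [:: sin p.1 * cos p.2; sin p.1 * sin p.2; cos p.1]`_i.

Section surface_measure.
Context {R : realType}.
Local Open Scope ereal_scope.

(* dx = sin(theta) dtheta dphi, as a measure on R^3 concentrated on the       *)
(* sphere; its total mass is 4 pi.                                            *)
Definition surface (A : set 'cV[R]_3) : \bar R :=
  \int[lebesgue_measure \x lebesgue_measure]_(p in
      (`[0%R, pi]%classic `*` `[0%R, (2 * pi)%R]%classic) `&`
      (@spherical_coord R @^-1` A)) (sin p.1)%:E.

Lemma measurable_spherical_coord :
  measurable_fun [set: R * R] (@spherical_coord R).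
Proof.
apply: (@measurability _ _ _ _ _ _ (\bigcup_(ij in [set: 'I_3 * 'I_1])
  preimage_set_system setT (fun A : 'cV[R]_3 => A ij.1 ij.2) measurable)) => //.
move=> B [C [ij _ [D mD <-]] <-]; rewrite !setTI.
suff mi : measurable_fun [set: R * R]
    (fun p => @spherical_coord R p ij.1 ij.2).
  by rewrite -[X in measurable X]setTI; exact: mi.
have ms1 : measurable_fun [set: R * R] (fun p : R * R => sin p.1).
  exact: (measurableT_comp (continuous_measurable_fun (@continuous_sin R))).
have mc1 : measurable_fun [set: R * R] (fun p : R * R => cos p.1).
  exact: (measurableT_comp (continuous_measurable_fun (@continuous_cos R))).
have ms2 : measurable_fun [set: R * R] (fun p : R * R => sin p.2).
  exact: (measurableT_comp (continuous_measurable_fun (@continuous_sin R))).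
have mc2 : measurable_fun [set: R * R] (fun p : R * R => cos p.2).
  exact: (measurableT_comp (continuous_measurable_fun (@continuous_cos R))).
case: (ij.1) => -[|[|[|//]]] lti.
- by under eq_fun do rewrite mxE /=; exact: measurable_funM.
- by under eq_fun do rewrite mxE /=; exact: measurable_funM.
- by under eq_fun do rewrite mxE /=.
Qed.

Let D0 : set (R * R) := `[0%R, pi]%classic `*` `[0%R, (2 * pi)%R]%classic.

Let surface0 : surface set0 = 0.
Proof. by rewrite /surface preimage_set0 setI0 integral_set0. Qed.

Let sin_D0_ge0 p : D0 p -> 0 <= (sin p.1)%:E.
Proof.
move=> [/=]; rewrite in_itv /= => /andP[p0 ppi] _.
by rewrite lee_fin sin_ge0_pi// p0 ppi.
Qed.

Let surface_ge0 A : 0 <= surface A.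
Proof. by apply: integral_ge0 => p [+ _]; exact: sin_D0_ge0. Qed.

Let surface_sigma_additive : semi_sigma_additive surface.
Proof.
move=> /= F mF tF mUF; rewrite /surface.
have mG k : measurable (D0 `&` (@spherical_coord R @^-1` F k)).
  apply: measurableI; first by apply: measurableX; exact: measurable_itv.
  by rewrite -[X in measurable X]setTI; exact: measurable_spherical_coord.
have G0 k p : (D0 `&` (@spherical_coord R @^-1` F k)) p -> 0 <= (sin p.1)%:E.
  by move=> [+ _]; exact: sin_D0_ge0.
apply: cvg_toP.
  apply: ereal_nondecreasing_is_cvgn => a b ab.
  apply: lee_sum_nneg_natr => // k _ _.
  by apply: integral_ge0 => p; exact: G0.
rewrite preimage_bigcup setI_bigcupr ge0_integral_bigcup//=.
- apply: measurable_funTS; apply/measurable_EFinP.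
  exact: (measurableT_comp (continuous_measurable_fun (@continuous_sin R))).
- by move=> p [k _]; exact: G0.
- apply/trivIsetP => a b _ _ ab.
  move/trivIsetP : tF => /(_ a b I I ab) Fab.
  by rewrite setIACA -preimage_setI Fab preimage_set0 setI0.
Qed.

HB.instance Definition _ := isMeasure.Build _ _ _ surface
  surface0 surface_ge0 surface_sigma_additive.

End surface_measure.

Definition haar_probability (R : realType) (mu : probability 'M[R]_3 R) : Prop :=
  mu SO3 = 1%E /\
  forall g, SO3 g -> forall A, measurable A -> mu (mulmx g @^-1` A) = mu A.

Definition cintegral (d : measure_display) (T : measurableType d)
    (R : realType) (mu : {measure set T -> \bar R}) (D : set T)
    (f : T -> R[i]) : R[i] :=
  (\int[mu]_(x in D) complex.Re (f x)) +i* (\int[mu]_(x in D) complex.Im (f x)).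

Definition legendre (R : realType) (l : nat) : {poly R} :=
  (2 ^+ l * l`!%:R)^-1 *: (('X^2 - 1) ^+ l)^`(l).

(* For 0 <= k <= l, in Cartesian coordinates and with the Condon-Shortley     *)
(* phase: on the sphere sin(theta)^k e^{i k phi} = (x_0 + i x_1)^k and        *)
(* P_l^k(cos theta) = (-1)^k sin(theta)^k P_l^{(k)}(x_2).                     *)
Definition spherical_harmonic_nneg (R : realType) (l k : nat) (x : 'cV[R]_3) :
    R[i] :=
  ((-1) ^+ k
   * Num.sqrt ((l.*2.+1)%:R / (4 * pi) * ((l - k)`!%:R / (l + k)`!%:R))
   * (legendre R l)^`(k).[x (inord 2) 0])%:C
  * (x (inord 0) 0 +i* x (inord 1) 0) ^+ k.

Definition spherical_harmonic (R : realType) (l : nat) (m : int)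
    (x : 'cV[R]_3) : R[i] :=
  match m with
  | Posz k => spherical_harmonic_nneg l k x
  | Negz k => (-1) ^+ k.+1 * (spherical_harmonic_nneg l k.+1 x)^*
  end.

(* Orders -l <= m <= l are encoded by 'I_(2l+1), the index i standing for     *)
(* m = i - l.                                                                 *)
Definition Y (R : realType) (l : nat) (i : 'I_l.*2.+1) (x : 'cV[R]_3) : R[i] :=
  spherical_harmonic l (i%:Z - l%:Z) x.

Definition sphere_fourier (R : realType) (f : 'cV[R]_3 -> R[i]) (l : nat)
    (i : 'I_l.*2.+1) : R[i] :=
  cintegral surface sphere (fun x => f x * (Y i x)^*).

Definition rotational_harmonics (R : realType)
    (D : forall l : nat, 'M[R]_3 -> 'M[R[i]]_l.*2.+1) : Prop :=
  forall l g x, SO3 g -> sphere x -> forall i : 'I_l.*2.+1,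
    (Y i (g *m x))^* = \sum_j D l g i j * (Y j x)^*.

Definition rot_fourier (R : realType) (mu : probability 'M[R]_3 R)
    (D : forall l : nat, 'M[R]_3 -> 'M[R[i]]_l.*2.+1) (fe : 'M[R]_3 -> R)
    (l : nat) : 'M[R[i]]_l.*2.+1 :=
  \matrix_(i, j) cintegral mu SO3 (fun g => (fe g)%:C * D l g i j).

Definition enorm (R : realType) (n : nat) (v : 'cV[R[i]]_n) : R :=
  Num.sqrt (\sum_i normc (v i 0) ^+ 2).

Definition opnorm (R : realType) (n : nat) (A : 'M[R[i]]_n) : R :=
  sup [set enorm (A *m v) | v in [set v | enorm v <= 1]].

(* F l is the Fourier transform of the noise density at order l *)
Definition ordinary_smooth (R : realType) (F : forall l : nat, 'M[R[i]]_l.*2.+1)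
    (nu d0 d1 : R) : Prop :=
  (forall l, F l \in unitmx) /\
  forall l, (0 < l)%N ->
    opnorm (invmx (F l)) <= d0^-1 * l%:R `^ nu /\
    opnorm (F l) <= d1 * l%:R `^ (- nu).

Definition probability_density (d : measure_display) (T : measurableType d)
    (R : realType) (mu : {measure set T -> \bar R}) (S : set T) (f : T -> R) :
    Prop :=
  [/\ measurable_fun S f, (forall x, S x -> 0 <= f x) &
      (\int[mu]_(x in S) (f x)%:E = 1)%E].

Definition has_density (d d' : measure_display) (Om : measurableType d)
    (T : measurableType d') (R : realType) (P : probability Om R)
    (V : Om -> T) (mu : {measure set T -> \bar R}) (S : set T) (f : T -> R) :
    Prop :=
  forall A, measurable A ->
    P (V @^-1` A) = (\int[mu]_(x in S `&` A) (f x)%:E)%E.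

Definition mutually_independent (d : measure_display) (Om : measurableType d)
    (R : realType) (P : probability Om R) (I : eqType)
    (G : I -> set_system Om) : Prop :=
  forall (r : seq I) (E : I -> set Om), uniq r ->
    (forall i, i \in r -> G i (E i)) ->
    P (\bigcap_(i in [set` r]) E i) = (\prod_(i <- r) P (E i))%E.

(* All the variables eps_0, eps_1, ..., X_0, X_1, ... are independent, i.e.   *)
(* each of the two sequences is independent and they are independent of each  *)
(* other. P f is the probability under which the X_i have density f.          *)
Definition noisy_sphere_model (d : measure_display) (Om : measurableType d)
    (R : realType) (mu : probability 'M[R]_3 R) (fe : 'M[R]_3 -> R)
    (P : ('cV[R]_3 -> R) -> probability Om R)
    (eps : nat -> Om -> 'M[R]_3) (X : nat -> Om -> 'cV[R]_3) : Prop :=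
  [/\ probability_density mu SO3 fe,
      (forall i, measurable_fun setT (eps i) /\ forall w, SO3 (eps i w)),
      (forall i, measurable_fun setT (X i) /\ forall w, sphere (X i w)) &
      forall f, probability_density surface sphere f ->
        [/\ (forall i, has_density (P f) (eps i) mu SO3 fe),
            (forall i, has_density (P f) (X i) surface sphere f) &
            mutually_independent (P f) (fun k : nat + nat =>
              match k with
              | inl i => preimage_set_system setT (eps i) measurable
              | inr i => preimage_set_system setT (X i) measurable
              end)]].

Definition f_unif (R : realType) (x : 'cV[R]_3) : R :=
  (4 * pi)^-1 * \1_sphere x.

Definition l2norm_sq (R : realType) (f : 'cV[R]_3 -> R[i]) : \bar R :=
  (\int[surface]_(x in sphere) (normc (f x) ^+ 2)%:E)%E.

Definition square_integrable (R : realType) (f : 'cV[R]_3 -> R[i]) : Prop :=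
  [/\ measurable_fun sphere (fun x => complex.Re (f x)),
      measurable_fun sphere (fun x => complex.Im (f x)) &
      (l2norm_sq f < +oo)%E].

Definition sobolev_norm_sq (R : realType) (s : R) (f : 'cV[R]_3 -> R[i]) :
    \bar R :=
  (\sum_(0 <= l <oo) \sum_(i < l.*2.+1)
     ((1 + (l * l.+1)%:R) `^ s * normc (sphere_fourier f i) ^+ 2)%:E)%E.

Fixpoint Ck (R : realType) (k : nat) (F : 'cV[R]_3 -> R) : Prop :=
  match k with
  | 0 => continuous F
  | k'.+1 => continuous F /\
      forall v, (forall x, derivable F x v) /\ Ck k' (fun x => 'D_v F x)
  end.

(* The sphere being a closed submanifold of R^3, its smooth functions are the *)
(* restrictions of the smooth functions on R^3.                               *)
Definition smooth_on_sphere (R : realType) (f : 'cV[R]_3 -> R[i]) : Prop :=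
  exists F G : 'cV[R]_3 -> R,
    [/\ (forall k, Ck k F), (forall k, Ck k G) &
        forall x, sphere x -> f x = F x +i* G x].

(* The completion of the smooth functions for the Sobolev norm, realized      *)
(* inside L2 (for s >= 0 the Sobolev norm dominates the L2 norm).             *)
Definition sobolev (R : realType) (s : R) (f : 'cV[R]_3 -> R[i]) : Prop :=
  square_integrable f /\
  exists g : nat -> 'cV[R]_3 -> R[i],
    (forall n, smooth_on_sphere (g n)) /\
    sobolev_norm_sq s (fun x => f x - g n x) @[n --> \oo] --> 0%E.

Definition sobolev_ball (R : realType) (s rad : R) : set ('cV[R]_3 -> R) :=
  [set f | [/\ probability_density surface sphere f,
               sobolev s (fun x => (f x)%:C) &
               (sobolev_norm_sq s (fun x => (f x)%:C)
                  <= ((4 * pi)^-1 + rad ^+ 2)%:E)%E]].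

Definition alternatives (R : realType) (s rad rho : R) : set ('cV[R]_3 -> R) :=
  [set f | sobolev_ball s rad f /\
           (rho%:E <= l2norm_sq (fun x => (f x - f_unif x)%:C))%E].

Definition Phi (R : realType) (F : forall l : nat, 'M[R[i]]_l.*2.+1)
    (l : nat) (i : 'I_l.*2.+1) (x : 'cV[R]_3) : R[i] :=
  \sum_j invmx (F l) i j * (Y j x)^*.

(* The observations Z_1, ..., Z_N are numbered from 0 *)
Definition T_stat (R : realType) (F : forall l : nat, 'M[R[i]]_l.*2.+1)
    (N : nat) (z : nat -> 'cV[R]_3) (L : nat) : R[i] :=
  \sum_(1 <= l < L.+1) \sum_(i < l.*2.+1)
    2 / (N%:R * (N%:R - 1)) *
      \sum_(i1 < N) \sum_(i2 < N | (i1 < i2)%N)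
        Phi F i (z i1) * (Phi F i (z i2))^*.

Definition loglog (R : realType) (N : nat) : R := ln (ln N%:R).

Definition log2 (R : realType) (x : R) : R := ln x / ln 2.

(* The absolute values only turn the exponents, which are nonnegative for     *)
(* large N, into natural numbers.                                             *)
Definition j_min (R : realType) (N : nat) : nat :=
  `|Num.ceil (log2 (loglog R N))|%N.

Definition j_max (R : realType) (N : nat) : nat :=
  `|Num.ceil (log2 (N%:R * loglog R N `^ (- (3 / 2))))|%N.

Definition resolutions (R : realType) (N : nat) : seq nat :=
  [seq (2 ^ j)%N | j <- index_iota (j_min R N) (j_max R N).+1].

Definition t_sq (R : realType) (nu : R) (N L : nat) : R :=
  L%:R `^ (2 * nu + 1) * Num.sqrt (loglog R N) / N%:R.

(* The maximum, of nonnegative reals, is taken from 0 *)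
Definition D_stat (R : realType) (F : forall l : nat, 'M[R[i]]_l.*2.+1)
    (nu K0 : R) (N : nat) (z : nat -> 'cV[R]_3) : nat :=
  (Num.sqrt (2 / K0) <
     \big[Num.max/0]_(L <- resolutions R N)
        (normc (T_stat F N z L) / t_sq nu N L))%R.

Definition deviation_constant (d : measure_display) (Om : measurableType d)
    (R : realType) (P0 : probability Om R)
    (F : forall l : nat, 'M[R[i]]_l.*2.+1) (nu : R)
    (Z : nat -> Om -> 'cV[R]_3) (K0 : R) : Prop :=
  0 < K0 /\ exists2 K1 : R, 0 < K1 &
    \forall N \near \oo, forall L, L \in resolutions R N ->
      let u := Num.sqrt (2 * K0^-1 * loglog R N) in
      (P0 [set w | (L%:R `^ (2 * nu + 1) * u / N%:R
                      < normc (T_stat F N (fun i => Z i w) L))%R]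
         <= (K1 * expR (- K0 * u ^+ 2))%:E)%E.

Definition psi_ad (R : realType) (s nu : R) (N : nat) : R :=
  (N%:R / Num.sqrt (loglog R N)) `^ (- (2 * s) / (2 * s + 2 * nu + 1)).

(* Main.v *)
(* Let [m_L] be the sum of the [|f_lm|^2] over [1 <= l <= L], the mean of [T_L] when the
   density is [f]. Under the null hypothesis a union bound over the at most [O(log N)]
   resolutions suffices: by the choice of the threshold each deviation has probability
   at most [K1 / (log N)^2].

   Under an alternative it is enough to look at one resolution [L*], the largest power of
   two below [(N / sqrt(log log N))^(1 / (2 s + 2 nu + 1))], for which [t_L*^2 <= psi] and
   [L*^(-2 s) <= 2^(2 s) psi]. By Parseval and the Sobolev bound, [|f - f_0|^2 - m_L*] is
   at most [(1/(4 pi) + rad^2) L*^(-2 s)], so [m_L*] exceeds [kappa t_L*^2] by a fixed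
   fraction of itself, where [kappa = sqrt (2 / K0)], and Chebyshev's inequality gives
   [O(1 / sqrt(log log N))] uniformly in [f].

   The variance of [T_L] is at most of order [lam tr / N^2 + lam m_L / N], where [lam] and
   [tr] bound the operator norm and the trace of the covariance matrix of the
   [Phi_lm(Z)]. Since the density of [Z] has absolutely summable Fourier series, uniformly
   over the class (for [s >= 1] and [nu > 0]), [E |g(Z)|^2 <= B |g|^2] for every
   trigonometric polynomial [g] on the sphere; hence [lam] is [O(L^(2 nu))] and [tr] is
   [O(L^(2 nu + 2))]. Completeness of the spherical harmonics, needed for Parseval,
   comes from polynomial approximation of the indicators of the sets [x_i < c], the sets
   with an L2-approximable indicator forming a sigma-algebra. *)

Require Import Defs.
From mathcomp Require Import all_boot all_order all_algebra.
From mathcomp Require Import complex.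
From mathcomp Require Import all_classical all_reals all_analysis.
From mathcomp Require Import measurable_realfun ring lra zify.
Import Order.TTheory GRing.Theory Num.Theory.
Import numFieldNormedType.Exports.
Import ComplexField.Normc.
Local Open Scope classical_set_scope.
Local Open Scope ring_scope.
Set Implicit Arguments.
Unset Strict Implicit.
Unset Printing Implicit Defensive.

(** * Legendre polynomials *)

Section legendre_polynomials.
Variable R : realType.
Implicit Types p q : {poly R}.

(** The harmonics are explicit formulas and the rotation matrices are known only through their
    action on them. Orthonormality, the value (2l + 1) / (4 pi) of the sum over m of |Y_lm|^2, and
    the measurability of the rotation coefficients must therefore be extracted; the first two become
    polynomial identities for derivatives of Legendre polynomials.

    A harmonic of an observation is a finite sum of products of a function of the rotation and a
    function of X; independence is used on such sums alone.

    The constant B comes from the degree l term of the Fourier series, at most |F_l| sqrt(E_l)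
    sqrt(l) with E_l the energy of f: l sqrt(E_l) is square summable as s >= 1, and l^(-nu - 1/2) is
    as nu > 0.

    Write t for t_L*^2, m for m_L* and q = sqrt(log log N). Then t / q = L*^(2 nu + 1) / N, so the
    variance is at most a constant times (t / q)^2 + (t / q) m. The hypothesis on the constant C
    says exactly that C' = C - (1/(4 pi) + rad^2) 2^(2 s) exceeds kappa; as m >= C' t, the variance
    divided by (m - kappa t)^2 is O(1 / q). *)

Definition primitive q : {poly R} :=
  \poly_(i < (size q).+1) (q`_i.-1 / i%:R).

Lemma coef_primitive q i : (primitive q)`_i = q`_i.-1 / i%:R.
Proof.
rewrite coef_poly ltnS; case: leqP => // lt_qi.
by case: i lt_qi => [//|i] /= lt_qi; rewrite nth_default ?mul0r.
Qed.

Lemma deriv_primitive q : (primitive q)^`() = q.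
Proof.
apply/polyP => i; rewrite coef_deriv coef_primitive /= -[LHS]mulr_natr -mulrA.
by rewrite mulVf ?mulr1 // pnatr_eq0.
Qed.

(** The integral over [-1, 1], kept formal so that orthogonality of the Legendre functions is
    polynomial algebra; [Rintegral_sin_horner_cos] links it with Lebesgue measure. *)
Definition integral11 q : R := (primitive q).[1] - (primitive q).[-1].

Lemma integral11D p q : integral11 (p + q) = integral11 p + integral11 q.
Proof.
rewrite /integral11; have -> : primitive (p + q) = primitive p + primitive q.
  by apply/polyP => i; rewrite coefD !coef_primitive coefD mulrDl.
rewrite !hornerD; ring.
Qed.

Lemma integral11Z a q : integral11 (a *: q) = a * integral11 q.
Proof.
rewrite /integral11; have -> : primitive (a *: q) = a *: primitive q.
  by apply/polyP => i; rewrite coefZ !coef_primitive coefZ mulrA.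
by rewrite !hornerZ mulrBr.
Qed.

Lemma integral11B p q : integral11 (p - q) = integral11 p - integral11 q.
Proof. by rewrite integral11D -scaleN1r integral11Z mulN1r. Qed.

Lemma integral11_sum (I : Type) (r : seq I) (F : I -> {poly R}) :
  integral11 (\sum_(i <- r) F i) = \sum_(i <- r) integral11 (F i).
Proof.
elim/big_rec2 : _ => [|i y x _ <-]; last exact: integral11D.
by rewrite -(scale0r 0) integral11Z mul0r.
Qed.

Lemma deriv_eq0_const q : q^`() = 0 -> q = (q`_0)%:P.
Proof.
move=> q0; apply/polyP => -[|i]; rewrite coefC //=.
have := congr1 (fun r : {poly R} => r`_i) q0; rewrite coef_deriv coef0.
by move/eqP; rewrite mulrn_eq0 /= => /eqP.
Qed.

Lemma integral11_deriv q : integral11 q^`() = q.[1] - q.[-1].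
Proof.
have /deriv_eq0_const E : (primitive q^`() - q)^`() = 0.
  by rewrite derivB deriv_primitive subrr.
rewrite /integral11 -(subrK q (primitive _)) E !hornerD !hornerC; ring.
Qed.

(** Of the Leibniz expansion at [c] only the term in which all [l] derivatives fall on the power
    survives. With [c = 1] this evaluates Rodrigues' formula. *)
Lemma derivn_horner_XsubC (c : R) l q :
  (('X - c%:P) ^+ l * q)^`(l).[c] = l`!%:R * q.[c].
Proof.
elim: l q => [|l IH] q; first by rewrite expr0 mul1r derivn0 mul1r.
rewrite derivSn.
have -> : (('X - c%:P) ^+ l.+1 * q)^`() =
    ('X - c%:P) ^+ l * (l.+1%:R * q + ('X - c%:P) * q^`()).
  by rewrite derivM deriv_exp derivXsubC mul1r /= exprS -[_ *+ _]mulr_natr; ring.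
rewrite IH factS natrM hornerD !hornerM hornerXsubC subrr mul0r addr0.
by rewrite -polyC_natr hornerC; ring.
Qed.

Lemma deriv_natM n q : (n%:R * q)^`() = n%:R * q^`().
Proof. by rewrite mulr_natl derivMn mulr_natl. Qed.

Lemma deriv_nat n : (n%:R : {poly R})^`() = 0.
Proof. by rewrite -polyC_natr derivC. Qed.

(** The polynomial [u] solves (X^2 - 1) u' = 2 l X u; the identity is the derivative of order n + 1
    of this equation, one differentiation per induction step. *)
Lemma rodrigues_ode l n : let u := ('X^2 - 1 : {poly R}) ^+ l in
  ('X^2 - 1) * u^`(n.+2) + (2 * n.+1%:R - 2 * l%:R) * 'X * u^`(n.+1)
    + (n.+1%:R * n%:R - 2 * l%:R * n.+1%:R) * u^`(n) = 0.
Proof.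
move=> u.
have dX : ('X^2 - 1 : {poly R})^`() = 2 * 'X.
  by rewrite derivB derivXn derivC subr0 /= mulr_natl.
elim: n => [|n IH].
  have u1 : ('X^2 - 1) * u^`() = (2 * l)%:R * ('X * u).
    rewrite /u deriv_exp dX natrM; case: l {u} => [|l]; first by ring.
    by move: ('X^2 - 1 : {poly R}) => w; rewrite /= -[_ *+ l.+1]mulr_natr exprS; ring.
  have := congr1 (fun p => p^`()) u1; rewrite deriv_natM !derivM dX derivX => u2.
  rewrite [u^`(2)]derivnS !derivn1 !derivn0.
  transitivity (2 * 'X * u^`() + ('X^2 - 1) * u^`()^`() -
    (2 * l)%:R * (1 * u + 'X * u^`())); first by rewrite natrM; ring.
  by rewrite u2 subrr.
have := congr1 (fun p => p^`()) IH.
set a := 2 * _ - _; set b := _ - 2 * l%:R * _.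
have a0 : a^`() = 0 by rewrite /a -!natrM derivB !deriv_nat subrr.
have b0 : b^`() = 0 by rewrite /b -!natrM derivB !deriv_nat subrr.
rewrite deriv0 !derivD !derivM a0 b0 dX derivX -!derivnS !mul0r !add0r mulr1.
move=> <-; rewrite /a /b; ring.
Qed.

Lemma derivn_comp p m n : p^`(m)^`(n) = p^`(m + n).
Proof. by rewrite /derivn addnC iterD. Qed.

(** Legendre's equation differentiated [k] times. It is [rodrigues_ode] at order l + k, with l(l +
    1) - k(k + 1) = (l - k)(l + k + 1). *)
Lemma deriv_legendre_ode l k : let p := legendre R l in
  (1 - 'X^2) * p^`(k.+2) - 2 * k.+1%:R * 'X * p^`(k.+1)
    + (l%:R - k%:R) * (l + k).+1%:R * p^`(k) = 0.
Proof.
move=> p; rewrite {}/p /legendre !derivnZ !derivn_comp !addnS.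
have := rodrigues_ode l (l + k); set u := _ ^+ l => /= E.
set c := (_ ^-1); rewrite -!scalerAr -scalerBr -scalerDr.
apply/eqP; rewrite scaler_eq0; apply/orP; right; apply/eqP.
rewrite -[RHS]oppr0 -{}E -addn1 !natrD; ring.
Qed.

Lemma legendre1 l : (legendre R l).[1] = 1.
Proof.
have -> : legendre R l =
    (2 ^+ l * l`!%:R)^-1 *: (('X - 1%:P) ^+ l * ('X + 1%:P) ^+ l)^`(l).
  by rewrite -exprMn /legendre; congr (_ *: (_ ^+ _)^`(_)); rewrite !polyC1; ring.
rewrite hornerZ derivn_horner_XsubC horner_exp hornerD hornerX hornerC.
by rewrite [2 ^+ l * _]mulrC mulVf // mulf_neq0 ?expf_neq0 ?pnatr_eq0 -?lt0n ?fact_gt0.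
Qed.

Lemma size_deriv_char0 p : size p^`() = (size p).-1.
Proof.
have [->|p0] := eqVneq p 0; first by rewrite deriv0 size_poly0.
have [p1|p1] := leqP (size p) 1.
  by rewrite (size1_polyC p1) derivC size_poly0 size_polyC; case: eqP.
apply/eqP; rewrite eqn_leq; apply/andP; split.
  by rewrite -ltnS prednK ?lt_size_deriv// lt0n size_poly_eq0.
rewrite -[(size p).-1]prednK; last by rewrite -subn1 subn_gt0.
rewrite ltnNge; apply/negP => /leq_sizeP/(_ _ (leqnn _)).
rewrite coef_deriv prednK; last by rewrite -subn1 subn_gt0.
move/eqP; rewrite mulrn_eq0 -/(lead_coef p) lead_coef_eq0 (negPf p0) orbF.
by rewrite -subn1 subn_eq0 leqNgt p1.
Qed.

Lemma size_derivn_char0 p n : size p^`(n) = (size p - n)%N.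
Proof.
elim: n => [|n IH]; first by rewrite derivn0 subn0.
by rewrite derivnS size_deriv_char0 IH subnS.
Qed.

Lemma size_legendre l : size (legendre R l) = l.+1.
Proof.
have c0 : (2 ^+ l * l`!%:R)^-1 != 0 :> R.
  by rewrite invr_eq0 mulf_neq0 ?expf_neq0 ?pnatr_eq0 -?lt0n ?fact_gt0.
have w3 : size ('X^2 - 1 : {poly R}) = 3%N by rewrite size_XnsubC.
have sz : size (('X^2 - 1 : {poly R}) ^+ l) = l.*2.+1.
  rewrite -[LHS]prednK ?size_exp ?w3 ?mul2n// lt0n size_poly_eq0 expf_neq0//.
  by rewrite -size_poly_eq0 w3.
by rewrite /legendre size_scale // size_derivn_char0 sz -addnn -addnS addnC addnK.
Qed.

Lemma size_deriv_legendre l k : size (legendre R l)^`(k) = (l.+1 - k)%N.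
Proof. by rewrite size_derivn_char0 size_legendre. Qed.

(** The factorial ratio in the squared normalization of the harmonics of orders k and -k. *)
Definition legendre_weight l k : R := (l - k)`!%:R / (l + k)`!%:R.

Lemma legendre_weight_gt0 l k : 0 < legendre_weight l k.
Proof. by rewrite divr_gt0 // ltr0n fact_gt0. Qed.

Lemma legendre_weight0 l : legendre_weight l 0 = 1.
Proof.
by rewrite /legendre_weight subn0 addn0 divff // pnatr_eq0 -lt0n fact_gt0.
Qed.

Lemma legendre_weightS l k : (k < l)%N ->
  legendre_weight l k.+1 * ((l%:R - k%:R) * (l + k).+1%:R) = legendre_weight l k.
Proof.
move=> kl; rewrite /legendre_weight addnS factS.
have -> : (l - k)`! = ((l - k) * (l - k.+1)`!)%N by rewrite -(subnSK kl) factS.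
rewrite !natrM -natrB; last exact: ltnW.
have b0 : (l + k)`!%:R != 0 :> R by rewrite pnatr_eq0 -lt0n fact_gt0.
have a0 : (l + k).+1%:R != 0 :> R by rewrite pnatr_eq0.
by move: (_.+1%:R) (_`!%:R) a0 b0 => a b a0 b0; field; rewrite a0 b0.
Qed.

(** The weighted square of the associated Legendre function of degree [l] and order [k], as a
    polynomial in the cosine of the colatitude. *)
Definition assoc_legendre_sq l k : {poly R} :=
  legendre_weight l k *: ((1 - 'X^2) ^+ k * (legendre R l)^`(k) ^+ 2).

(** By the differentiated Legendre equation, the derivative of the square of order k + 1 is the
    difference of these polynomials at k + 1 and k. At k = l it vanishes, since l + 1 derivatives
    kill a polynomial of degree l. *)
Definition telescoper l k : {poly R} :=
  legendre_weight l k *: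
    ((1 - 'X^2) ^+ k * (legendre R l)^`(k) * (legendre R l)^`(k.+1)).

Lemma deriv_1subX2 : (1 - 'X^2 : {poly R})^`() = - (2 * 'X).
Proof. by rewrite derivB derivXn derivC sub0r /= mulr_natl. Qed.

Lemma deriv_assoc_legendre_sq0 l :
  (assoc_legendre_sq l 0)^`() = 2 * telescoper l 0.
Proof.
rewrite /assoc_legendre_sq /telescoper !expr0 !mul1r derivZ deriv_exp /=.
by rewrite !legendre_weight0 !scale1r expr1 -[_ *+ 2]mulr_natl; ring.
Qed.

Lemma deriv_assoc_legendre_sq l k : (k < l)%N ->
  (assoc_legendre_sq l k.+1)^`() = telescoper l k.+1 - telescoper l k.
Proof.
move=> kl; have := deriv_legendre_ode l k; rewrite /assoc_legendre_sq /telescoper.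
rewrite -(legendre_weightS kl); move: (legendre_weight l k.+1) => c.
set p := legendre R l; move: ('X^2 : {poly R}) deriv_1subX2 => x2 dw; cbv zeta => ode.
rewrite -scalerA -scalerBr derivZ; congr (_ *: _).
rewrite derivM !deriv_exp dw -[(p^`(k.+1))^`()]derivnS -!pred_Sn.
move: ode; have -> : (l%:R - k%:R) * (l + k).+1%:R = ((l%:R - k%:R) * (l + k).+1%:R)%:P :> {poly R}.
  by rewrite !polyCM polyCB !polyC_natr.
rewrite -mul_polyC; move: (((l%:R - k%:R) * (l + k).+1%:R)%:P) => d.
move: (p^`(k)) (p^`(k.+1)) (p^`(k.+2)) => p0 p1 p2 ode.
rewrite -[_ *+ k.+1]mulr_natr [_ ^+ k.+1]exprS.
apply/eqP; rewrite -subr_eq0; apply/eqP.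
transitivity ((1 - x2) ^+ k * p1 *
  ((1 - x2) * p2 - 2 * k.+1%:R * 'X * p1 + d * p0)); last by rewrite ode mulr0.
ring.
Qed.

(** The addition theorem on the diagonal. The derivatives of the summands telescope to zero, so the
    sum is constant; at 1 every factor 1 - X^2 vanishes and the term of order 0 is 1 by
    [legendre1]. *)
Lemma sum_assoc_legendre_sq l :
  assoc_legendre_sq l 0 + 2 * \sum_(k < l) assoc_legendre_sq l k.+1 = 1.
Proof.
pose S := assoc_legendre_sq l 0 + 2 * \sum_(k < l) assoc_legendre_sq l k.+1.
have dS : S^`() = 0.
  rewrite /S derivD deriv_natM deriv_assoc_legendre_sq0 raddf_sum /=.
  rewrite (eq_bigr (fun k : 'I_l => telescoper l k.+1 - telescoper l k)); last first.
    by move=> k _; rewrite deriv_assoc_legendre_sq.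
  rewrite -(big_mkord xpredT (fun k => telescoper l k.+1 - telescoper l k)).
  rewrite telescope_sumr // /telescoper.
  have -> : (legendre R l)^`(l.+1) = 0.
    by apply/eqP; rewrite -size_poly_eq0 size_deriv_legendre subnn.
  by rewrite mulr0 scaler0; ring.
have SE y : S.[y] = (assoc_legendre_sq l 0).[y] +
    2 * \sum_(k < l) (assoc_legendre_sq l k.+1).[y].
  by rewrite /S hornerD hornerM horner_sum -polyC_natr hornerC.
suff S1 : S.[1] = 1.
  by move: S1; rewrite -/S (deriv_eq0_const dS) hornerC => ->.
rewrite SE.
rewrite big1 => [|k _].
  rewrite /assoc_legendre_sq legendre_weight0 scale1r expr0 mul1r horner_exp.
  by rewrite derivn0 legendre1; ring.
rewrite /assoc_legendre_sq hornerZ hornerM horner_exp.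
by rewrite hornerD hornerN hornerXn hornerC expr1n subrr expr0n /= mul0r mulr0.
Qed.

Definition assoc_legendre_dot k l l' : R :=
  integral11 ((1 - 'X^2) ^+ k * (legendre R l)^`(k) * (legendre R l')^`(k)).

Lemma assoc_legendre_dotC k l l' : assoc_legendre_dot k l l' = assoc_legendre_dot k l' l.
Proof. by rewrite /assoc_legendre_dot mulrAC. Qed.

(** Integration by parts. The factor (1 - X^2)^(k + 1) kills the boundary values, and by the
    differentiated Legendre equation its product with the derivative of order k + 1 has derivative
    -(l - k)(l + k + 1)(1 - X^2)^k times the derivative of order k. *)
Lemma assoc_legendre_dotS k l l' : assoc_legendre_dot k.+1 l l' =
  (l%:R - k%:R) * (l + k).+1%:R * assoc_legendre_dot k l l'.
Proof.
have := deriv_legendre_ode l k; rewrite /assoc_legendre_dot.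
set p := legendre R l; set q := legendre R l'; cbv zeta => ode.
have := integral11_deriv ((1 - 'X^2) ^+ k.+1 * p^`(k.+1) * q^`(k)).
have v (y : R) : y ^+ 2 = 1 -> (1 - 'X^2 : {poly R}).[y] = 0.
  by move=> y2; rewrite hornerD hornerN hornerXn hornerC y2 subrr.
rewrite !hornerM !horner_exp !v ?expr1n ?sqrrN ?expr1n// expr0n !mul0r subrr.
rewrite !derivM deriv_exp deriv_1subX2 -[(p^`(k.+1))^`()]derivnS -[(q^`(k))^`()]derivnS -!pred_Sn.
move: ('X^2 : {poly R}) ode => x2 ode.
set c := (_ - _) * _.
have cE : c%:P = (l%:R - k%:R) * (l + k).+1%:R.
  by rewrite !polyCM polyCB !polyC_natr.
rewrite -integral11Z -mul_polyC => E; apply/eqP; rewrite -subr_eq0.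
rewrite -integral11B -{}E; apply/eqP; congr integral11.
move: ode; rewrite -cE; move: (c%:P) => d.
move: (p^`(k)) (p^`(k.+1)) (p^`(k.+2)) (q^`(k)) (q^`(k.+1)) => p0 p1 p2 q0 q1 ode.
rewrite -[_ *+ k.+1]mulr_natr [_ ^+ k.+1]exprS.
apply/eqP; rewrite -subr_eq0; apply/eqP.
transitivity (- ((1 - x2) ^+ k * q0) *
  ((1 - x2) * p2 - 2 * k.+1%:R * 'X * p1 + d * p0)); last by rewrite ode mulr0.
ring.
Qed.

(** Symmetry of the Legendre operator: [assoc_legendre_dotS] at k = 0, read with either degree
    first, multiplies the same number by l(l + 1) and by l'(l' + 1). Higher [k] follow by the
    recursion. *)
Lemma assoc_legendre_dot_neq k l l' : l != l' -> assoc_legendre_dot k l l' = 0.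
Proof.
move=> ll'; elim: k => [|k IH]; last by rewrite assoc_legendre_dotS IH mulr0.
have := assoc_legendre_dotS 0 l' l; rewrite 2!(assoc_legendre_dotC _ l').
rewrite assoc_legendre_dotS !subr0 !addn0 => /eqP.
rewrite -subr_eq0 -mulrBl mulf_eq0 => /orP[|/eqP//].
rewrite -!natrM subr_eq0 eqr_nat => /eqP E; exfalso; move/eqP: ll'; apply; nia.
Qed.

(** By [assoc_legendre_dotS] and [legendre_weightS] the left side does not depend on [k];
    integrating [sum_assoc_legendre_sq] makes 2l + 1 copies of it equal to the integral of 1, which
    is 2. *)
Lemma assoc_legendre_dot_eq k l : (k <= l)%N ->
  legendre_weight l k * assoc_legendre_dot k l l = 2 / l.*2.+1%:R.
Proof.
have sqE j : integral11 (assoc_legendre_sq l j) =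
    legendre_weight l j * assoc_legendre_dot j l l.
  by rewrite integral11Z expr2 mulrA.
have step j : (j <= l)%N -> legendre_weight l j * assoc_legendre_dot j l l =
    assoc_legendre_dot 0 l l.
  elim: j => [|j IH] jl; first by rewrite legendre_weight0 mul1r.
  by rewrite assoc_legendre_dotS mulrA legendre_weightS// IH// ltnW.
move=> /step ->.
have : integral11 (1 : {poly R}) = 2.
  by rewrite -(derivX R) integral11_deriv !hornerX; ring.
rewrite -(sum_assoc_legendre_sq l) integral11D sqE step// mulr_natl -scaler_nat.
rewrite integral11Z integral11_sum.
rewrite (eq_bigr (fun=> assoc_legendre_dot 0 l l)) => [|i _]; last by rewrite sqE step.
rewrite sumr_const card_ord -mulr_natl => <-.
have : l.*2.+1%:R != 0 :> R by rewrite pnatr_eq0.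
rewrite -natr1 -mul2n natrM => n0; field; exact: n0.
Qed.

End legendre_polynomials.

(** * Complex-valued integrals *)

Import HBNNSimple.

(** * Change of variables with a weight *)

Section transfer.
Local Open Scope ereal_scope.
Context {R : realType} (d1 d2 : measure_display).
Variables (T1 : measurableType d1) (T2 : measurableType d2).
Variables (P : {measure set T1 -> \bar R}) (D : set T1).
Variables (m : {measure set T2 -> \bar R}) (S : set T2).
Variables (V : T1 -> T2) (Y : T1 -> R) (f : T2 -> R).
Hypotheses (mD : measurable D) (mS : measurable S).
Hypotheses (mV : measurable_fun D V) (mY : measurable_fun D Y).
Hypotheses (Y0 : forall x, D x -> (0 <= Y x)%R) (f0 : forall x, S x -> (0 <= f x)%R).
Hypothesis (mf : measurable_fun S f).
Hypothesis H : forall B, measurable B ->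
  \int[P]_(x in D `&` V @^-1` B) (Y x)%:E = \int[m]_(y in S `&` B) (f y)%:E.

Lemma integral_setI_indic d (T : measurableType d) (nu : {measure set T -> \bar R})
    (E A : set T) (g : T -> R) :
  \int[nu]_(x in E `&` A) (g x)%:E = \int[nu]_(x in E) (\1_A x * g x)%:E.
Proof.
rewrite integral_mkcondr; apply: eq_integral => x _.
by rewrite patchE indicE; case: ifP => _; rewrite ?mul1r ?mul0r.
Qed.

Lemma transfer_nnsfun (phi : {nnsfun T2 >-> R}) :
  \int[P]_(x in D) (phi (V x) * Y x)%:E = \int[m]_(y in S) (phi y * f y)%:E.
Proof.
have mphiV r : measurable_fun D (fun x => \1_(phi @^-1` [set r]) (V x) : R).
  have mi : measurable_fun setT (\1_(phi @^-1` [set r]) : T2 -> R).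
    by apply: measurable_indic; exact: measurable_sfunP.
  exact: (measurableT_comp mi mV).
transitivity (\int[P]_(x in D) (\sum_(r \in range phi)
    (r * \1_(phi @^-1` [set r]) (V x) * Y x)%:E)).
  apply: eq_integral => x _; rewrite fimfunE mulr_fsuml ?fsumEFin//.
transitivity (\int[m]_(y in S) (\sum_(r \in range phi)
    (r * \1_(phi @^-1` [set r]) y * f y)%:E)); last first.
  apply: eq_integral => x _; rewrite fimfunE mulr_fsuml ?fsumEFin//.
have nn r y : (0 <= r * \1_(phi @^-1` [set r]) y)%R.
  by have := nnfun_muleindic_ge0 phi r y; rewrite lee_fin.
rewrite !ge0_integral_fsum //.
- apply: eq_fsbigr => r _.
  have mA : measurable (phi @^-1` [set r]) by exact: measurable_sfunP.
  have [r0|r0] := ltP r 0%R.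
    have e : phi @^-1` [set r] = set0.
      by apply/seteqP; split => // y /= yr; move: r0; rewrite -yr ltNge fun_ge0.
    by rewrite e !integral0_eq// => x _; rewrite indic0 mulr0 mul0r.
  under eq_integral do rewrite -mulrA EFinM.
  under [RHS]eq_integral do rewrite -mulrA EFinM.
  rewrite !ge0_integralZl_EFin//.
  + congr (_ * _); rewrite -[RHS]integral_setI_indic -H // integral_setI_indic.
    by apply: eq_integral.
  + by move=> y Sy; rewrite lee_fin mulr_ge0// f0.
  + by apply/measurable_EFinP; apply: measurable_funM => //; exact: measurable_funTS.
  + by move=> y Sy; rewrite lee_fin mulr_ge0// Y0.
  + by apply/measurable_EFinP; apply: measurable_funM.
- move=> r; apply/measurable_EFinP; apply: measurable_funM => //.
  by apply: measurable_funM => //; exact: measurable_funTS.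
- by move=> r y Sy; rewrite lee_fin mulr_ge0// f0.
- move=> r; apply/measurable_EFinP; apply: measurable_funM => //.
  exact: measurable_funM.
- by move=> r y Dy; rewrite lee_fin mulr_ge0// Y0.
Qed.

(** Equality on sets extends to simple functions, then to nonnegative functions by monotone
    convergence. The weight [Y] makes the statement serve polar coordinates, laws with a density,
    and factorization under independence. *)
Lemma ge0_integral_transfer (phi : T2 -> R) :
  measurable_fun setT phi -> (forall y, 0 <= phi y)%R ->
  \int[P]_(x in D) (phi (V x) * Y x)%:E = \int[m]_(y in S) (phi y * f y)%:E.
Proof.
move=> mphi phi0.
have mphiE : measurable_fun setT (EFin \o phi) by exact/measurable_EFinP.
pose g := nnsfun_approx measurableT mphiE.
have gphi y : (g n y)%:E @[n --> \oo] --> (phi y)%:E.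
  by apply: (cvg_nnsfun_approx measurableT mphiE) => // x _; rewrite lee_fin.
have limM (c : R) y : (0 <= c)%R -> limn (fun n => (g n y * c)%:E) = (phi y * c)%:E.
  move=> c0; apply/cvg_lim => //; apply: cvg_EFin; first by near=> n.
  by apply: cvgMl; move/fine_cvgP : (gphi y) => [].
have mono (c : R) y : (0 <= c)%R ->
    {homo (fun n => (g n y * c)%:E) : a b / (a <= b)%N >-> a <= b}.
  move=> c0 a b ab; rewrite lee_fin ler_wpM2r//.
  by have /lefP := nd_nnsfun_approx measurableT mphiE ab; exact.
have mg n : measurable_fun setT (g n) by exact: measurable_funP.
have c1 : (fun n => \int[P]_(x in D) (g n (V x) * Y x)%:E) @ \oo -->
    \int[P]_(x in D) (phi (V x) * Y x)%:E.
  rewrite (_ : \int[P]_(x in D) _ =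
      \int[P]_(x in D) limn (fun n => (g n (V x) * Y x)%:E)); last first.
    by apply: eq_integral => x /set_mem Dx; rewrite limM ?Y0.
  apply: cvg_monotone_convergence => //.
  + move=> n; apply/measurable_EFinP; apply: measurable_funM => //.
    exact: (measurableT_comp (mg n)).
  + by move=> n x Dx; rewrite lee_fin mulr_ge0// Y0.
  + by move=> x Dx; apply: mono; exact: Y0.
have c2 : (fun n => \int[m]_(x in S) (g n x * f x)%:E) @ \oo -->
    \int[m]_(x in S) (phi x * f x)%:E.
  rewrite (_ : \int[m]_(x in S) _ =
      \int[m]_(x in S) limn (fun n => (g n x * f x)%:E)); last first.
    by apply: eq_integral => x /set_mem Dx; rewrite limM ?f0.
  apply: cvg_monotone_convergence => //.
  + move=> n; apply/measurable_EFinP; apply: measurable_funM => //.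
    exact: measurable_funTS.
  + by move=> n x Dx; rewrite lee_fin mulr_ge0// f0.
  + by move=> x Dx; apply: mono; exact: f0.
rewrite -(cvg_lim (@ereal_hausdorff _) c1) -(cvg_lim (@ereal_hausdorff _) c2).
by under eq_fun do rewrite transfer_nnsfun.
Unshelve. all: by end_near.
Qed.

End transfer.

(** * Complex moduli and the Cauchy-Schwarz inequality *)

Section complex_arithmetic.
Local Open Scope complex_scope.
Local Open Scope ring_scope.
Context {R : realType}.
Implicit Types x y z : R[i].

Lemma ReD x y : complex.Re (x + y) = complex.Re x + complex.Re y.
Proof. by case: x y => [a b] [c e]. Qed.

Lemma ImD x y : complex.Im (x + y) = complex.Im x + complex.Im y.
Proof. by case: x y => [a b] [c e]. Qed.

Lemma ReM x y : complex.Re (x * y) =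
  complex.Re x * complex.Re y - complex.Im x * complex.Im y.
Proof. by case: x y => [a b] [c e]. Qed.

Lemma ImM x y : complex.Im (x * y) =
  complex.Re x * complex.Im y + complex.Im x * complex.Re y.
Proof. by case: x y => [a b] [c e]. Qed.

Lemma Re_conjc x : complex.Re x^* = complex.Re x.
Proof. by case: x. Qed.

Lemma Im_conjc x : complex.Im x^* = - complex.Im x.
Proof. by case: x. Qed.

Lemma conj_Complex (a b : R) : (a +i* b)^* = a -i* b.
Proof. by []. Qed.

Lemma conj_real (a : R) : (a%:C)^* = a%:C.
Proof. exact: conjc_real. Qed.

Lemma complex_eta x : x = complex.Re x +i* complex.Im x.
Proof. by case: x. Qed.

Lemma normc_ge0 x : 0 <= normc x.
Proof. by case: x => a b; rewrite sqrtr_ge0. Qed.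

Lemma normc_sqr x : normc x ^+ 2 = complex.Re x ^+ 2 + complex.Im x ^+ 2.
Proof. by case: x => a b; rewrite sqr_sqrtr // addr_ge0 // sqr_ge0. Qed.

Lemma mulc_conj x : x * x^* = (normc x ^+ 2)%:C.
Proof. by rewrite normc_sqr; case: x => a b; apply/eqP; rewrite eq_complex /=; apply/andP; split; apply/eqP; ring. Qed.

Lemma normc_conj x : normc x^* = normc x.
Proof. by case: x => a b /=; rewrite sqrrN. Qed.

Lemma normc_real (a : R) : normc a%:C = `|a|.
Proof. by rewrite /= expr0n /= addr0 sqrtr_sqr. Qed.

Lemma le_Re_normc x : `|complex.Re x| <= normc x.
Proof.
rewrite -(@ler_pXn2r _ 2)// ?nnegrE ?normc_ge0//.
by rewrite normc_sqr real_normK ?num_real// lerDl sqr_ge0.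
Qed.

Lemma le_Im_normc x : `|complex.Im x| <= normc x.
Proof.
rewrite -(@ler_pXn2r _ 2)// ?nnegrE ?normc_ge0//.
by rewrite normc_sqr real_normK ?num_real// lerDr sqr_ge0.
Qed.

Lemma le_normc_sum (I : Type) (r : seq I) (Q : pred I) (F : I -> R[i]) :
  normc (\sum_(i <- r | Q i) F i) <= \sum_(i <- r | Q i) normc (F i).
Proof.
elim/big_rec2: _ => [|i y x _ yx]; first by rewrite normc0.
by apply: le_trans (le_normcD _ _) _; rewrite lerD2l.
Qed.

Lemma normc_sqrD x y : normc (x + y) ^+ 2 <= 2 * normc x ^+ 2 + 2 * normc y ^+ 2.
Proof.
rewrite !normc_sqr ReD ImD.
move: (complex.Re x) (complex.Im x) (complex.Re y) (complex.Im y) => a b c e.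
have := sqr_ge0 (a - c); have := sqr_ge0 (b - e); nra.
Qed.

Lemma normc_sqrB x y : normc (x - y) ^+ 2 = normc x ^+ 2 + normc y ^+ 2
  - 2 * complex.Re (x * y^*).
Proof.
rewrite !normc_sqr ReM Re_conjc Im_conjc; case: x y => [a b] [c e] /=; ring.
Qed.

Lemma cauchy_schwarz_sum (I : finType) (a b : I -> R) :
  (\sum_i a i * b i) ^+ 2 <= (\sum_i a i ^+ 2) * (\sum_i b i ^+ 2).
Proof.
set A := \sum_i a i ^+ 2; set B := \sum_i b i ^+ 2; set S := \sum_i _.
have A0 : 0 <= A by apply: sumr_ge0 => i _; exact: sqr_ge0.
have B0 : 0 <= B by apply: sumr_ge0 => i _; exact: sqr_ge0.
have q (t : R) : 0 <= A - 2 * t * S + t ^+ 2 * B.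
  rewrite (_ : _ + _ = \sum_i (a i - t * b i) ^+ 2).
    by apply: sumr_ge0 => i _; exact: sqr_ge0.
  rewrite /A /B /S !mulr_sumr -sumrB -big_split /=.
  by apply: eq_bigr => i _; ring.
have [B00|Bn0] := eqVneq B 0.
  have b0 i : b i = 0.
    apply/eqP; rewrite -sqrf_eq0; apply/eqP.
    by move/psumr_eq0P : B00 => -> // j _; exact: sqr_ge0.
  by rewrite /S big1 => [|i _]; rewrite ?b0 ?mulr0// expr0n mulr_ge0.
have Bp : 0 < B by rewrite lt0r Bn0.
(* The minimizer of the nonnegative quadratic [q]. *)
have := q (S / B).
rewrite (_ : _ + _ = A - S ^+ 2 / B); last by field.
by rewrite subr_ge0 ler_pdivrMr.
Qed.

Lemma cauchy_schwarz_normc (I : finType) (a b : I -> R[i]) :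
  normc (\sum_i a i * b i) ^+ 2 <=
  (\sum_i normc (a i) ^+ 2) * (\sum_i normc (b i) ^+ 2).
Proof.
apply: le_trans (cauchy_schwarz_sum _ _).
rewrite ler_pXn2r ?nnegrE ?normc_ge0//.
  by under [leRHS]eq_bigr do rewrite -normcM; exact: le_normc_sum.
by apply: sumr_ge0 => i _; rewrite mulr_ge0 ?normc_ge0.
Qed.

End complex_arithmetic.

(** * Integrals of complex-valued functions *)

Section complex_integral.
Local Open Scope complex_scope.
Local Open Scope ring_scope.
Context {R : realType} {d : measure_display} {T : measurableType d}.
Implicit Types (f g : T -> R[i]) (D : set T).

Definition cmeasurable D f :=
  measurable_fun D (fun x => complex.Re (f x)) /\
  measurable_fun D (fun x => complex.Im (f x)).

Lemma eq_cmeasurable D f g : (forall x, D x -> f x = g x) ->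
  cmeasurable D f -> cmeasurable D g.
Proof.
move=> fg [mr mi]; split; [move: mr|move: mi];
  by apply: eq_measurable_fun => x /set_mem Dx; rewrite fg.
Qed.

Lemma cmeasurable_cst D (c : R[i]) : cmeasurable D (fun=> c).
Proof. by split; exact: measurable_cst. Qed.

Lemma cmeasurableD D f g : cmeasurable D f -> cmeasurable D g ->
  cmeasurable D (fun x => f x + g x).
Proof.
move=> [fr fi] [gr gi]; split.
  by under eq_fun do rewrite ReD; exact: measurable_funD.
by under eq_fun do rewrite ImD; exact: measurable_funD.
Qed.

Lemma cmeasurableM D f g : cmeasurable D f -> cmeasurable D g ->
  cmeasurable D (fun x => f x * g x).
Proof.
move=> [fr fi] [gr gi]; split.
  by under eq_fun do rewrite ReM; apply: measurable_funB; exact: measurable_funM.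
by under eq_fun do rewrite ImM; apply: measurable_funD; exact: measurable_funM.
Qed.

Lemma cmeasurable_conj D f : cmeasurable D f -> cmeasurable D (fun x => (f x)^*).
Proof.
move=> [fr fi]; split; first by under eq_fun do rewrite Re_conjc.
by under eq_fun do rewrite Im_conjc; exact: measurableT_comp.
Qed.

Lemma cmeasurableZ D (c : R[i]) f : cmeasurable D f -> cmeasurable D (fun x => c * f x).
Proof. by move=> mf; apply: cmeasurableM => //; exact: cmeasurable_cst. Qed.

Lemma cmeasurable_sum D (I : Type) (r : seq I) (Q : pred I) (F : I -> T -> R[i]) :
  (forall i, cmeasurable D (F i)) -> cmeasurable D (fun x => \sum_(i <- r | Q i) F i x).
Proof.
move=> mF; elim: r => [|i r IH].
  by under eq_fun do rewrite big_nil; exact: cmeasurable_cst.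
under eq_fun do rewrite big_cons; case: (Q i) => //; exact: cmeasurableD.
Qed.

Lemma cmeasurableX D f n : cmeasurable D f -> cmeasurable D (fun x => f x ^+ n).
Proof.
move=> mf; elim: n => [|n IH]; first exact: cmeasurable_cst.
by under eq_fun do rewrite exprS; exact: cmeasurableM.
Qed.

Lemma cmeasurable_real D (h : T -> R) : measurable_fun D h ->
  cmeasurable D (fun x => (h x)%:C).
Proof. by move=> mh; split => //=; exact: measurable_cst. Qed.

Lemma measurable_normc_sqr D f : cmeasurable D f ->
  measurable_fun D (fun x => normc (f x) ^+ 2).
Proof.
move=> [fr fi]; under eq_fun do rewrite normc_sqr.
by apply: measurable_funD; exact: measurable_funX.
Qed.

Lemma measurable_normc D f : cmeasurable D f ->
  measurable_fun D (fun x => normc (f x)).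
Proof.
move=> mf; rewrite (_ : (fun x => _) = fun x => Num.sqrt (normc (f x) ^+ 2)).
  by apply: measurableT_comp (measurable_normc_sqr mf); exact: continuous_measurable_fun (@sqrt_continuous R).
by apply/funext => x; rewrite sqrtr_sqr ger0_norm // normc_ge0.
Qed.

Variable m : {measure set T -> \bar R}.

Definition cintegrable D f :=
  m.-integrable D (EFin \o (fun x => complex.Re (f x))) /\
  m.-integrable D (EFin \o (fun x => complex.Im (f x))).

Lemma eq_cintegrable D f g : measurable D -> (forall x, D x -> f x = g x) ->
  cintegrable D f -> cintegrable D g.
Proof.
move=> mD fg [fr fi]; split; [move: fr|move: fi];
  by apply: eq_integrable => // x /set_mem Dx /=; rewrite fg.
Qed.

Lemma eq_cintegral D f g : (forall x, D x -> f x = g x) ->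
  cintegral m D f = cintegral m D g.
Proof.
move=> fg; rewrite /cintegral; congr (_ +i* _); apply: eq_Rintegral;
  by move=> x /set_mem Dx; rewrite fg.
Qed.

Lemma cintegrableD D f g : measurable D -> cintegrable D f -> cintegrable D g ->
  cintegrable D (fun x => f x + g x).
Proof.
move=> mD [fr fi] [gr gi]; split.
  by apply: eq_integrable (integrableD mD fr gr) => // x _ /=; rewrite ReD EFinD.
by apply: eq_integrable (integrableD mD fi gi) => // x _ /=; rewrite ImD EFinD.
Qed.

Lemma cintegralD D f g : measurable D -> cintegrable D f -> cintegrable D g ->
  cintegral m D (fun x => f x + g x) = cintegral m D f + cintegral m D g.
Proof.
move=> mD [fr fi] [gr gi]; rewrite /cintegral /=.
rewrite [RHS](_ : _ = (\int[m]_(x in D) complex.Re (f x) + \int[m]_(x in D) complex.Re (g x))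
  +i* (\int[m]_(x in D) complex.Im (f x) + \int[m]_(x in D) complex.Im (g x)))//.
rewrite -!RintegralD//; congr (_ +i* _); apply: eq_Rintegral => x _; [exact: ReD|exact: ImD].
Qed.

Lemma cintegrableZ D (c : R[i]) f : measurable D -> cintegrable D f ->
  cintegrable D (fun x => c * f x).
Proof.
move=> mD [fr fi]; split.
  have h := integrableB mD (integrableZl mD (complex.Re c) fr) (integrableZl mD (complex.Im c) fi).
  by apply: eq_integrable h => // x _ /=; rewrite ReM EFinB !EFinM.
have h := integrableD mD (integrableZl mD (complex.Re c) fi) (integrableZl mD (complex.Im c) fr).
by apply: eq_integrable h => // x _ /=; rewrite ImM EFinD !EFinM.
Qed.

Lemma cintegralZ D (c : R[i]) f : measurable D -> cintegrable D f ->
  cintegral m D (fun x => c * f x) = c * cintegral m D f.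
Proof.
move=> mD [fr fi].
have hr a := integrableZl mD a fr; have hi a := integrableZl mD a fi.
rewrite [RHS]complex_eta ReM ImM /=; congr (_ +i* _).
  rewrite -!RintegralZl// -RintegralB//.
  - by apply: eq_Rintegral => x _; rewrite ReM.
  - by apply: eq_integrable (hr (complex.Re c)).
  - by apply: eq_integrable (hi (complex.Im c)).
rewrite -!RintegralZl// -RintegralD//.
- by apply: eq_Rintegral => x _; rewrite ImM.
- by apply: eq_integrable (hi (complex.Re c)).
- by apply: eq_integrable (hr (complex.Im c)).
Qed.

Lemma cintegral_conj D f : measurable D -> cintegrable D f ->
  cintegral m D (fun x => (f x)^*) = (cintegral m D f)^*.
Proof.
move=> mD [fr fi]; rewrite /cintegral /=; congr (_ +i* _).
  by apply: eq_Rintegral => x _; rewrite Re_conjc.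
under eq_Rintegral do rewrite Im_conjc -mulN1r.
by rewrite RintegralZl// mulN1r.
Qed.

Lemma cintegrable0 D : measurable D -> cintegrable D (fun=> 0).
Proof. by move=> mD; split; exact: integrable0. Qed.

Lemma cintegral0 D : cintegral m D (fun=> 0) = 0.
Proof. by rewrite /cintegral /= /Rintegral integral0. Qed.

Lemma cintegrable_sum D (I : Type) (r : seq I) (F : I -> T -> R[i]) : measurable D ->
  (forall i, cintegrable D (F i)) -> cintegrable D (fun x => \sum_(i <- r) F i x).
Proof.
move=> mD iF; elim: r => [|i r IH].
  by under eq_fun do rewrite big_nil; exact: cintegrable0.
by under eq_fun do rewrite big_cons; exact: cintegrableD.
Qed.

Lemma cintegral_sum D (I : Type) (r : seq I) (F : I -> T -> R[i]) : measurable D ->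
  (forall i, cintegrable D (F i)) ->
  cintegral m D (fun x => \sum_(i <- r) F i x) = \sum_(i <- r) cintegral m D (F i).
Proof.
move=> mD iF; elim: r => [|i r IH].
  by under eq_fun do rewrite big_nil; rewrite big_nil cintegral0.
under eq_fun do rewrite big_cons; rewrite big_cons cintegralD ?IH//.
exact: cintegrable_sum.
Qed.

Lemma integrable_bounded_mul D (g h : T -> R) (M : R) : measurable D ->
  measurable_fun D g -> (forall x, D x -> `|g x| <= M) ->
  m.-integrable D (EFin \o h) -> m.-integrable D (EFin \o (fun x => g x * h x)).
Proof.
move=> mD mg gM ih.
have M0 : forall x, D x -> 0 <= M by move=> x Dx; exact: le_trans (gM x Dx).
apply: (@le_integrable _ _ _ m D mD _ (EFin \o (fun x => M * h x))).
- apply/measurable_EFinP; apply: measurable_funM => //.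
  by apply/measurable_EFinP; exact: measurable_int ih.
- move=> x Dx /=; rewrite lee_fin !normrM ler_wpM2r//.
  by rewrite (le_trans (gM x Dx))// ler_norm.
- by apply: eq_integrable (integrableZl mD M ih).
Qed.

Lemma cintegrable_bounded_mul D f g (M : R) : measurable D ->
  cmeasurable D g -> (forall x, D x -> normc (g x) <= M) ->
  cintegrable D f -> cintegrable D (fun x => g x * f x).
Proof.
move=> mD [gr gi] gM [fr fi].
have rM x : D x -> `|complex.Re (g x)| <= M.
  by move=> Dx; exact: le_trans (le_Re_normc _) (gM x Dx).
have iM x : D x -> `|complex.Im (g x)| <= M.
  by move=> Dx; exact: le_trans (le_Im_normc _) (gM x Dx).
have b1 := integrable_bounded_mul mD gr rM fr.
have b2 := integrable_bounded_mul mD gi iM fi.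
have b3 := integrable_bounded_mul mD gr rM fi.
have b4 := integrable_bounded_mul mD gi iM fr.
split.
  by apply: eq_integrable (integrableB mD b1 b2) => // x _ /=; rewrite ReM EFinB.
by apply: eq_integrable (integrableD mD b3 b4) => // x _ /=; rewrite ImM EFinD.
Qed.

Lemma cintegrable_bounded D f (M : R) : measurable D -> (m D < +oo)%E ->
  cmeasurable D f -> (forall x, D x -> normc (f x) <= M) -> cintegrable D f.
Proof.
move=> mD fD mf fM.
apply: (@eq_cintegrable D (fun x => f x * 1)) => // [x _|]; first by rewrite mulr1.
apply: (@cintegrable_bounded_mul _ _ _ M) => //.
split; last exact: integrable0.
apply/integrableP; split; first exact: measurable_cst.
by under eq_integral do rewrite /= normr1; rewrite integral_cst// mul1e.
Qed.

Lemma cintegral_real D (h : T -> R) :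
  cintegral m D (fun x => (h x)%:C) = (\int[m]_(x in D) h x)%:C.
Proof. by rewrite /cintegral /=; congr (_ +i* _); rewrite /Rintegral integral0. Qed.

End complex_integral.

(** * Change of variables for bounded functions *)

Section ctransfer.
Local Open Scope complex_scope.
Local Open Scope ring_scope.
Context {R : realType} (d1 d2 : measure_display).
Variables (T1 : measurableType d1) (T2 : measurableType d2).
Variables (P : {measure set T1 -> \bar R}) (D : set T1).
Variables (m : {measure set T2 -> \bar R}) (S : set T2).
Variables (V : T1 -> T2) (Y : T1 -> R) (f : T2 -> R).
Hypotheses (mD : measurable D) (mS : measurable S).
Hypotheses (mV : measurable_fun D V) (VS : forall x, D x -> S (V x)).
Hypotheses (Y0 : forall x, D x -> 0 <= Y x) (f0 : forall x, S x -> 0 <= f x).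
Hypotheses (iY : P.-integrable D (EFin \o Y)) (jf : m.-integrable S (EFin \o f)).
Hypothesis H : forall B, measurable B ->
  (\int[P]_(x in D `&` V @^-1` B) (Y x)%:E = \int[m]_(y in S `&` B) (f y)%:E)%E.

Let mY : measurable_fun D Y.
Proof. by apply/measurable_EFinP; exact: measurable_int iY. Qed.

Let mf : measurable_fun S f.
Proof. by apply/measurable_EFinP; exact: measurable_int jf. Qed.

Lemma measurable_comp_transfer (phi : T2 -> R) : measurable_fun S phi ->
  measurable_fun D (fun x => phi (V x)).
Proof.
move=> mphi; have := measurableT_comp ((measurable_restrictT _ mS).1 mphi) mV.
by apply: eq_measurable_fun => x /set_mem Dx; rewrite /= patchE mem_set //; exact: VS.
Qed.

Lemma Rintegral_transfer_nneg (phi : T2 -> R) : measurable_fun S phi ->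
  (forall y, S y -> 0 <= phi y) ->
  \int[P]_(x in D) (phi (V x) * Y x) = \int[m]_(y in S) (phi y * f y).
Proof.
move=> mphi phi0; rewrite /Rintegral; congr fine.
transitivity (\int[P]_(x in D) (((phi \_ S) (V x)) * Y x)%:E)%E.
  by apply: eq_integral => x /set_mem Dx; rewrite patchE mem_set //; exact: VS.
rewrite (ge0_integral_transfer mD mS mV mY Y0 f0 mf H).
- by apply: eq_integral => y yS; rewrite patchE yS.
- exact/(measurable_restrictT _ mS).
- by move=> y; rewrite patchE; case: ifPn => // /set_mem; exact: phi0.
Qed.

(** A bounded function plus its bound is nonnegative, so [Rintegral_transfer_nneg] applies to it and
    to the constant 1; the shift is then subtracted. *)
Lemma Rintegral_transfer (phi : T2 -> R) (M : R) : measurable_fun S phi ->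
  (forall y, S y -> `|phi y| <= M) ->
  \int[P]_(x in D) (phi (V x) * Y x) = \int[m]_(y in S) (phi y * f y).
Proof.
move=> mphi phiM.
have mp : measurable_fun S (fun y => phi y + M) by apply: measurable_funD.
have p0 y : S y -> 0 <= phi y + M.
  by move=> /phiM; rewrite ler_norml => /andP[]; lra.
have pM y : S y -> `|phi y + M| <= M + M.
  by move=> /phiM; rewrite !ler_norml => /andP[? ?]; apply/andP; split; lra.
have E := Rintegral_transfer_nneg mp p0.
have E1 := @Rintegral_transfer_nneg (fun=> 1) (measurable_cst _) (fun _ _ => ler01).
have i1 := integrable_bounded_mul mD (measurable_comp_transfer mp)
  (fun x Dx => pM _ (VS Dx)) iY.
have i2 := integrable_bounded_mul mS mp pM jf.
transitivity (\int[P]_(x in D) ((phi (V x) + M) * Y x) - M * \int[P]_(x in D) (1 * Y x)).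
  rewrite -RintegralZl -?RintegralB//.
  - by apply: eq_Rintegral => x _; ring.
  - by apply: eq_integrable (integrableZl mD M iY) => // x _ /=; rewrite mul1r.
  - by apply: eq_integrable iY => // x _ /=; rewrite mul1r.
rewrite E E1 -RintegralZl -?RintegralB//.
- by apply: eq_Rintegral => x _; ring.
- by apply: eq_integrable (integrableZl mS M jf) => // x _ /=; rewrite mul1r.
- by apply: eq_integrable jf => // x _ /=; rewrite mul1r.
Qed.

Lemma cintegral_transfer (phi : T2 -> R[i]) (M : R) : cmeasurable S phi ->
  (forall y, S y -> normc (phi y) <= M) ->
  cintegral P D (fun x => phi (V x) * (Y x)%:C) =
  cintegral m S (fun y => phi y * (f y)%:C).
Proof.
move=> [mr mi] pM; rewrite /cintegral; congr (_ +i* _).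
  under eq_Rintegral do rewrite ReM /= mulr0 subr0.
  under [RHS]eq_Rintegral do rewrite ReM /= mulr0 subr0.
  apply: (Rintegral_transfer (M := M) mr) => y Sy.
  exact: le_trans (le_Re_normc _) (pM _ Sy).
under eq_Rintegral do rewrite ImM /= mulr0 add0r.
under [RHS]eq_Rintegral do rewrite ImM /= mulr0 add0r.
apply: (Rintegral_transfer (M := M) mi) => y Sy.
exact: le_trans (le_Im_normc _) (pM _ Sy).
Qed.

End ctransfer.

(** * Integration in polar coordinates *)

Section fubini_product.
Context {R : realType} (d1 d2 : measure_display).
Variables (T1 : measurableType d1) (T2 : measurableType d2).
Variables (m1 : {sigma_finite_measure set T1 -> \bar R}).
Variables (m2 : {sigma_finite_measure set T2 -> \bar R}).
Variables (D1 : set T1) (D2 : set T2) (A : T1 -> R) (B : T2 -> R) (MA MB : R).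
Hypotheses (mD1 : measurable D1) (mD2 : measurable D2).
Hypotheses (fD1 : (m1 D1 < +oo)%E) (fD2 : (m2 D2 < +oo)%E).
Hypotheses (mA : measurable_fun D1 A) (mB : measurable_fun D2 B).
Hypotheses (bA : forall x, D1 x -> `|A x| <= MA) (bB : forall x, D2 x -> `|B x| <= MB).

Lemma integrable_of_bounded d (T : measurableType d) (m : {measure set T -> \bar R})
    (D : set T) (f : T -> R) (M : R) : measurable D -> (m D < +oo)%E ->
  measurable_fun D f -> (forall x, D x -> `|f x| <= M) -> m.-integrable D (EFin \o f).
Proof.
move=> mD fD mf fM.
have [i1 _] := @cintegrable_bounded R d T m D (fun=> 1) 1 mD fD
  (cmeasurable_cst _ _) (fun _ _ => ltac:(by rewrite normc1)).
apply: eq_integrable (integrable_bounded_mul mD mf fM i1) => // x _ /=.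
by rewrite mulr1.
Qed.

Lemma product_measure_setX_lty : ((m1 \x m2) (D1 `*` D2) < +oo)%E.
Proof. by rewrite product_measure1E// lte_mul_pinfty// ge0_fin_numE. Qed.

Lemma Rintegral_prod :
  \int[(m1 \x m2)%E]_(p in D1 `*` D2) (A p.1 * B p.2) =
  \int[m1]_(x in D1) A x * \int[m2]_(y in D2) B y.
Proof.
have iA := integrable_of_bounded mD1 fD1 mA bA.
have iB := integrable_of_bounded mD2 fD2 mB bB.
have mA' : measurable_fun setT (A \_ D1) by exact/(measurable_restrictT _ mD1).
have mB' : measurable_fun setT (B \_ D2) by exact/(measurable_restrictT _ mD2).
have E p : ((fun p => A p.1 * B p.2) \_ (D1 `*` D2)) p = (A \_ D1) p.1 * (B \_ D2) p.2.
  rewrite !patchE; case: ifPn => [/set_mem[/= a b]|]; first by rewrite !mem_set.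
  move=> n; case: ifPn => [/set_mem a|]; last by rewrite mul0r.
  case: ifPn => [/set_mem b|]; last by rewrite mulr0.
  by exfalso; move/negP: n; apply; rewrite inE.
rewrite Rintegral_mkcond [X in _ = X * _]Rintegral_mkcond [X in _ = _ * X]Rintegral_mkcond.
under eq_Rintegral do rewrite E.
have iA' : m1.-integrable setT (EFin \o (A \_ D1)).
  by have /(integrable_mkcond _ mD1) := iA; rewrite restrict_EFin.
have iB' : m2.-integrable setT (EFin \o (B \_ D2)).
  by have /(integrable_mkcond _ mD2) := iB; rewrite restrict_EFin.
have iAB : (m1 \x m2)%E.-integrable setT (EFin \o (fun p => (A \_ D1) p.1 * (B \_ D2) p.2)).
  have : (m1 \x m2)%E.-integrable (D1 `*` D2) (EFin \o (fun p => A p.1 * B p.2)).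
    apply: (@integrable_of_bounded _ _ _ _ _ (MA * MB)).
    - exact: measurableX.
    - exact: product_measure_setX_lty.
    - apply/(measurable_restrictT _ (measurableX mD1 mD2)).
      rewrite (_ : _ \_ _ = fun p => (A \_ D1) p.1 * (B \_ D2) p.2); last exact/funext.
      by apply: measurable_funM; [exact: (measurableT_comp mA')|exact: (measurableT_comp mB')].
    - by move=> [x y] [/= /bA a /bB b]; rewrite normrM ler_pM.
  move=> /(integrable_mkcond _ (measurableX mD1 mD2)); rewrite restrict_EFin.
  by apply: eq_integrable => // p _ /=; rewrite E.
rewrite /Rintegral -(integral12_prod_meas1 iAB) /fubini_F /=.
under eq_integral => x _.
  under eq_integral do rewrite EFinM.
  rewrite integralZl//.
  over.
rewrite -(fineK (integrable_fin_num measurableT iB')) /=.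
by rewrite integralZr// fineM// (integrable_fin_num measurableT iA').
Qed.

End fubini_product.

(** * Surface integrals in polar coordinates *)

Section polar.
Local Open Scope complex_scope.
Local Open Scope ring_scope.
Context {R : realType}.

Lemma measurable_mx_entry d (T : measurableType d) m n i j :
  measurable_fun setT (fun A : 'M[T]_(m, n) => A i j).
Proof.
move=> _ B mB; rewrite setTI; apply: sub_sigma_algebra.
by exists (i, j) => //; exists B => //; rewrite setTI.
Qed.

Lemma measurable_sphere : measurable (@sphere R).
Proof.
have m : measurable_fun setT (fun x : 'cV[R]_3 => \sum_i x i 0 ^+ 2).
  by apply: measurable_sum => i; apply: measurable_funX; exact: measurable_mx_entry.
by rewrite -[X in measurable X]setTI; exact: m measurableT [set 1] (measurable_set1 1).
Qed.

Definition polar_rect : set (R * R) := `[0%R, pi]%classic `*` `[0%R, (2 * pi)%R]%classic.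

Lemma measurable_polar_rect :
  measurable (polar_rect : set (measurableTypeR R * measurableTypeR R)).
Proof. by apply: measurableX; exact: measurable_itv. Qed.

Lemma sphere_spherical_coord (p : R * R) : sphere (spherical_coord p).
Proof.
rewrite /sphere /= !big_ord_recl big_ord0 !mxE /= addr0 !exprMn.
by rewrite addrA -mulrDr cos2Dsin2 mulr1 addrC cos2Dsin2.
Qed.

Lemma polar_rect_lty : ((@lebesgue_measure R \x @lebesgue_measure R) polar_rect < +oo)%E.
Proof.
have lt (c : R) : (lebesgue_measure `[0%R, c]%classic < +oo)%E.
  by rewrite lebesgue_measure_itv /=; case: ifP => // _; rewrite -?EFinB ltry.
by apply: product_measure_setX_lty; [exact: measurable_itv..|exact: lt|exact: lt].
Qed.

Lemma integrable_sin_polar :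
  (@lebesgue_measure R \x @lebesgue_measure R)%E.-integrable polar_rect
    (EFin \o (fun p => sin p.1)).
Proof.
apply: (@integrable_of_bounded _ _ _ _ _ _ 1).
- exact: measurable_polar_rect.
- exact: polar_rect_lty.
- apply: measurable_funTS.
  exact: (measurableT_comp (continuous_measurable_fun (@continuous_sin R))).
- by move=> p _; rewrite ler_norml sin_geN1 sin_le1.
Qed.

Lemma surface_sphere_lty : (@surface R sphere < +oo)%E.
Proof.
rewrite /surface setIidl => [|p _ /=]; last exact: sphere_spherical_coord.
have := integrable_fin_num measurable_polar_rect integrable_sin_polar.
by rewrite fin_numElt => /andP[].
Qed.

(** [surface] is by construction the image of the weight sin(theta) under [spherical_coord], so this
    is the transfer with weight [sin] and target density 1. *)
Lemma cintegral_polar (phi : 'cV[R]_3 -> R[i]) (M : R) : cmeasurable sphere phi ->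
  (forall y, sphere y -> normc (phi y) <= M) ->
  cintegral surface sphere phi =
  cintegral (lebesgue_measure \x lebesgue_measure)%E polar_rect
    (fun p => phi (spherical_coord p) * (sin p.1)%:C).
Proof.
move=> mphi phiM.
have mS := measurable_sphere; have mD := measurable_polar_rect.
have i1 : (@surface R).-integrable sphere (EFin \o (fun=> 1)).
  by apply: (@integrable_of_bounded _ _ _ _ _ _ 1) => //; rewrite ?normr1//; exact: surface_sphere_lty.
have sin0 p : polar_rect p -> 0 <= sin p.1.
  by move=> [/=]; rewrite in_itv /= => /andP[p0 ppi] _; rewrite sin_ge0_pi// p0 ppi.
rewrite (@cintegral_transfer R _ _ _ _ (lebesgue_measure \x lebesgue_measure)%E
  polar_rect (@surface R) sphere (@spherical_coord R) (fun p => sin p.1) (fun=> 1) mD mS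
  (measurable_funTS (@measurable_spherical_coord R)) _ sin0 _ integrable_sin_polar i1 _ phi M)//.
- by apply: eq_cintegral => y _; rewrite mulr1.
- by move=> p _; exact: sphere_spherical_coord.
- move=> B mB; rewrite integral_cst ?mul1e; last exact: measurableI.
  rewrite (_ : polar_rect `&` _ =
    polar_rect `&` @spherical_coord R @^-1` (sphere `&` B))//.
  by apply/seteqP; split => p [rp Bp]; split => //;
    [split => //; exact: sphere_spherical_coord | case: Bp].
Qed.

(** These functions are stable under product and conjugation, contain every harmonic up to a
    constant factor, and have an explicit surface integral; harmonics are handled through them. *)
Definition mono (a b : nat) (q : {poly R}) (x : 'cV[R]_3) : R[i] :=
  (x (inord 0) 0 +i* x (inord 1) 0) ^+ a *
  (x (inord 0) 0 -i* x (inord 1) 0) ^+ b * (q.[x (inord 2) 0])%:C.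

Lemma cmeasurable_mono D a b q : cmeasurable D (mono a b q).
Proof.
have e i : measurable_fun D (fun x : 'cV[R]_3 => x i 0).
  by apply: measurable_funTS; exact: measurable_mx_entry.
apply: cmeasurableM; first apply: cmeasurableM.
- by apply: cmeasurableX; split => /=.
- by apply: cmeasurableX; split => //=; exact: measurableT_comp.
- apply: cmeasurable_real; under eq_fun do rewrite horner_coef.
  apply: measurable_sum => i; apply: measurable_funM => //.
  exact: measurable_funX.
Qed.

Lemma sphereE (x : 'cV[R]_3) : sphere x ->
  x (inord 0) 0 ^+ 2 + x (inord 1) 0 ^+ 2 + x (inord 2) 0 ^+ 2 = 1.
Proof.
rewrite /sphere /= !big_ord_recl big_ord0 addr0 addrA => <-.
by congr (x _ 0 ^+ 2 + x _ 0 ^+ 2 + x _ 0 ^+ 2); apply: val_inj; rewrite /= inordK.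
Qed.

Lemma mono_conj a b q x : (mono a b q x)^* = mono b a q x.
Proof.
by rewrite /mono !rmorphM !rmorphXn /= conj_real !conj_Complex opprK [X in X * _]mulrC.
Qed.

Lemma monoM a b q a' b' q' x :
  mono a b q x * mono a' b' q' x = mono (a + a') (b + b') (q * q') x.
Proof. by rewrite /mono !exprD hornerM rmorphM /=; ring. Qed.

(** On the sphere (x_0 + i x_1)(x_0 - i x_1) = 1 - x_2^2. *)
Lemma mono_reduce a b q x : sphere x -> mono a.+1 b.+1 q x = mono a b ((1 - 'X^2) * q) x.
Proof.
move=> /sphereE sx; rewrite /mono hornerM hornerD hornerN hornerXn hornerC rmorphM /=.
rewrite -{1}sx addrK [_ ^+ a.+1]exprS [_ ^+ b.+1]exprS.
have -> : (x (inord 0) 0 ^+ 2 + x (inord 1) 0 ^+ 2)%:C =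
  (x (inord 0) 0 +i* x (inord 1) 0) * (x (inord 0) 0 -i* x (inord 1) 0).
  by apply/eqP; rewrite eq_complex /=; apply/andP; split; apply/eqP; ring.
ring.
Qed.

Lemma horner_bounded q (z : R) : `|z| <= 1 -> `|q.[z]| <= \sum_(i < size q) `|q`_i|.
Proof.
move=> z1; rewrite horner_coef; apply: le_trans (ler_norm_sum _ _ _) _.
by apply: ler_sum => i _; rewrite normrM normrX ler_piMr// exprn_ile1.
Qed.

Lemma mono_bounded a b q : exists M : R, forall x, sphere x -> normc (mono a b q x) <= M.
Proof.
exists (\sum_(i < size q) `|q`_i|) => x sx; have := sphereE sx.
set u := x _ _; set v := x _ _; set z := x _ _ => uvz.
have nw : normc (u +i* v) <= 1.
  by rewrite -(@ler_pXn2r _ 2)// ?nnegrE ?normc_ge0// normc_sqr /= expr1n -uvz lerDl sqr_ge0.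
have nX (w : R[i]) n : normc w <= 1 -> normc (w ^+ n) <= 1.
  move=> w1; elim: n => [|n IH]; first by rewrite expr0 normc1.
  by rewrite exprS normcM mulr_ile1 ?normc_ge0.
rewrite /mono !normcM normc_real.
have zz : `|z| <= 1.
  by rewrite -(@ler_pXn2r _ 2)// ?nnegrE// real_normK ?num_real// expr1n -uvz lerDr addr_ge0 ?sqr_ge0.
have q1 := horner_bounded q zz.
rewrite -[leRHS]mul1r; apply: ler_pM => //; first by rewrite mulr_ge0 ?normc_ge0.
apply: mulr_ile1; rewrite ?normc_ge0 ?nX//.
by rewrite (_ : u -i* v = (u +i* v)^*)// normc_conj.
Qed.

Lemma cexp_mul a b (t : R) : (cos t +i* sin t) ^+ a * (cos t -i* sin t) ^+ b =
  cos ((a%:R - b%:R) * t) +i* sin ((a%:R - b%:R) * t).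
Proof.
elim: a => [|a IH].
  rewrite expr0 mul1r sub0r; elim: b => [|b IH]; first by rewrite oppr0 mul0r cos0 sin0.
  rewrite exprS IH -natr1 opprD mulrDl mulN1r cosD sinD cosN sinN.
  by apply/eqP; rewrite eq_complex /=; apply/andP; split; apply/eqP; ring.
have -> : (a.+1%:R - b%:R) * t = (a%:R - b%:R) * t + t by rewrite -natr1; ring.
rewrite exprS -mulrA IH cosD sinD.
by apply/eqP; rewrite eq_complex /=; apply/andP; split; apply/eqP; ring.
Qed.

Lemma mono_spherical_coord a b q p : mono a b q (spherical_coord p) =
  (sin p.1 ^+ (a + b) * q.[cos p.1])%:C *
  (cos ((a%:R - b%:R) * p.2) +i* sin ((a%:R - b%:R) * p.2)).
Proof.
rewrite -cexp_mul /mono !mxE /= !inordK//=.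
have E (u v : R) n : (sin p.1 * u +i* (sin p.1 * v)) ^+ n = (sin p.1 ^+ n)%:C * (u +i* v) ^+ n.
  rewrite -[(sin p.1 ^+ n)%:C]/((real_complex R) _) rmorphXn -exprMn; congr (_ ^+ _).
  by apply/eqP; rewrite eq_complex /=; apply/andP; split; apply/eqP; ring.
rewrite -mulrN !E exprD !rmorphM /=; ring.
Qed.

Lemma Rintegral_FTC (F f : R -> R) (a b : R) : a < b ->
  (forall x, is_derive x (1 : R) F (f x)) -> continuous f ->
  \int[lebesgue_measure]_(x in `[a, b]) f x = F b - F a.
Proof.
move=> ab dF cf.
have cF x : F z @[z --> x] --> F x.
  by apply: differentiable_continuous; apply/derivable1_diffP; have [] := dF x.
rewrite /Rintegral (@continuous_FTC2 _ f F)//.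
- exact: continuous_subspaceT.
- split; [by move=> x _; have [] := dF x|exact: cvg_at_right_filter|exact: cvg_at_left_filter].
- by move=> x _; rewrite derive1E; have [_ ->] := dF x.
Qed.

(** Read off from [cexp_mul] at 2 pi, where both factors are powers of 1. *)
Lemma cos_sin_2pi a b :
  cos ((a%:R - b%:R) * (2 * pi)) = 1 :> R /\ sin ((a%:R - b%:R) * (2 * pi)) = 0 :> R.
Proof.
have := cexp_mul a b (2 * pi); rewrite mulrDl !mul1r cosDpi sinDpi cospi sinpi !opprK oppr0.
rewrite (_ : 1 +i* 0 = 1 :> R[i])// !expr1n mulr1 => /eqP.
by rewrite eq_complex /= => /andP[/eqP <- /eqP <-].
Qed.

Lemma is_derive_scaled (f : R -> R) (c x l : R) : is_derive (c * x) (1 : R) f l ->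
  is_derive x (1 : R) (fun t => f (c * t)) (l * c).
Proof.
move=> df; have E t : c * t = (c *: 'X).[t] by rewrite hornerZ hornerX.
under eq_fun do rewrite E.
apply: (is_derive1_comp (f := f) (g := horner (c *: 'X))); first by rewrite -E.
by have := is_derive_poly (c *: 'X) x; rewrite derivZ derivX hornerZ hornerC mulr1.
Qed.

Lemma Rintegral_cos_sin a b :
  \int[lebesgue_measure]_(t in `[0, 2 * pi]) cos ((a%:R - b%:R) * t) =
    (if a == b then 2 * pi else 0) :> R /\
  \int[lebesgue_measure]_(t in `[0, 2 * pi]) sin ((a%:R - b%:R) * t) = 0 :> R.
Proof.
have p0 : 0 < 2 * pi :> R by rewrite mulr_gt0 // pi_gt0.
have [<-|ab] := eqVneq a b.
  rewrite subrr; split.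
    under eq_Rintegral do rewrite mul0r cos0.
    by rewrite Rintegral_cst//= lebesgue_measure_itv /= lte_fin p0 sube0 mul1r.
  by under eq_Rintegral do rewrite mul0r sin0; rewrite Rintegral_cst// mul0r.
set c := a%:R - b%:R.
have c0 : c != 0 by rewrite subr_eq0 eqr_nat.
have [c2 s2] := cos_sin_2pi a b; rewrite -/c in c2 s2.
have cl : continuous (fun t : R => c * t).
  by move=> t; apply: cvgMr; exact: cvg_id.
have ds x : is_derive x (1 : R) (fun t => c^-1 * sin (c * t)) (cos (c * x)).
  have d1 := @is_derive_scaled sin c x _ (is_derive_sin (c * x)).
  have := is_deriveZ c^-1 d1.
  by rewrite /GRing.scale /= (_ : c^-1 * _ = cos (c * x)) //; field.
have dc x : is_derive x (1 : R) (fun t => (- c^-1) * cos (c * t)) (sin (c * x)).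
  have d1 := @is_derive_scaled cos c x _ (is_derive_cos (c * x)).
  have := is_deriveZ (- c^-1) d1.
  by rewrite /GRing.scale /= (_ : - c^-1 * _ = sin (c * x)) //; field.
split.
  rewrite (Rintegral_FTC p0 ds) ?s2 ?mulr0 ?sin0 ?mulr0 ?subrr//.
  by move=> t; apply: (continuous_comp (cl t)); exact: continuous_cos.
rewrite (Rintegral_FTC p0 dc) ?c2 ?mulr0 ?cos0 ?subrr//.
by move=> t; apply: (continuous_comp (cl t)); exact: continuous_sin.
Qed.

Lemma continuous_horner_cos (q : {poly R}) : continuous (fun t => q.[cos t]).
Proof.
move=> t; apply: (@continuous_comp _ _ _ cos (horner q)); first exact: continuous_cos.
exact: continuous_horner.
Qed.

(** Substitution x = cos t: an antiderivative of the integrand is minus [primitive q] at cos t. *)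
Lemma Rintegral_sin_horner_cos (q : {poly R}) :
  \int[lebesgue_measure]_(t in `[0, pi]) (sin t * q.[cos t]) = integral11 q.
Proof.
have dF x : is_derive x (1 : R) (fun t => - (primitive q).[cos t]) (sin x * q.[cos x]).
  have d1 : is_derive x (1 : R) (horner (primitive q) \o cos) (q.[cos x] * (- sin x)).
    by apply: is_derive1_comp; rewrite -[q in q.[_]]deriv_primitive; exact: is_derive_poly.
  have := is_deriveN d1.
  by rewrite mulrN opprK mulrC.
rewrite (Rintegral_FTC (@pi_gt0 R) dF).
  by rewrite cospi cos0 /integral11; ring.
move=> t; apply: cvgM; first exact: continuous_sin.
exact: continuous_horner_cos.
Qed.

(** In polar coordinates the integrand factors. The longitude integral of e^(i (a - b) phi) vanishes
    unless a = b, and then sin^(2a + 1) = sin (1 - cos^2)^a leaves [integral11]. *)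
Lemma cintegral_mono a b q : cintegral surface sphere (mono a b q) =
  if a == b then (2 * pi * integral11 ((1 - 'X^2) ^+ a * q))%:C else 0.
Proof.
have [M HM] := mono_bounded a b q.
rewrite (cintegral_polar (cmeasurable_mono _ _ _ _) HM).
pose A (t : R) := sin t ^+ (a + b).+1 * q.[cos t].
pose c : R := a%:R - b%:R.
under eq_cintegral => p _.
  rewrite mono_spherical_coord mulrAC -(rmorphM (real_complex R)) mulrAC -exprSr -/(A p.1) -/c.
  over.
have cA : continuous A.
  move=> t; apply: cvgM.
    apply: (@continuous_comp _ _ _ sin (fun u : R => u ^+ (a + b).+1)).
      exact: continuous_sin.
    exact: exprn_continuous.
  exact: continuous_horner_cos.
have cl : continuous (fun t : R => c * t).
  by move=> t; apply: cvgMr; exact: cvg_id.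
have bA t : `[0, pi]%classic t -> `|A t| <= \sum_(i < size q) `|q`_i|.
  move=> _; rewrite /A normrM normrX -[leRHS]mul1r ler_pM//.
    by rewrite exprn_ile1// ler_norml sin_geN1 sin_le1.
  by apply: horner_bounded; rewrite ler_norml cos_geN1 cos_le1.
have bc t : `[0, 2 * pi]%classic t -> `|cos (c * t)| <= 1.
  by rewrite ler_norml cos_geN1 cos_le1.
have bs t : `[0, 2 * pi]%classic t -> `|sin (c * t)| <= 1.
  by rewrite ler_norml sin_geN1 sin_le1.
have lt (r : R) : (lebesgue_measure `[0%R, r]%classic < +oo)%E.
  by rewrite lebesgue_measure_itv /=; case: ifP => // _; rewrite -?EFinB ltry.
have mA : measurable_fun `[0, pi] A.
  by apply: measurable_funTS; exact: continuous_measurable_fun.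
have mc : measurable_fun `[0, 2 * pi] (fun t => cos (c * t)).
  apply: measurable_funTS; apply: continuous_measurable_fun => t.
  by apply: (continuous_comp (cl t)); exact: continuous_cos.
have ms : measurable_fun `[0, 2 * pi] (fun t => sin (c * t)).
  apply: measurable_funTS; apply: continuous_measurable_fun => t.
  by apply: (continuous_comp (cl t)); exact: continuous_sin.
have Ec := @Rintegral_prod R _ _ (measurableTypeR R) (measurableTypeR R)
  lebesgue_measure lebesgue_measure _ _ _ _ _ _ (measurable_itv _) (measurable_itv _)
  (lt _) (lt _) mA mc bA bc.
have Es := @Rintegral_prod R _ _ (measurableTypeR R) (measurableTypeR R)
  lebesgue_measure lebesgue_measure _ _ _ _ _ _ (measurable_itv _) (measurable_itv _)
  (lt _) (lt _) mA ms bA bs.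
have [Ic Is] := Rintegral_cos_sin a b.
rewrite /cintegral.
under eq_Rintegral do rewrite ReM /= mul0r subr0.
under [X in _ +i* X]eq_Rintegral do rewrite ImM /= mul0r addr0.
rewrite [X in X +i* _]Ec [X in _ +i* X]Es Ic Is mulr0.
case: eqVneq => [ab|_]; last by rewrite mulr0.
rewrite mulrC -Rintegral_sin_horner_cos; congr (_ * _)%:C.
apply: eq_Rintegral => t _; rewrite /A -ab addnn -mul2n exprS exprM hornerM horner_exp.
rewrite hornerD hornerN hornerXn hornerC -mulrA; congr (_ * (_ ^+ _ * _)).
by rewrite -(cos2Dsin2 t); ring.
Qed.

End polar.

(** * Orthonormality of the spherical harmonics *)

Section harmonics.
Local Open Scope complex_scope.
Local Open Scope ring_scope.
Context {R : realType}.

(** With [neg_order], the exponents of x_0 + i x_1 and of its conjugate in the harmonic of order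
    [m]; at most one is nonzero, and both signs of [m] are treated at once. *)
Definition pos_order (m : int) : nat := if m is Posz k then k else 0.
Definition neg_order (m : int) : nat := if m is Negz k then k.+1 else 0.

Lemma pos_neg_order m : (pos_order m + neg_order m)%N = `|m|%N.
Proof. by case: m => k //=; rewrite addn0. Qed.

(** The Condon-Shortley sign remains only for m >= 0: at negative orders it cancels against the sign
    in [spherical_harmonic]. *)
Definition harmonic_norm l (m : int) : R :=
  (if m is Posz k then (-1) ^+ k else 1) *
  Num.sqrt (l.*2.+1%:R / (4 * pi) * legendre_weight R l `|m|%N).

Definition order_of l (i : 'I_l.*2.+1) : int := i%:Z - l%:Z.

Lemma conj_realM (c : R) (z : R[i]) : (c%:C * z)^* = c%:C * z^*.
Proof. by rewrite rmorphM /= conj_real. Qed.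

Lemma Y_mono l (i : 'I_l.*2.+1) (x : 'cV[R]_3) : Y i x =
  (harmonic_norm l (order_of i))%:C *
  mono (pos_order (order_of i)) (neg_order (order_of i))
    (legendre R l)^`(`|order_of i|%N) x.
Proof.
rewrite /Y -/(order_of i); case: (order_of i) => k; rewrite /spherical_harmonic /harmonic_norm /mono.
  by rewrite /spherical_harmonic_nneg absz_nat expr0 mulr1 !rmorphM /= /legendre_weight; ring.
rewrite /spherical_harmonic_nneg -/(legendre_weight R l k.+1) expr0 !mul1r.
set Z := (X in X%:C * _); set w := _ +i* _.
rewrite [X in _ * X = _](_ : _ = Z%:C * w^* ^+ k.+1); last first.
  by rewrite rmorphM rmorphXn; congr (_ * _); exact: conj_real.
set S := Num.sqrt _; set p := _.[_]; have -> : Z%:C = (-1) ^+ k.+1 * (S%:C * p%:C).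
  by rewrite /Z -mulrA !rmorphM rmorphXn rmorphN1.
by rewrite !mulrA -exprMn mulrNN mul1r expr1n mul1r mulrAC.
Qed.

Lemma harmonic_norm_sqr l m :
  harmonic_norm l m ^+ 2 = l.*2.+1%:R / (4 * pi) * legendre_weight R l `|m|%N.
Proof.
have p4 : 0 < 4 * pi :> R by rewrite mulr_gt0 // pi_gt0.
rewrite exprMn sqr_sqrtr; last first.
  by rewrite mulr_ge0 ?divr_ge0 // ltW // legendre_weight_gt0.
by case: m => k /=; rewrite ?expr1n ?mul1r// -exprM mulnC exprM sqrrN !expr1n mul1r.
Qed.

Lemma harmonic_norm_neq0 l m : harmonic_norm l m != 0.
Proof.
rewrite -sqrf_eq0 harmonic_norm_sqr mulf_neq0 ?gt_eqF ?legendre_weight_gt0//.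
by rewrite divr_gt0// mulr_gt0// pi_gt0.
Qed.

Lemma order_of_le l (i : 'I_l.*2.+1) : (`|order_of i|%N <= l)%N.
Proof. by rewrite /order_of; have := ltn_ord i; lia. Qed.

Lemma order_of_inj l (i j : 'I_l.*2.+1) : order_of i = order_of j -> i = j.
Proof. by rewrite /order_of => E; apply: val_inj => /=; lia. Qed.

Lemma cmeasurable_Y D l (i : 'I_l.*2.+1) : cmeasurable D (@Y R l i).
Proof.
apply: (@eq_cmeasurable _ _ _ _ (fun x => (harmonic_norm l (order_of i))%:C *
  mono (pos_order (order_of i)) (neg_order (order_of i))
    (legendre R l)^`(`|order_of i|%N) x)) => [x _|]; first by rewrite -Y_mono.
by apply: cmeasurableZ; exact: cmeasurable_mono.
Qed.

(** The squared modulus is a [mono] with both exponents equal to a + b, which [mono_reduce] turns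
    into a power of 1 - x_2^2. *)
Lemma normc_mono_sqr a b q (x : 'cV[R]_3) : sphere x ->
  normc (mono a b q x) ^+ 2 = ((1 - 'X^2) ^+ (a + b) * q ^+ 2).[x (inord 2) 0].
Proof.
move=> sx; have E : mono (a + b) (b + a) (q * q) x = mono 0 0 ((1 - 'X^2) ^+ (a + b) * q ^+ 2) x.
  rewrite [(b + a)%N]addnC -expr2; elim: (a + b)%N (q ^+ 2) => [|n IH] r; first by rewrite expr0 mul1r.
  by rewrite mono_reduce// IH mulrA -exprSr.
have := mulc_conj (mono a b q x); rewrite mono_conj monoM E /mono !expr0 !mul1r.
by move=> /complexI.
Qed.

Lemma sum_abs_order (V : nmodType) (g : nat -> V) l :
  \sum_(i < l.*2.+1) g `|order_of i|%N = g 0%N + (\sum_(k < l) g k.+1) *+ 2.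
Proof.
rewrite /order_of; elim: l => [|l IH].
  by rewrite big_ord_recl !big_ord0 mul0rn.
rewrite [\sum_(k < l.+1) _]big_ord_recr /= mulrnDl addrA -IH doubleS big_ord_recr big_ord_recl /=.
rewrite subn0 (_ : `|l.*2.+2%:Z - l.+1%:Z|%N = l.+1); last by lia.
rewrite mulr2n [RHS]addrA [g l.+1 + _]addrC; congr (_ + _ + _).
by apply: eq_bigr => i _; congr g; rewrite /= /bump; lia.
Qed.

(** Each |Y|^2 is a constant times [assoc_legendre_sq] at |m|, and every |m| > 0 occurs twice; this
    is the sum in [sum_assoc_legendre_sq]. *)
Lemma sum_normc_Y l (x : 'cV[R]_3) : sphere x ->
  \sum_(i < l.*2.+1) normc (Y i x) ^+ 2 = l.*2.+1%:R / (4 * pi).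
Proof.
move=> sx; pose g k := l.*2.+1%:R / (4 * pi) * (assoc_legendre_sq R l k).[x (inord 2) 0].
rewrite (eq_bigr (fun i => g `|order_of i|%N)) => [|i _].
  rewrite sum_abs_order /g -mulr_sumr -mulrnAr -mulrDr.
  rewrite -[RHS]mulr1; congr (_ * _).
  have /(congr1 (fun p => p.[x (inord 2) 0])) := sum_assoc_legendre_sq R l.
  by rewrite hornerD hornerM horner_sum -polyC_natr !hornerC mulr_natl.
rewrite Y_mono normcM exprMn normc_real real_normK ?num_real// harmonic_norm_sqr.
by rewrite /g /assoc_legendre_sq hornerZ [RHS]mulrA normc_mono_sqr// pos_neg_order.
Qed.

Lemma normc_Y_le l (i : 'I_l.*2.+1) (x : 'cV[R]_3) : sphere x ->
  normc (Y i x) <= Num.sqrt (l.*2.+1%:R / (4 * pi)).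
Proof.
move=> sx; rewrite -(sum_normc_Y l sx) -[leLHS]ger0_norm ?normc_ge0// -sqrtr_sqr.
rewrite ler_wsqrtr// (bigD1 i)//= lerDl.
by apply: sumr_ge0 => j _; exact: sqr_ge0.
Qed.

Lemma cintegrable_mono a b q : cintegrable (@surface R) sphere (mono a b q).
Proof.
have [M HM] := mono_bounded a b q.
apply: (cintegrable_bounded measurable_sphere surface_sphere_lty _ HM).
exact: cmeasurable_mono.
Qed.

(** The longitude integral separates the orders. For equal orders the colatitude integral is
    [assoc_legendre_dot], which separates the degrees and whose diagonal value [harmonic_norm]
    cancels. *)
Lemma cintegral_Y_conj l (i : 'I_l.*2.+1) l' (j : 'I_l'.*2.+1) :
  cintegral (@surface R) sphere (fun x => Y i x * (Y j x)^*) =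
  ((l == l') && (i == j :> nat))%:R.
Proof.
set m := order_of i; set m' := order_of j.
have E x : Y i x * (Y j x)^* = (harmonic_norm l m * harmonic_norm l' m')%:C *
    mono (pos_order m + neg_order m') (neg_order m + pos_order m')
      ((legendre R l)^`(`|m|%N) * (legendre R l')^`(`|m'|%N)) x.
  by rewrite !Y_mono conj_realM mono_conj -monoM [in RHS]rmorphM /=; ring.
rewrite (eq_cintegral _ (fun x _ => E x)) cintegralZ; first last.
  exact: cintegrable_mono.
  exact: measurable_sphere.
rewrite cintegral_mono.
have mm : (pos_order m + neg_order m' == neg_order m + pos_order m')%N = (m == m').
  by move: m m' {E} => [k|k] [k'|k'] /=; rewrite ?NegzE; lia.
rewrite mm; case: eqVneq => [mE|mN]; last first.
  rewrite mulr0; case: eqVneq => // ll; case: eqVneq => // ij; exfalso.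
  by move/eqP: mN; apply; rewrite /m /m' /order_of ij; congr (_ - Posz _).
rewrite -[m']mE pos_neg_order.
have -> : integral11 ((1 - 'X^2) ^+ `|m|%N * ((legendre R l)^`(`|m|%N) *
    (legendre R l')^`(`|m|%N))) = assoc_legendre_dot R `|m|%N l l'.
  by rewrite /assoc_legendre_dot mulrA.
have [ll|ll] := eqVneq l l'; last by rewrite assoc_legendre_dot_neq// !mulr0.
subst l'; rewrite (order_of_inj mE) eqxx /= -rmorphM -[(1%:R : R[i])]/((1:R)%:C); congr (_%:C).
rewrite -expr2 harmonic_norm_sqr.
have := @assoc_legendre_dot_eq R _ _ (order_of_le i); rewrite -/m => d.
have p0 : pi != 0 :> R by rewrite gt_eqF ?pi_gt0.
transitivity (l.*2.+1%:R / 2 *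
    (legendre_weight R l `|m|%N * assoc_legendre_dot R `|m|%N l l)).
  move: (legendre_weight _ _ _) (assoc_legendre_dot _ _ _ _) => w a {d}.
  by move: (l.*2.+1%:R) (pi : R) p0 => c p p0; field; rewrite p0.
rewrite d; have : l.*2.+1%:R != 0 :> R by rewrite pnatr_eq0.
by move: (_%:R) => c c0; field.
Qed.

(* The truncation level is eventually arbitrary so that sums need no padding. *)
Definition harmonic_span (g : 'cV[R]_3 -> R[i]) : Prop :=
  exists (c : forall l : nat, 'I_l.*2.+1 -> R[i]) (M0 : nat),
    forall M, (M0 <= M)%N -> forall x, sphere x ->
      g x = \sum_(l < M) \sum_(i < l.*2.+1) c l i * Y i x.

Lemma eq_harmonic_span g h : (forall x, sphere x -> g x = h x) ->
  harmonic_span g -> harmonic_span h.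
Proof.
move=> gh [c [M0 H]]; exists c, M0 => M MM x sx; rewrite -gh //; exact: H.
Qed.

Lemma harmonic_span0 : harmonic_span (fun=> 0).
Proof.
exists (fun _ _ => 0), 0%N => M _ x _.
by rewrite big1// => l _; rewrite big1// => i _; rewrite mul0r.
Qed.

Lemma harmonic_spanD g h : harmonic_span g -> harmonic_span h ->
  harmonic_span (fun x => g x + h x).
Proof.
move=> [c [M0 H]] [c' [M0' H']]; exists (fun l i => c l i + c' l i), (maxn M0 M0').
move=> M; rewrite geq_max => /andP[MM MM'] x sx; rewrite (H M)// (H' M)//.
rewrite -big_split; apply: eq_bigr => l _; rewrite -big_split.
by apply: eq_bigr => i _; rewrite /= mulrDl.
Qed.

Lemma harmonic_spanZ a g : harmonic_span g -> harmonic_span (fun x => a * g x).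
Proof.
move=> [c [M0 H]]; exists (fun l i => a * c l i), M0 => M MM x sx.
rewrite (H M)// mulr_sumr; apply: eq_bigr => l _; rewrite mulr_sumr.
by apply: eq_bigr => i _; rewrite mulrA.
Qed.

Lemma harmonic_span_sum (I : Type) (r : seq I) (F : I -> 'cV[R]_3 -> R[i]) :
  (forall i, harmonic_span (F i)) -> harmonic_span (fun x => \sum_(i <- r) F i x).
Proof.
move=> sF; elim: r => [|i r IH].
  by apply: eq_harmonic_span harmonic_span0 => x _; rewrite big_nil.
by apply: eq_harmonic_span (harmonic_spanD (sF i) IH) => x _; rewrite big_cons.
Qed.

Lemma harmonic_span_Y l (i : 'I_l.*2.+1) : harmonic_span (@Y R l i).
Proof.
exists (fun l' j => if (l' == l) && (j == i :> nat) then 1 else 0), l.+1.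
move=> M lM x _; rewrite (bigD1 (Ordinal lM))//= [X in _ = _ + X]big1 ?addr0; last first.
  move=> k kl; rewrite big1// => j _; case: ifP => [/andP[/eqP E _]|_]; last by rewrite mul0r.
  by exfalso; move/eqP: kl; apply; apply: val_inj.
rewrite (bigD1 i)//= !eqxx mul1r big1 ?addr0// => j ji.
by rewrite (negPf ji : (j == i :> nat) = false) mul0r.
Qed.

(** Induction on the degree of [q]: the |m|-th derivative of the Legendre polynomial of degree |m| +
    n has degree exactly n, so a multiple of it removes the coefficient of index n. *)
Lemma harmonic_span_mono_order (m : int) q :
  harmonic_span (mono (pos_order m) (neg_order m) q).
Proof.
move: {2}(size q) (leqnn (size q)) => n.
elim: n q => [|n IH] q.
  rewrite leqn0 size_poly_eq0 => /eqP ->.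
  by apply: eq_harmonic_span harmonic_span0 => x _; rewrite /mono horner0 mulr0.
move=> qn; pose l := (`|m|%N + n)%N; pose p := (legendre R l)^`(`|m|%N).
have sp : size p = n.+1 by rewrite size_deriv_legendre /l; lia.
have pn : p`_n != 0.
  have : lead_coef p != 0 by rewrite lead_coef_eq0 -size_poly_eq0 sp.
  by rewrite lead_coefE sp.
pose q' := q - (q`_n / p`_n) *: p.
have sq' : (size q' <= n)%N.
  apply/leq_sizeP => j; rewrite leq_eqVlt => /orP[/eqP <-|nj].
    by rewrite coefB coefZ divfK// subrr.
  by rewrite coefB coefZ [p`_j]nth_default ?sp// [q`_j]nth_default ?(leq_trans qn)// mulr0 subr0.
have li : (`|(m + l%:Z)%R|%N < l.*2.+1)%N by rewrite /l; lia.
have oE : order_of (Ordinal li) = m by rewrite /order_of /= /l; lia.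
have h := harmonic_spanD (IH _ sq')
  (harmonic_spanZ (q`_n / p`_n / harmonic_norm l m)%:C (harmonic_span_Y (Ordinal li))).
apply: eq_harmonic_span h => x _; rewrite Y_mono oE -/p /q'.
move: (q`_n / p`_n) (harmonic_norm l m) (harmonic_norm_neq0 l m) => c h h0.
rewrite mulrA -(rmorphM (real_complex R)) divfK// /mono hornerD hornerN hornerZ.
rewrite rmorphB rmorphM /=; ring.
Qed.

Lemma harmonic_span_mono a b q : harmonic_span (mono a b q).
Proof.
elim: a b q => [|a IH] [|b] q.
- exact: (harmonic_span_mono_order 0%N).
- exact: (harmonic_span_mono_order (Negz b)).
- exact: (harmonic_span_mono_order a.+1).
- by apply: eq_harmonic_span (IH b ((1 - 'X^2) * q)) => x sx; rewrite mono_reduce.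
Qed.

(** Up to a constant, the product of two harmonics is again a [mono], hence in the span. *)
Lemma harmonic_span_YM l (i : 'I_l.*2.+1) l' (j : 'I_l'.*2.+1) :
  harmonic_span (fun x => Y i x * Y j x).
Proof.
apply: eq_harmonic_span (harmonic_spanZ _ (harmonic_span_mono _ _ _)) => x _.
rewrite !Y_mono mulrACA monoM; reflexivity.
Qed.

Lemma harmonic_spanM g h : harmonic_span g -> harmonic_span h ->
  harmonic_span (fun x => g x * h x).
Proof.
move=> [c [M0 H]] [c' [M0' H']].
apply: (@eq_harmonic_span (fun x => \sum_(l < M0) \sum_(i < l.*2.+1)
  \sum_(l' < M0') \sum_(i' < l'.*2.+1) c l i * c' l' i' * (Y i x * Y i' x))).
  move=> x sx; rewrite (H M0)// (H' M0')// mulr_suml; apply: eq_bigr => l _.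
  rewrite mulr_suml; apply: eq_bigr => i _; rewrite mulr_sumr.
  apply: eq_bigr => l' _; rewrite mulr_sumr; apply: eq_bigr => i' _; ring.
do 4! (apply: harmonic_span_sum => ?).
by apply: harmonic_spanZ; exact: harmonic_span_YM.
Qed.

Lemma harmonic_span_Yconj l (i : 'I_l.*2.+1) : harmonic_span (fun x => (Y i x)^*).
Proof.
apply: eq_harmonic_span (harmonic_spanZ _ (harmonic_span_mono _ _ _)) => x _.
rewrite Y_mono conj_realM mono_conj; reflexivity.
Qed.

Lemma harmonic_span_conj g : harmonic_span g -> harmonic_span (fun x => (g x)^*).
Proof.
move=> [c [M0 H]]; apply: (@eq_harmonic_span (fun x => \sum_(l < M0)
  \sum_(i < l.*2.+1) (c l i)^* * (Y i x)^*)).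
  move=> x sx; rewrite (H M0)// rmorph_sum; apply: eq_bigr => l _.
  by rewrite rmorph_sum; apply: eq_bigr => i _; rewrite rmorphM.
do 2! (apply: harmonic_span_sum => ?).
by apply: harmonic_spanZ; exact: harmonic_span_Yconj.
Qed.

Lemma cmeasurable_harmonic_span g : harmonic_span g -> cmeasurable sphere g.
Proof.
move=> [c [M0 H]]; apply: (@eq_cmeasurable _ _ _ _ (fun x => \sum_(l < M0)
  \sum_(i < l.*2.+1) c l i * Y i x)); first by move=> x sx; rewrite (H M0).
do 2! (apply: cmeasurable_sum => ?).
by apply: cmeasurableZ; exact: cmeasurable_Y.
Qed.

Lemma harmonic_span_bounded g : harmonic_span g ->
  exists K : R, forall x, sphere x -> normc (g x) <= K.
Proof.
move=> [c [M0 H]]; exists (\sum_(l < M0) \sum_(i < l.*2.+1)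
  normc (c l i) * Num.sqrt (l.*2.+1%:R / (4 * pi))) => x sx.
rewrite (H M0)//; apply: le_trans (le_normc_sum _ _ _) _; apply: ler_sum => l _.
apply: le_trans (le_normc_sum _ _ _) _; apply: ler_sum => i _.
by rewrite normcM ler_wpM2l ?normc_ge0 ?normc_Y_le.
Qed.

Lemma cintegrable_harmonic_span g : harmonic_span g -> cintegrable (@surface R) sphere g.
Proof.
move=> sg; have [K HK] := harmonic_span_bounded sg.
by apply: (cintegrable_bounded measurable_sphere surface_sphere_lty _ HK);
  exact: cmeasurable_harmonic_span.
Qed.

End harmonics.

(** * Completeness of the spherical harmonics *)

Import HBNNSimple.

(** * Polynomials converging to a step function *)

Section step_function.
Context {R : realType}.

Lemma bernoulli_ge (t : R) n : 0 <= t -> 1 + n%:R * t <= (1 + t) ^+ n.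
Proof.
move=> t0; elim: n => [|n IH]; first by rewrite expr0 mul0r addr0.
rewrite exprS -natr1; apply: (@le_trans _ _ ((1 + t) * (1 + n%:R * t))).
  by have := ler0n R n; nra.
by rewrite ler_wpM2l// addr_ge0.
Qed.

Lemma bernoulli_le (t : R) n : 0 <= t <= 1 -> 1 - n%:R * t <= (1 - t) ^+ n.
Proof.
move=> /andP[t0 t1]; elim: n => [|n IH]; first by rewrite expr0 mul0r subr0.
rewrite exprS -natr1; apply: (@le_trans _ _ ((1 - t) * (1 - n%:R * t))).
  by have := ler0n R n; nra.
by rewrite ler_wpM2l// subr_ge0.
Qed.

(** With q = sqrt(r), n r^n = (n q^n) q^n, and n q^n (1 - q) <= 1 - q^n by induction. *)
Lemma cvg_natM_expr (r : R) : 0 <= r < 1 -> (fun n => n%:R * r ^+ n) @ \oo --> (0 : R).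
Proof.
move=> /andP[r0 r1]; pose q := Num.sqrt r.
have q0 : 0 <= q by exact: sqrtr_ge0.
have qr : q ^+ 2 = r by rewrite sqr_sqrtr.
have q1 : q < 1 by rewrite -(@ltr_pXn2r _ 2)// ?nnegrE// qr expr1n.
have b n : n%:R * q ^+ n <= (1 - q)^-1.
  rewrite -[leRHS]mul1r ler_pdivlMr ?subr_gt0//.
  suff : n%:R * q ^+ n * (1 - q) <= 1 - q ^+ n.
    by have := exprn_ge0 n q0; lra.
  elim: n => [|n IH]; first by rewrite !mul0r expr0 subrr.
  rewrite exprS -natr1; have := exprn_ge0 n q0 => qn.
  have qn1 : q ^+ n <= 1 by rewrite exprn_ile1// ltW.
  have h1 : q * (n%:R * q ^+ n * (1 - q)) <= q * (1 - q ^+ n) by rewrite ler_wpM2l.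
  have h2 : 0 <= (1 - q) * (1 - q * q ^+ n).
    by rewrite mulr_ge0// subr_ge0 ?mulr_ile1// ltW.
  by move: h1 h2; move: (q ^+ n) (n%:R : R) => a k; nra.
apply: (@squeeze_cvgr _ _ _ _ (fun=> 0) (fun n => (1 - q)^-1 * q ^+ n)).
- apply: nearW => n; rewrite mulr_ge0 ?exprn_ge0//=.
  by rewrite -{1}qr -exprM mulnC exprM expr2 mulrA ler_wpM2r ?exprn_ge0.
- exact: cvg_cst.
- rewrite -[X in _ --> X](mulr0 (1 - q)^-1); apply: cvgMr.
  by apply: cvg_expr; rewrite ger0_norm.
Qed.

(** A variant of the polynomials (1 - u^n)^(k^n) of the elementary proof of the Stone-Weierstrass
    theorem. The extra factor [n] in the exponent makes the value at u = 1/2 tend to 0 as well, so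
    that the limit is known at every point. *)
Definition step_approx n (u : R) : R := (1 - u ^+ n) ^+ (n * 2 ^ n).

Lemma step_approx_itv n u : 0 <= u <= 1 -> 0 <= step_approx n u <= 1.
Proof.
move=> /andP[u0 u1]; have un1 := exprn_ile1 n u0 u1; have un0 := exprn_ge0 n u0.
by rewrite exprn_ge0 ?subr_ge0//= exprn_ile1 ?subr_ge0// lerBlDr lerDl.
Qed.

(** Bernoulli's inequality on both sides of 1/2. Below, the value is at least 1 - n (2u)^n. From 1/2
    on, its product with (1 + u^n)^(n 2^n) >= n + 1 is at most 1, so it is at most 1 / (n + 1). *)
Lemma cvg_step_approx (u : R) : 0 <= u <= 1 ->
  (fun n => step_approx n u) @ \oo --> (if (u < 2^-1)%R then 1 else 0 : R).
Proof.
move=> u01; have /andP[u0 u1] := u01; case: ltP => uh.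
  have r01 : 0 <= 2 * u < 1 by apply/andP; split; lra.
  apply: (@squeeze_cvgr _ _ _ _ (fun n => 1 - n%:R * (2 * u) ^+ n) (fun=> 1)).
  - apply: nearW => n; have /andP[_ ->] := step_approx_itv n u01; rewrite andbT.
    apply: le_trans (bernoulli_le _ _); last by rewrite exprn_ge0//= exprn_ile1.
    by rewrite natrM natrX exprMn mulrA.
  - rewrite -[X in _ --> X]subr0; apply: cvgB; [exact: cvg_cst|exact: cvg_natM_expr].
  - exact: cvg_cst.
apply: (@squeeze_cvgr _ _ _ _ (fun=> 0) (@harmonic R)).
- apply: nearW => n; have /andP[-> _] := step_approx_itv n u01; rewrite andTb.
  rewrite /harmonic -[leRHS]mul1r ler_pdivlMr ?ltr0n//.
  have un1 := exprn_ile1 n u0 u1; have un0 := exprn_ge0 n u0.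
  set m := (n * 2 ^ n)%N.
  have mu : n.+1%:R <= (1 + u ^+ n) ^+ m.
    apply: le_trans (bernoulli_ge _ un0); rewrite -natr1 addrC lerD2l.
    rewrite natrM natrX -mulrA -exprMn ler_peMr// exprn_ege1//; lra.
  apply: (@le_trans _ _ ((1 - u ^+ n) ^+ m * (1 + u ^+ n) ^+ m)).
    by rewrite ler_wpM2l// exprn_ge0// subr_ge0.
  by rewrite -exprMn exprn_ile1//; nra.
- exact: cvg_cst.
- exact: cvg_harmonic.
Qed.

End step_function.

(** * Density of the harmonic span in L2 of the sphere *)

Section l2_density.
Local Open Scope complex_scope.
Local Open Scope ring_scope.
Context {R : realType}.
Local Notation mS := (@measurable_sphere R).

Lemma measurable_normc_sqrE (g : 'cV[R]_3 -> R[i]) : cmeasurable sphere g ->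
  measurable_fun sphere (fun x => (normc (g x) ^+ 2)%:E).
Proof. by move=> mg; apply/measurable_EFinP; exact: measurable_normc_sqr. Qed.

Lemma le_l2norm_sq (h h' : 'cV[R]_3 -> R[i]) : cmeasurable sphere h ->
  cmeasurable sphere h' -> (forall x, sphere x -> normc (h x) <= normc (h' x)) ->
  (l2norm_sq h <= l2norm_sq h')%E.
Proof.
move=> mh mh' hh; apply: ge0_le_integral; first exact: mS.
- by move=> x _; rewrite lee_fin sqr_ge0.
- exact: measurable_normc_sqrE.
- exact: measurable_normc_sqrE.
- by move=> x /hh hx; rewrite lee_fin ler_pXn2r ?nnegrE ?normc_ge0.
Qed.

Lemma l2norm_sqZ (c : R[i]) (h : 'cV[R]_3 -> R[i]) : cmeasurable sphere h ->
  l2norm_sq (fun x => c * h x) = ((normc c ^+ 2)%:E * l2norm_sq h)%E.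
Proof.
move=> mh; rewrite /l2norm_sq -ge0_integralZl_EFin//.
- by apply: eq_integral => x _; rewrite normcM exprMn EFinM.
- exact: mS.
- by move=> x _; rewrite lee_fin sqr_ge0.
- exact: measurable_normc_sqrE.
- exact: sqr_ge0.
Qed.

Lemma l2norm_sqD (h h' : 'cV[R]_3 -> R[i]) : cmeasurable sphere h ->
  cmeasurable sphere h' ->
  (l2norm_sq (fun x => (h x + h' x)%R) <= 2%:E * l2norm_sq h + 2%:E * l2norm_sq h')%E.
Proof.
move=> mh mh'.
have nn (g : 'cV[R]_3 -> R[i]) x : (0 <= (normc (g x) ^+ 2)%:E)%E by rewrite lee_fin sqr_ge0.
rewrite -!ge0_integralZl_EFin //; try (exact: mS); try (exact: measurable_normc_sqrE).
rewrite -ge0_integralD //; try (exact: mS).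
- apply: ge0_le_integral; try (exact: mS).
  + by move=> x _; rewrite lee_fin sqr_ge0.
  + by apply: measurable_normc_sqrE; exact: cmeasurableD.
  + by apply: emeasurable_funD; apply: measurable_funeM; exact: measurable_normc_sqrE.
  + by move=> x _; rewrite -!EFinM -EFinD lee_fin normc_sqrD.
- by move=> x _; rewrite mule_ge0.
- by apply: measurable_funeM; exact: measurable_normc_sqrE.
- by move=> x _; rewrite mule_ge0.
- by apply: measurable_funeM; exact: measurable_normc_sqrE.
Qed.

Lemma eq_l2norm_sq (h h' : 'cV[R]_3 -> R[i]) : (forall x, sphere x -> h x = h' x) ->
  l2norm_sq h = l2norm_sq h'.
Proof. by move=> hh; apply: eq_integral => x /set_mem /hh ->. Qed.

Definition l2_approx (h : 'cV[R]_3 -> R[i]) := cmeasurable sphere h /\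
  forall e : R, 0 < e -> exists2 g, harmonic_span g &
    (l2norm_sq (fun x => (h x - g x)%R) <= e%:E)%E.

Lemma eq_l2_approx h h' : (forall x, sphere x -> h x = h' x) ->
  l2_approx h -> l2_approx h'.
Proof.
move=> hh [mh H]; split; first exact: eq_cmeasurable mh.
move=> e e0; have [g sg gh] := H e e0; exists g => //.
by rewrite -(@eq_l2norm_sq (fun x => h x - g x))// => x sx; rewrite hh.
Qed.

Lemma l2_approx_span g : harmonic_span g -> l2_approx g.
Proof.
move=> sg; split; first exact: cmeasurable_harmonic_span.
move=> e e0; exists g => //; rewrite /l2norm_sq integral0_eq ?lee_fin ?ltW// => x _.
by rewrite subrr normc0 expr0n.
Qed.

Lemma cmeasurableB (D : set 'cV[R]_3) (f g : 'cV[R]_3 -> R[i]) : cmeasurable D f ->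
  cmeasurable D g -> cmeasurable D (fun x => f x - g x).
Proof.
move=> mf mg; apply: (@eq_cmeasurable _ _ _ _ (fun x => f x + (-1) * g x)).
  by move=> x _; rewrite mulN1r.
by apply: cmeasurableD => //; exact: cmeasurableZ.
Qed.

Lemma l2_approx_of (h : 'cV[R]_3 -> R[i]) : cmeasurable sphere h ->
  (forall e : R, 0 < e -> exists2 h', l2_approx h' &
     (l2norm_sq (fun x => (h x - h' x)%R) <= e%:E)%E) ->
  l2_approx h.
Proof.
move=> mh H; split => // e e0.
(* A quarter each, since [l2norm_sqD] doubles both squared distances. *)
have e4 : 0 < e / 4 by rewrite divr_gt0.
have [h' [mh' H'] hh'] := H _ e4; have [g sg h'g] := H' _ e4; exists g => //.
have mg := cmeasurable_harmonic_span sg.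
rewrite (@eq_l2norm_sq _ (fun x => (h x - h' x) + (h' x - g x))); last first.
  by move=> x _; rewrite addrA subrK.
apply: le_trans (l2norm_sqD (cmeasurableB mh mh') (cmeasurableB mh' mg)) _.
rewrite (_ : e%:E = 2%:E * (e / 4)%:E + 2%:E * (e / 4)%:E)%E; last first.
  by rewrite -!EFinM -EFinD; congr EFin; field.
by apply: leeD; apply: lee_pmul => //; rewrite ?lee_fin//; apply: integral_ge0 => x _;
  rewrite lee_fin sqr_ge0.
Qed.

Lemma l2_approxD h h' : l2_approx h -> l2_approx h' -> l2_approx (fun x => h x + h' x).
Proof.
move=> [mh H] [mh' H']; split; first exact: cmeasurableD.
move=> e e0; have e4 : 0 < e / 4 by rewrite divr_gt0.
have [g sg hg] := H _ e4; have [g' sg' hg'] := H' _ e4.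
exists (fun x => g x + g' x); first exact: harmonic_spanD.
have mg := cmeasurable_harmonic_span sg; have mg' := cmeasurable_harmonic_span sg'.
rewrite (@eq_l2norm_sq _ (fun x => (h x - g x) + (h' x - g' x))); last first.
  by move=> x _; rewrite opprD addrACA.
apply: le_trans (l2norm_sqD (cmeasurableB mh mg) (cmeasurableB mh' mg')) _.
rewrite (_ : e%:E = 2%:E * (e / 4)%:E + 2%:E * (e / 4)%:E)%E; last first.
  by rewrite -!EFinM -EFinD; congr EFin; field.
by apply: leeD; apply: lee_pmul => //; rewrite ?lee_fin//; apply: integral_ge0 => x _;
  rewrite lee_fin sqr_ge0.
Qed.

(** Write h h' - g g' = h (h' - g') + g' (h - g). The approximation g' is chosen first, because its
    sup bound fixes the accuracy asked of g. *)
Lemma l2_approxM h h' (K : R) : (forall x, sphere x -> normc (h x) <= K) ->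
  l2_approx h -> l2_approx h' -> l2_approx (fun x => h x * h' x).
Proof.
move=> hK [mh H] [mh' H']; split; first exact: cmeasurableM.
move=> e e0.
have K1 : 0 < 4 * (`|K| ^+ 2 + 1) by rewrite mulr_gt0// ltr_wpDl// sqr_ge0.
have [g' sg' hg'] := H' _ (divr_gt0 e0 K1).
have [K' HK'] := harmonic_span_bounded sg'.
have K'1 : 0 < 4 * (`|K'| ^+ 2 + 1) by rewrite mulr_gt0// ltr_wpDl// sqr_ge0.
have [g sg hg] := H _ (divr_gt0 e0 K'1).
exists (fun x => g x * g' x); first exact: harmonic_spanM.
have mg := cmeasurable_harmonic_span sg; have mg' := cmeasurable_harmonic_span sg'.
rewrite (@eq_l2norm_sq _ (fun x => h x * (h' x - g' x) + g' x * (h x - g x))); last first.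
  by move=> x _; ring.
have m1 := cmeasurableB mh mg; have m2 := cmeasurableB mh' mg'.
apply: le_trans (l2norm_sqD (cmeasurableM mh m2) (cmeasurableM mg' m1)) _.
have b (f1 f2 : 'cV[R]_3 -> R[i]) (k : R) : cmeasurable sphere f1 -> cmeasurable sphere f2 ->
    0 < 4 * (`|k| ^+ 2 + 1) -> (forall x, sphere x -> normc (f1 x) <= k) ->
    (l2norm_sq f2 <= (e / (4 * (`|k| ^+ 2 + 1)))%:E)%E ->
    (2%:E * l2norm_sq (fun x => (f1 x * f2 x)%R) <= (e / 2)%:E)%E.
  move=> mf1 mf2 k1 f1k f2e.
  apply: (@le_trans _ _ (2%:E * ((`|k| ^+ 2)%:E * (e / (4 * (`|k| ^+ 2 + 1)))%:E))%E).
    apply: lee_pmul => //; first by apply: integral_ge0 => x _; rewrite lee_fin sqr_ge0.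
    apply: (@le_trans _ _ (l2norm_sq (fun x => (k%:C * f2 x)%R))).
      apply: le_l2norm_sq; [exact: cmeasurableM|exact: cmeasurableZ|].
      move=> x sx; rewrite !normcM normc_real ler_wpM2r ?normc_ge0//.
      exact: le_trans (f1k x sx) (ler_norm _).
    rewrite l2norm_sqZ// normc_real; apply: lee_pmul => //; rewrite ?lee_fin ?sqr_ge0//.
    by apply: integral_ge0 => x _; rewrite lee_fin sqr_ge0.
  rewrite -!EFinM lee_fin; move: k1; move: (`|k| ^+ 2) (sqr_ge0 `|k|) => a a0 a1.
  rewrite (_ : 2 * _ = e / 2 * (a / (a + 1))); last by field; rewrite gt_eqF// ltr_wpDl.
  by rewrite ler_piMr// ?divr_ge0 ?ltW// ltr_pdivrMr ?ltr_wpDl// mul1r ltrDl.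
apply: (@le_trans _ _ ((e / 2)%:E + (e / 2)%:E)%E).
  by apply: leeD; [exact: (b _ _ K)|exact: (b _ _ K')].
by rewrite -EFinD lee_fin; lra.
Qed.

Lemma l2_approx_dominated (h : 'cV[R]_3 -> R[i]) (hn : nat -> 'cV[R]_3 -> R[i])
    (G : 'cV[R]_3 -> R) : cmeasurable sphere h -> (forall n, l2_approx (hn n)) ->
  (forall x, sphere x -> (fun n => normc (h x - hn n x) ^+ 2) @ \oo --> (0 : R)) ->
  (forall n x, sphere x -> normc (h x - hn n x) ^+ 2 <= G x) ->
  (@surface R).-integrable sphere (EFin \o G) -> l2_approx h.
Proof.
move=> mh ah hl hG iG; apply: l2_approx_of => // e e0.
have m1 n : measurable_fun sphere (fun x => (normc (h x - hn n x) ^+ 2)%:E).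
  exact: measurable_normc_sqrE (cmeasurableB mh (ah n).1).
have c1 : {ae surface, forall x, sphere x ->
    (fun n => (normc (h x - hn n x) ^+ 2)%:E) @ \oo --> (0%E : \bar R)}.
  by apply: aeW => x sx; apply: cvg_EFin; [exact: nearW|exact: hl].
have d1 : {ae surface, forall x, forall n, sphere x ->
    (`|(normc (h x - hn n x) ^+ 2)%:E| <= (EFin \o G) x)%E}.
  by apply: aeW => x n sx /=; rewrite lee_fin ger0_norm ?sqr_ge0// hG.
have [_ _] := dominated_convergence mS m1 (measurable_cst 0%E) c1 iG d1.
rewrite integral0 => cv.
have : nbhs (0%E : \bar R) [set y | (y < e%:E)%E].
  by apply: open_nbhs_nbhs; split; [exact: open_ereal_lt_ereal|rewrite /= lte_fin].
move=> /cv [N _ /(_ N (leqnn N))] /= Ne.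
by exists (hn N); [exact: ah|exact: ltW].
Qed.

Lemma l2_approxZ c h : l2_approx h -> l2_approx (fun x => c * h x).
Proof.
move=> ah; apply: (@l2_approxM (fun=> c) h (normc c)) => //.
apply: l2_approx_span; apply: eq_harmonic_span (harmonic_spanZ c (harmonic_span_mono 0 0 1)).
by move=> x _; rewrite /mono !expr0 hornerC !mulr1.
Qed.

Lemma harmonic_span_cst c : harmonic_span (fun=> c : R[i]).
Proof.
apply: eq_harmonic_span (harmonic_spanZ c (harmonic_span_mono 0 0 1)).
by move=> x _; rewrite /mono !expr0 hornerC !mulr1.
Qed.

Lemma l2_approx_sum (I : Type) (r : seq I) (F : I -> 'cV[R]_3 -> R[i]) :
  (forall i, l2_approx (F i)) -> l2_approx (fun x => \sum_(i <- r) F i x).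
Proof.
move=> aF; elim: r => [|i r IH].
  by apply: eq_l2_approx (l2_approx_span harmonic_span0) => x _; rewrite big_nil.
by apply: eq_l2_approx (l2_approxD (aF i) IH) => x _; rewrite big_cons.
Qed.

Lemma harmonic_spanX (g : 'cV[R]_3 -> R[i]) n : harmonic_span g -> harmonic_span (fun x => g x ^+ n).
Proof.
move=> sg; elim: n => [|n IH]; first exact: (harmonic_span_cst 1).
by apply: eq_harmonic_span (harmonic_spanM sg IH) => x _; rewrite exprS.
Qed.

Lemma harmonic_span_coord (i : 'I_3) : harmonic_span (fun x : 'cV[R]_3 => (x i 0)%:C).
Proof.
have s1 := harmonic_span_mono 1 0 (1 : {poly R}).
have s2 := harmonic_span_mono 0 1 (1 : {poly R}).
have s3 := harmonic_span_mono 0 0 ('X : {poly R}).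
have [i0|i1|i2] : [\/ i = inord 0, i = inord 1 | i = inord 2].
  by case: i => -[|[|[|//]]] lt; [apply: Or31|apply: Or32|apply: Or33];
    apply: val_inj; rewrite /= inordK.
- apply: eq_harmonic_span (harmonic_spanZ (2^-1)%:C (harmonic_spanD s1 s2)) => x _.
  rewrite /mono !expr1 !expr0 hornerC mulr1 mul1r !mulr1 i0.
  by apply/eqP; rewrite eq_complex /=; apply/andP; split; apply/eqP; field.
- apply: eq_harmonic_span (harmonic_spanZ (0 +i* (- 2^-1))
    (harmonic_spanD s1 (harmonic_spanZ (-1) s2))) => x _.
  rewrite /mono !expr1 !expr0 hornerC mulr1 mul1r !mulr1 i1 mulN1r.
  by apply/eqP; rewrite eq_complex /=; apply/andP; split; apply/eqP; field.
- by apply: eq_harmonic_span s3 => x _; rewrite /mono !expr0 hornerX !mul1r i2.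
Qed.

Definition l2_set : set (set 'cV[R]_3) :=
  [set A | measurable A /\ l2_approx (fun x => (\1_A x)%:C)].

Lemma surface_integrable_cst (c : R) : (@surface R).-integrable sphere (EFin \o (fun=> c)).
Proof.
by apply: (@integrable_of_bounded _ _ _ _ _ _ `|c|);
  [exact: mS|exact: surface_sphere_lty|exact: measurable_cst|].
Qed.

Lemma sphere_coord_le1 (i : 'I_3) (x : 'cV[R]_3) : sphere x -> `|x i 0| <= 1.
Proof.
rewrite /sphere /= => sx; rewrite -(@ler_pXn2r _ 2)// ?nnegrE// real_normK ?num_real//.
rewrite expr1n -sx (bigD1 i)//= lerDl; apply: sumr_ge0 => j _; exact: sqr_ge0.
Qed.

(** An affine change of x_i carries the ray to u < 1/2, where [step_approx] converges to the
    indicator. As |x_i - c| <= 1 + |c| on the sphere, division by 2 (1 + |c|) keeps [u] in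
    [0, 1]. *)
Lemma l2_set_ray (i : 'I_3) (c : R) : l2_set [set x | x i 0 < c].
Proof.
have mA : measurable [set x : 'cV[R]_3 | x i 0 < c].
  have := @measurable_mx_entry _ R 3 1 i 0 measurableT `]-oo, c[%classic (measurable_itv _).
  by rewrite setTI; congr measurable; apply/seteqP; split => x /=; rewrite in_itv.
split => //.
pose K := 2 * (1 + `|c|).
have K0 : 0 < K by rewrite mulr_gt0// ltr_pwDl.
pose u (x : 'cV[R]_3) := 2^-1 + (x i 0 - c) / K.
have u01 x : sphere x -> 0 <= u x <= 1.
  move=> /(sphere_coord_le1 i) xi; rewrite /u.
  have : `|(x i 0 - c) / K| <= 2^-1.
    rewrite normrM normfV (gtr0_norm K0) ler_pdivrMr// /K mulrA mulVf// mul1r.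
    by apply: le_trans (ler_normB _ _) _; rewrite lerD2r.
  by rewrite ler_norml => /andP[? ?]; apply/andP; split; lra.
have uh x : (u x < 2^-1) = (x i 0 < c).
  by rewrite /u gtrDl pmulr_llt0 ?invr_gt0// subr_lt0.
have su : harmonic_span (fun x => (u x)%:C).
  apply: eq_harmonic_span (harmonic_spanD (harmonic_span_cst (2^-1 - c / K)%:C)
    (harmonic_spanZ (K^-1)%:C (harmonic_span_coord i))) => x _.
  by rewrite -rmorphM -rmorphD; congr (_%:C); rewrite /u; field; rewrite gt_eqF.
apply: (@l2_approx_dominated _ (fun n x => (step_approx n (u x))%:C) (fun=> 1)).
- by apply: cmeasurable_real; apply: measurable_funTS; exact: measurable_indic.
- move=> n; apply: l2_approx_span.
  apply: eq_harmonic_span (harmonic_spanX (n * 2 ^ n) (harmonic_spanD (harmonic_span_cst 1)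
    (harmonic_spanZ (-1) (harmonic_spanX n su)))) => x _.
  by rewrite /step_approx rmorphXn rmorphB rmorph1 rmorphXn mulN1r.
- move=> x sx; have := cvg_step_approx (u01 x sx); rewrite uh => cv.
  rewrite (_ : (fun n => _) = fun n => ((\1_[set x | x i 0 < c] x : R) - step_approx n (u x)) ^+ 2); last first.
    apply/funext => n; rewrite -rmorphB normc_real real_normK ?num_real//.
  have e : (if x i 0 < c then 1 else 0 : R) = \1_[set x | x i 0 < c] x.
    rewrite indicE; case: ifPn => xc; [rewrite mem_set//|rewrite memNset//].
    by move=> /=; exact/negP.
  rewrite -[X in _ --> X](expr0n R 2) -[X in X ^+ 2](subrr (\1_[set x | x i 0 < c] x : R)).
  apply: (@continuous_cvg _ _ _ _ _ _ (fun y : R => y ^+ 2)); first exact: exprn_continuous.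
  by apply: cvgB; [exact: cvg_cst|rewrite -e].
- move=> n x sx; rewrite -rmorphB normc_real real_normK ?num_real//.
  have := step_approx_itv n (u01 x sx) => /andP[s0 s1].
  rewrite -real_normK ?num_real// exprn_ile1// indicE.
  by case: (_ \in _) => /=; rewrite ?mulr1n ?mulr0n ler_norml; apply/andP; split; lra.
- exact: surface_integrable_cst.
Qed.

Lemma l2_setC A : l2_set A -> l2_set (~` A).
Proof.
move=> [mA aA]; split; first exact: measurableC.
apply: eq_l2_approx (l2_approxD (l2_approx_span (harmonic_span_cst 1)) (l2_approxZ (-1) aA)).
by move=> x _; rewrite !indicE in_setC; case: (x \in A); rewrite /= mulN1r ?subrr ?oppr0 ?addr0.
Qed.

Lemma l2_setI A B : l2_set A -> l2_set B -> l2_set (A `&` B).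
Proof.
move=> [mA aA] [mB aB]; split; first exact: measurableI.
apply: eq_l2_approx (l2_approxM (K := 1) _ aA aB).
  by move=> x _; rewrite !indicE in_setI -rmorphM -natrM mulnb.
by move=> x _; rewrite normc_real indicE; case: (x \in A); rewrite ?normr1 ?normr0.
Qed.

Lemma l2_set0 : l2_set set0.
Proof.
split => //; apply: eq_l2_approx (l2_approx_span harmonic_span0) => x _.
by rewrite indic0.
Qed.

Lemma l2_set_bigcup (F : (set 'cV[R]_3)^nat) : (forall i, l2_set (F i)) ->
  l2_set (\bigcup_i F i).
Proof.
move=> lF.
pose G n := \big[setU/set0]_(k < n) F k.
have lG n : l2_set (G n).
  elim: n => [|n IH]; first by rewrite /G big_ord0; exact: l2_set0.
  rewrite /G big_ord_recr /= -/(G n) -[G n `|` _]setCK setCU.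
  by apply: l2_setC; apply: l2_setI; apply: l2_setC.
have mU : measurable (\bigcup_i F i) by apply: bigcup_measurable => i _; case: (lF i).
split => //.
have GU n x : G n x -> (\bigcup_i F i) x.
  by rewrite /G -bigcup_mkord => -[k _ Fk]; exists k.
apply: (@l2_approx_dominated _ (fun n x => (\1_(G n) x)%:C) (fun=> 1)).
- by apply: cmeasurable_real; apply: measurable_funTS; exact: measurable_indic.
- by move=> n; case: (lG n).
- move=> x _; have [[k _ Fk]|nU] := pselect ((\bigcup_i F i) x).
    apply: cvg_near_cst; exists k.+1 => // n kn.
    have Gx : G n x by rewrite /G -bigcup_mkord; exists k.
    by rewrite -rmorphB normc_real !indicE (mem_set Gx) (mem_set (GU _ _ Gx)) subrr normr0 expr0n.
  apply: cvg_near_cst; apply: nearW => n.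
  by rewrite -rmorphB normc_real !indicE !memNset// ?subrr ?normr0 ?expr0n// => /GU.
- move=> n x _; rewrite -rmorphB normc_real.
  by rewrite exprn_ile1// !indicE; case: (_ \in _); case: (_ \in _);
    rewrite ?subrr ?subr0 ?sub0r ?normrN ?normr1 ?normr0.
- exact: surface_integrable_cst.
Qed.

(** Two nested generation arguments: matrix sets are generated by Borel conditions on one entry, and
    Borel sets by the rays of [l2_set_ray]. *)
Lemma l2_set_measurable A : measurable A -> l2_set A.
Proof.
move=> mA; have : mx_measurable A by [].
apply: smallest_sub.
  split; first exact: l2_set0.
    by move=> B; rewrite setTD; exact: l2_setC.
  by move=> F; exact: l2_set_bigcup.
move=> B [[i j] _ [E mE <-]]; rewrite setTI /=; have {j} -> : j = 0 by exact: ord1.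
have : @measurable _ (measurableTypeR R) E := mE.
rewrite RGenInftyO.measurableE.
pose C := [set E : set R | l2_set ((fun x : 'cV[R]_3 => x i 0) @^-1` E)].
move=> h; suff : C E by [].
move: E h {mE}; apply: smallest_sub.
  split; rewrite /C /=; first by rewrite preimage_set0; exact: l2_set0.
    by move=> E; rewrite setTD preimage_setC; exact: l2_setC.
  by move=> F lF; rewrite preimage_bigcup; exact: l2_set_bigcup.
move=> E [c ->]; by have := l2_set_ray i c; rewrite /C /=; congr l2_set.
Qed.

(** Simple functions increase to [f]; their level sets are covered by [l2_set_measurable], and f^2
    dominates the squared distances. *)
Lemma l2_approx_nneg (f : 'cV[R]_3 -> R) : measurable_fun sphere f ->
  (forall x, sphere x -> 0 <= f x) ->
  (@surface R).-integrable sphere (EFin \o (fun x => f x ^+ 2)) ->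
  l2_approx (fun x => (f x)%:C).
Proof.
move=> mf f0 if2.
have mfE : measurable_fun sphere (EFin \o f) by exact/measurable_EFinP.
pose g := nnsfun_approx mS mfE.
have cg x : sphere x -> (fun n => g n x) @ \oo --> f x.
  move=> sx; have : (g n x)%:E @[n --> \oo] --> (f x)%:E.
    by apply: (cvg_nnsfun_approx mS mfE) => // y sy; rewrite lee_fin f0.
  by move=> /fine_cvgP[].
have gf n x : sphere x -> g n x <= f x.
  move=> sx; have := cg x sx => /cvg_lim <- //.
  apply: nondecreasing_cvgn_le; last by apply/cvg_ex; exists (f x); exact: cg.
  by move=> a b ab; have /lefP := nd_nnsfun_approx mS mfE ab; exact.
apply: (@l2_approx_dominated _ (fun n x => (g n x)%:C) (fun x => f x ^+ 2)) => //.
- move=> n.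
  have [t tE] : exists t : seq R, forall x : 'cV[R]_3,
      g n x = \sum_(r <- t) r * \1_(g n @^-1` [set r]) x.
    by eexists => x; rewrite [in LHS]fimfunE fsbig_finite.
  rewrite (_ : (fun x => _) = fun x : 'cV[R]_3 =>
      \sum_(r <- t) r%:C * (\1_(g n @^-1` [set r]) x)%:C); last first.
    by apply/funext => x; rewrite tE rmorph_sum; apply: eq_bigr => r _; exact: rmorphM.
  apply: l2_approx_sum => r; apply: l2_approxZ.
  by have [] : l2_set (g n @^-1` [set r]) by apply: l2_set_measurable; exact: measurable_sfunP.
- move=> x sx; rewrite (_ : (fun n => _) = fun n => (f x - g n x) ^+ 2); last first.
    by apply/funext => n; rewrite -rmorphB normc_real real_normK ?num_real.
  rewrite -[X in _ --> X](expr0n R 2) -[X in X ^+ 2](subrr (f x)).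
  apply: (@continuous_cvg _ _ _ _ _ _ (fun y : R => y ^+ 2)); first exact: exprn_continuous.
  by apply: cvgB; [exact: cvg_cst|exact: cg].
- move=> n x sx; rewrite -rmorphB normc_real ler_pXn2r ?nnegrE ?f0//.
  have h1 := gf n x sx; have h2 : 0 <= g n x by exact: fun_ge0.
  by rewrite ger0_norm ?subr_ge0// gerBl.
Qed.

Lemma Re_sum (I : Type) (r : seq I) (Q : pred I) (F : I -> R[i]) :
  complex.Re (\sum_(i <- r | Q i) F i) = \sum_(i <- r | Q i) complex.Re (F i).
Proof. by elim/big_rec2: _ => [//|i y x _ <-]; exact: ReD. Qed.

Lemma cintegral_orthonormal_sqr (I : finType) (e : I -> 'cV[R]_3 -> R[i]) (c : I -> R[i]) :
  (forall a, harmonic_span (e a)) ->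
  (forall a b, cintegral (@surface R) sphere (fun x => e a x * (e b x)^*) = (a == b)%:R) ->
  \int[@surface R]_(x in sphere) (normc (\sum_a c a * e a x) ^+ 2) = \sum_a normc (c a) ^+ 2.
Proof.
move=> se orth; apply: complexI; rewrite -cintegral_real.
have ie a b : cintegrable (@surface R) sphere (fun x => e a x * (e b x)^*).
  by apply: cintegrable_harmonic_span; apply: harmonic_spanM => //; exact: harmonic_span_conj.
rewrite (@eq_cintegral _ _ _ _ _ _ (fun x => \sum_a c a * \sum_b (c b)^* * (e a x * (e b x)^*))); last first.
  move=> x _; rewrite -mulc_conj rmorph_sum mulr_suml; apply: eq_bigr => a _.
  by rewrite !mulr_sumr; apply: eq_bigr => b _; rewrite rmorphM /=; ring.
have ib a : cintegrable (@surface R) sphere (fun x => \sum_b (c b)^* * (e a x * (e b x)^*)).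
  by apply: cintegrable_sum => [|b]; [exact: mS|apply: cintegrableZ; [exact: mS|]].
rewrite cintegral_sum; first last.
- by move=> a; apply: cintegrableZ; [exact: mS|].
- exact: mS.
rewrite rmorph_sum; apply: eq_bigr => a _; rewrite /= -mulc_conj.
rewrite cintegralZ; [|exact: mS|exact: ib]; congr (_ * _).
rewrite cintegral_sum; [|exact: mS|by move=> b; apply: cintegrableZ; [exact: mS|]].
rewrite (bigD1 a)//= big1 ?addr0 => [|b ba].
  by rewrite cintegralZ; [|exact: mS|exact: ie]; rewrite orth eqxx mulr1.
by rewrite cintegralZ; [|exact: mS|exact: ie]; rewrite orth eq_sym (negPf ba) mulr0.
Qed.

(* Expanding the square, [f - g] has squared norm
   [|f|^2 - 2 Re (sum conj(c_a) f_a) + sum |c_a|^2 >= |f|^2 - sum |f_a|^2]. *)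
Lemma l2_dist_ge (I : finType) (e : I -> 'cV[R]_3 -> R[i]) (c : I -> R[i]) (f : 'cV[R]_3 -> R) :
  (forall a, harmonic_span (e a)) ->
  (forall a b, cintegral (@surface R) sphere (fun x => e a x * (e b x)^*) = (a == b)%:R) ->
  (@surface R).-integrable sphere (EFin \o f) ->
  (@surface R).-integrable sphere (EFin \o (fun x => f x ^+ 2)) ->
  \int[@surface R]_(x in sphere) (f x ^+ 2) -
    \sum_a normc (cintegral (@surface R) sphere (fun x => (f x)%:C * (e a x)^*)) ^+ 2 <=
  \int[@surface R]_(x in sphere) (normc ((f x)%:C - \sum_a c a * e a x) ^+ 2).
Proof.
move=> se orth jf jf2.
pose g x := \sum_a c a * e a x.
have sg : harmonic_span g by apply: harmonic_span_sum => a; exact: harmonic_spanZ.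
pose fa a := cintegral (@surface R) sphere (fun x => (f x)%:C * (e a x)^*).
have cf : cintegrable (@surface R) sphere (fun x => (f x)%:C).
  by split => //; exact: (surface_integrable_cst 0).
have ia a : cintegrable (@surface R) sphere (fun x => (f x)%:C * (e a x)^*).
  have [K HK] := harmonic_span_bounded (se a).
  apply: (@eq_cintegrable _ _ _ _ _ (fun x => (e a x)^* * (f x)%:C)); first exact: mS.
    by move=> x _; rewrite mulrC.
  apply: (cintegrable_bounded_mul (M := K) mS _ _ cf).
    by apply: cmeasurable_conj; exact: cmeasurable_harmonic_span.
  by move=> x sx; rewrite normc_conj; exact: HK.
have ifg : cintegrable (@surface R) sphere (fun x => (f x)%:C * (g x)^*).
  apply: (@eq_cintegrable _ _ _ _ _ (fun x => \sum_a (c a)^* * ((f x)%:C * (e a x)^*))).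
  - exact: mS.
  - move=> x _; rewrite /g rmorph_sum mulr_sumr; apply: eq_bigr => a _.
    by rewrite rmorphM /= mulrCA.
  - by apply: cintegrable_sum => [|a]; [exact: mS|apply: cintegrableZ; [exact: mS|]].
have Efg : cintegral (@surface R) sphere (fun x => (f x)%:C * (g x)^*) = \sum_a (c a)^* * fa a.
  rewrite (@eq_cintegral _ _ _ _ _ _ (fun x => \sum_a (c a)^* * ((f x)%:C * (e a x)^*))); last first.
    move=> x _; rewrite /g rmorph_sum mulr_sumr; apply: eq_bigr => a _.
    by rewrite rmorphM /= mulrCA.
  rewrite cintegral_sum; first last.
  - by move=> a; apply: cintegrableZ; [exact: mS|].
  - exact: mS.
  by apply: eq_bigr => a _; rewrite cintegralZ; [|exact: mS|exact: ia].
have ig2 : (@surface R).-integrable sphere (EFin \o (fun x => normc (g x) ^+ 2)).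
  have [] := cintegrable_harmonic_span (harmonic_spanM sg (harmonic_span_conj sg)).
  by move=> h _; apply: eq_integrable h => [|x _]; [exact: mS|rewrite /= mulc_conj].
have ire : (@surface R).-integrable sphere
    (EFin \o (fun x => 2 * complex.Re ((f x)%:C * (g x)^*))).
  by have [h _] := ifg; apply: eq_integrable (integrableZl mS 2 h) => //; exact: mS.
have -> : \int[@surface R]_(x in sphere) (normc ((f x)%:C - \sum_a c a * e a x) ^+ 2) =
    \int[@surface R]_(x in sphere) (f x ^+ 2) + \sum_a normc (c a) ^+ 2
    - 2 * complex.Re (\sum_a (c a)^* * fa a).
  rewrite -Efg -(cintegral_orthonormal_sqr c se orth) /cintegral /=.
  rewrite -RintegralZl; [|exact: mS|by case: ifg].
  rewrite -RintegralD; [|exact: mS|exact: jf2|exact: ig2].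
  rewrite -RintegralB; [|exact: mS| |exact: ire].
    by apply: eq_Rintegral => x _; rewrite normc_sqrB normc_real real_normK ?num_real.
  by apply: eq_integrable (integrableD mS jf2 ig2) => //; exact: mS.
rewrite -addrA lerD2l Re_sum mulr_sumr -sumrB -sumrN; apply: ler_sum => a _.
rewrite -/(fa a) lerNl opprB.
have := sqr_ge0 (normc (fa a - c a)); rewrite normc_sqrB [_ * (c a)^*]mulrC; lra.
Qed.

(** A dependent pair, so that the double sum over degrees and orders runs over a single finite
    type. *)
Definition harmonic_index M := {l : 'I_M & 'I_(nat_of_ord l).*2.+1}.

Lemma sum_harmonic_index (V : nmodType) M (F : forall l : nat, 'I_l.*2.+1 -> V) :
  \sum_(l < M) \sum_(i < l.*2.+1) F l i = \sum_(a : harmonic_index M) F (tag a) (tagged a).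
Proof. exact: (sig_big_dep xpredT (fun _ => xpredT) (fun l : 'I_M => F l)). Qed.

Lemma harmonic_index_orthonormal M (a b : harmonic_index M) :
  cintegral (@surface R) sphere (fun x => Y (tagged a) x * (Y (tagged b) x)^*) = (a == b)%:R.
Proof.
rewrite cintegral_Y_conj; congr (nat_of_bool _)%:R.
apply/andP/eqP => [|->]; last by rewrite !eqxx.
case: a b => [l i] [l' j] /= [/eqP ll /eqP ij].
have {}ll : l = l' by apply: val_inj.
by subst l'; congr existT; exact: val_inj.
Qed.

(** The half of Parseval's identity that rests on completeness. An approximation of [f] within [e]
    is, for all large [M], a combination of the harmonics of degree below [M], and [l2_dist_ge]
    bounds its distance to [f] from below. *)
Lemma parseval_le (f : 'cV[R]_3 -> R) : (forall x, sphere x -> 0 <= f x) ->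
  (@surface R).-integrable sphere (EFin \o f) ->
  (@surface R).-integrable sphere (EFin \o (fun x => f x ^+ 2)) ->
  forall e : R, 0 < e -> exists M0 : nat, forall M, (M0 <= M)%N ->
    \int[@surface R]_(x in sphere) (f x ^+ 2) <=
    \sum_(l < M) \sum_(i < l.*2.+1) normc (sphere_fourier (fun x => (f x)%:C) i) ^+ 2 + e.
Proof.
move=> f0 jf jf2 e e0.
have mf : measurable_fun sphere f by apply/measurable_EFinP; exact: measurable_int jf.
have [mfC /(_ e e0) [g sg]] := l2_approx_nneg mf f0 jf2.
have mg := cmeasurable_harmonic_span sg.
have [c [M0 gE]] := sg => fg; exists M0 => M MM.
rewrite (sum_harmonic_index M (fun l i => normc (sphere_fourier (fun x => (f x)%:C) i) ^+ 2)).
rewrite -lerBlDl.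
have /le_trans := @l2_dist_ge (harmonic_index M) (fun a => Y (tagged a))
  (fun a => c (tag a) (tagged a)) f (fun a => harmonic_span_Y (tagged a))
  (@harmonic_index_orthonormal M) jf jf2.
apply.
move: fg; rewrite (@eq_l2norm_sq _ (fun x => (f x)%:C -
    \sum_(a : harmonic_index M) c (tag a) (tagged a) * Y (tagged a) x)); last first.
  by move=> x sx; rewrite (gE M)// (sum_harmonic_index M (fun l i => c l i * Y i x)).
rewrite /l2norm_sq /Rintegral => h.
rewrite -lee_fin fineK// fin_numE; apply/andP; split.
  by rewrite gt_eqF// (lt_le_trans (ltNyr 0))// integral_ge0// => x _; rewrite lee_fin sqr_ge0.
by rewrite lt_eqF// (le_lt_trans h)// ltry.
Qed.

End l2_density.

(** * Rotation coefficients *)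

(** Linearly independent functions have an invertible evaluation matrix at suitable points. The
    points are found one by one: a nonzero kernel vector of the current rows is a combination that
    does not vanish identically, and a point where it is nonzero gives an independent row. *)
Lemma exists_unit_evaluation (K : fieldType) (T : Type) (S : T -> Prop) n
    (f : 'I_n -> T -> K) :
  (forall a : 'cV[K]_n, (forall x, S x -> \sum_j f j x * a j 0 = 0) -> a = 0) ->
  exists x : 'I_n -> T, (forall k, S (x k)) /\ \matrix_(k, j) f j (x k) \in unitmx.
Proof.
move=> H.
suff step r : (r <= n)%N -> exists x : 'I_r -> T, (forall k, S (x k)) /\
    row_free (\matrix_(k < r, j < n) f j (x k)).
  have [x [Sx rx]] := step n (leqnn n); exists x; split => //.
  by rewrite -row_free_unit.
elim: r => [|r IH] rn.
  exists (fun k : 'I_0 => False_rect _ (notF (valP k))); split; first by case.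
  by rewrite /row_free flatmx0 mxrank0.
have [x [Sx rx]] := IH (ltnW rn).
set A := \matrix_(k, j) _ in rx.
have [a a0 Aa] : exists2 a : 'cV[K]_n, a != 0 & A *m a = 0.
  have k0 : kermx A^T != 0.
    rewrite -mxrank_eq0 mxrank_ker mxrank_tr; move/eqP: rx => ->.
    by rewrite subn_eq0 -ltnNge.
  have /row_subP/= := submx_refl (kermx A^T).
  have [i ki] : exists i, row i (kermx A^T) != 0.
    apply/existsP; apply: contraNT k0 => /existsPn k0.
    by apply/eqP/row_matrixP => i; rewrite row0; apply/eqP; rewrite -[_ == _]negbK k0.
  move=> _; exists (row i (kermx A^T))^T; first by rewrite trmx_eq0.
  apply: trmx_inj; rewrite trmx_mul trmxK trmx0; apply/eqP; rewrite -sub_kermx.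
  exact: row_sub.
have [y Sy ya] : exists2 y, S y & \sum_j f j y * a j 0 != 0.
  apply: contrapT => nex; move/eqP: a0; apply; apply: H => x' Sx'.
  by apply/eqP; apply: contrapT => /negP ne; apply: nex; exists x'.
rewrite -addn1.
exists (fun k => match fintype.split k with inl k' => x k' | inr _ => y end); split.
  by move=> k; case: fintype.split.
pose v := \row_j f j y.
have -> : \matrix_(k < r + 1, j < n) f j (match fintype.split k with inl k' => x k' | inr _ => y end)
    = col_mx A v.
  by apply/matrixP => k j; rewrite !mxE; case: fintype.split => k'; rewrite !mxE.
apply: inj_row_free => b; rewrite -[b]hsubmxK mul_row_col => E.
have va : (v *m a) 0 0 != 0.
  by rewrite mxE; under eq_bigr do rewrite mxE.
have b2 : rsubmx b = 0.
  have := congr1 (fun w => (w *m a) 0 0) E; rewrite mulmxDl -!mulmxA Aa mulmx0 add0r mul0mx.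
  rewrite [rsubmx b]mx11_scalar mul_scalar_mx !mxE => /eqP; rewrite mulf_eq0.
  by move: va; rewrite mxE => /negPf -> ; rewrite orbF => /eqP ->; rewrite raddf0.
have b1 : lsubmx b = 0.
  by apply/eqP; rewrite -(mulmx_free_eq0 _ rx); move: E; rewrite b2 mul0mx addr0 => ->.
by rewrite b1 b2 row_mx0.
Qed.

Section rotation_coefficients.
Local Open Scope complex_scope.
Local Open Scope ring_scope.
Context {R : realType}.

Lemma measurable_fun_mx d (T : measurableType d) d' (T' : measurableType d') m n
    (D : set T) (V : T -> 'M[T']_(m, n)) : measurable D ->
  (forall i j, measurable_fun D (fun w => V w i j)) -> measurable_fun D V.
Proof.
move=> mD mV; apply: (@measurability _ _ _ _ _ _ (\bigcup_(ij in [set: 'I_m * 'I_n])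
  preimage_set_system setT (fun A : 'M[T']_(m, n) => A ij.1 ij.2) measurable)) => //.
by move=> B [C [ij _ [E mE <-]] <-]; rewrite setTI; exact: (mV ij.1 ij.2 mD E mE).
Qed.

Lemma cmeasurable_comp d (T : measurableType d) d' (T' : measurableType d')
    (D : set T) (V : T -> T') (phi : T' -> R[i]) :
  cmeasurable setT phi -> measurable_fun D V -> cmeasurable D (fun w => phi (V w)).
Proof. by move=> [mr mi] mV; split; [exact: (measurableT_comp mr mV)|exact: (measurableT_comp mi mV)]. Qed.

Lemma measurable_mulmx_col d (T : measurableType d) (D : set T)
    (A : T -> 'M[R]_3) (v : T -> 'cV[R]_3) : measurable D ->
  measurable_fun D A -> measurable_fun D v -> measurable_fun D (fun w => A w *m v w).
Proof.
move=> mD mA mv; apply: measurable_fun_mx => // i j.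
under eq_fun do rewrite mxE; apply: measurable_sum => k.
by apply: measurable_funM; [exact: (measurableT_comp (measurable_mx_entry _ _) mA)|
  exact: (measurableT_comp (measurable_mx_entry _ _) mv)].
Qed.

Lemma measurable_SO3 : measurable (@SO3 R).
Proof.
have mdet : measurable_fun setT (fun g : 'M[R]_3 => \det g).
  rewrite /determinant; apply: measurable_sum => s; apply: measurable_funM => //.
  by apply: measurable_prod => i _; exact: measurable_mx_entry.
have mtr i j : measurable_fun setT (fun g : 'M[R]_3 => (g^T *m g) i j).
  under eq_fun do rewrite mxE; apply: measurable_sum => k.
  under eq_fun do rewrite mxE.
  by apply: measurable_funM; exact: measurable_mx_entry.
have mm : measurable_fun setT (fun g : 'M[R]_3 => g^T *m g).
  exact: measurable_fun_mx.
have -> : @SO3 R = (\bigcap_(i in [set: 'I_3]) \bigcap_(j in [set: 'I_3])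
    [set g | (g^T *m g) i j = (1%:M : 'M[R]_3) i j]) `&` [set g | \det g = 1].
  apply/seteqP; split => g /= [g1 g2]; split => //.
    by move=> i _ j _ /=; rewrite g1.
  by apply/matrixP => i j; exact: g1.
apply: measurableI.
  apply: fin_bigcap_measurable => // i _; apply: fin_bigcap_measurable => // j _.
  by rewrite -[X in measurable X]setTI; exact: mtr measurableT [set _] (measurable_set1 _).
by rewrite -[X in measurable X]setTI; exact: mdet measurableT [set 1] (measurable_set1 1).
Qed.

Lemma sphere_SO3 (g : 'M[R]_3) (x : 'cV[R]_3) : SO3 g -> sphere x -> sphere (g *m x).
Proof.
have E (y : 'cV[R]_3) : \sum_i y i 0 ^+ 2 = (y^T *m y) 0 0.
  by rewrite mxE; apply: eq_bigr => i _; rewrite mxE expr2.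
move=> [g1 _]; rewrite /sphere /= !E trmx_mul mulmxA -(mulmxA x^T) g1 mulmx1.
by [].
Qed.

(** [rotational_harmonics] leaves the regularity of [D] in the rotation open. Evaluated at points
    x_k where the harmonics of degree l have an invertible matrix, it expresses [D l g] linearly in
    the values of Y at g x_k, hence as a bounded measurable function on [SO3]. *)
Lemma rotation_coefficients (D : forall l : nat, 'M[R]_3 -> 'M[R[i]]_l.*2.+1) l :
  rotational_harmonics D -> exists (De : 'M[R]_3 -> 'M[R[i]]_l.*2.+1) (K : R),
    [/\ (forall i j, cmeasurable setT (fun g => De g i j)),
        (forall g, SO3 g -> D l g = De g) &
        (forall g, SO3 g -> forall i j, normc (De g i j) <= K)].
Proof.
move=> hD.
have hDl g x : SO3 g -> sphere x -> forall i : 'I_l.*2.+1,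
    (Y i (g *m x))^* = \sum_j D l g i j * (Y j x)^* by exact: hD.
have [a H|x [Sx xu]] := @exists_unit_evaluation R[i] _ (@sphere R) l.*2.+1
    (fun j x => (Y j x)^*).
  have mS := @measurable_sphere R.
  (* Linear independence: integrating a vanishing combination against [Y i] isolates its i-th
     coefficient. *)
  apply/matrixP => i k; rewrite !mxE; have {k} -> : k = 0 by exact: ord1.
  have iY j : cintegrable (@surface R) sphere (fun x => Y i x * (Y j x)^*).
    apply: cintegrable_harmonic_span; apply: harmonic_spanM; first exact: harmonic_span_Y.
    exact: harmonic_span_Yconj.
  have : cintegral (@surface R) sphere (fun x => \sum_j a j 0 * (Y i x * (Y j x)^*)) =
      cintegral (@surface R) sphere (fun=> 0).
    apply: eq_cintegral => x sx; transitivity (Y i x * \sum_j (Y j x)^* * a j 0).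
      by rewrite mulr_sumr; apply: eq_bigr => j _; ring.
    by rewrite (H x sx) mulr0.
  rewrite cintegral0.
  rewrite cintegral_sum; [|exact: mS|by move=> j; apply: cintegrableZ].
  rewrite (bigD1 i)//= big1 ?addr0 => [|j ji].
    by rewrite cintegralZ// cintegral_Y_conj !eqxx mulr1.
  by rewrite cintegralZ// cintegral_Y_conj eqxx [_ == _](negPf _) ?mulr0//= eq_sym.
pose M : 'M[R[i]]_l.*2.+1 := \matrix_(k, j) (Y j (x k))^*.
pose N := (invmx M)^T.
pose De g : 'M[R[i]]_l.*2.+1 := \matrix_(i, j) \sum_k (Y i (g *m x k))^* * N k j.
exists De, (\sum_k \sum_j (Num.sqrt (l.*2.+1%:R / (4 * pi)) * normc (N k j))); split.
- move=> i j; rewrite /De; under eq_fun do rewrite mxE.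
  apply: cmeasurable_sum => k; apply: cmeasurableM; last exact: cmeasurable_cst.
  apply: cmeasurable_conj; apply: cmeasurable_comp; first exact: cmeasurable_Y.
  by apply: measurable_mulmx_col.
- move=> g Sg; have E : D l g *m M^T = \matrix_(i, k) (Y i (g *m x k))^*.
    by apply/matrixP => i k; rewrite !mxE hDl//; apply: eq_bigr => j _; rewrite !mxE.
  have -> : De g = (\matrix_(i, k) (Y i (g *m x k))^*) *m N.
    by apply/matrixP => i k; rewrite !mxE; apply: eq_bigr => j _; rewrite !mxE.
  by rewrite -E /N -mulmxA -trmx_mul mulVmx// trmx1 mulmx1.
- move=> g Sg i j; rewrite /De mxE; apply: le_trans (le_normc_sum _ _ _) _.
  apply: ler_sum => k _; rewrite normcM normc_conj (bigD1 j)//= -[leLHS]addr0 lerD//.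
    by rewrite ler_wpM2r ?normc_ge0// normc_Y_le//; exact: sphere_SO3.
  by apply: sumr_ge0 => j' _; rewrite mulr_ge0 ?normc_ge0.
Qed.

End rotation_coefficients.

(** * Independence *)

Section expectation.
Local Open Scope complex_scope.
Local Open Scope ring_scope.
Context {R : realType} {d : measure_display} {Om : measurableType d}.
Implicit Types X Y : Om -> R[i].

Definition bounded_rv X := cmeasurable setT X /\ exists K : R, forall w, normc (X w) <= K.

Lemma bounded_rv_cst c : bounded_rv (fun=> c).
Proof. by split; [exact: cmeasurable_cst|exists (normc c)]. Qed.

Lemma bounded_rvD X Y : bounded_rv X -> bounded_rv Y -> bounded_rv (fun w => X w + Y w).
Proof.
move=> [mX [K HK]] [mY [L HL]]; split; first exact: cmeasurableD.
exists (K + L) => w; apply: le_trans (le_normcD _ _) _; exact: lerD.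
Qed.

Lemma bounded_rvM X Y : bounded_rv X -> bounded_rv Y -> bounded_rv (fun w => X w * Y w).
Proof.
move=> [mX [K HK]] [mY [L HL]]; split; first exact: cmeasurableM.
by exists (K * L) => w; rewrite normcM ler_pM ?normc_ge0.
Qed.

Lemma bounded_rvZ c X : bounded_rv X -> bounded_rv (fun w => c * X w).
Proof. by move=> bX; apply: bounded_rvM => //; exact: bounded_rv_cst. Qed.

Lemma bounded_rv_conj X : bounded_rv X -> bounded_rv (fun w => (X w)^*).
Proof.
move=> [mX [K HK]]; split; first exact: cmeasurable_conj.
by exists K => w; rewrite normc_conj.
Qed.

Lemma bounded_rv_sum (I : Type) (r : seq I) (F : I -> Om -> R[i]) :
  (forall i, bounded_rv (F i)) -> bounded_rv (fun w => \sum_(i <- r) F i w).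
Proof.
move=> bF; elim: r => [|i r IH].
  by under eq_fun do rewrite big_nil; exact: bounded_rv_cst.
by under eq_fun do rewrite big_cons; exact: bounded_rvD.
Qed.

Lemma bounded_rv_prod (I : eqType) (r : seq I) (F : I -> Om -> R[i]) :
  (forall i, i \in r -> bounded_rv (F i)) -> bounded_rv (fun w => \prod_(i <- r) F i w).
Proof.
elim: r => [|i r IH] bF.
  by under eq_fun do rewrite big_nil; exact: bounded_rv_cst.
under eq_fun do rewrite big_cons; apply: bounded_rvM; first by apply: bF; rewrite mem_head.
by apply: IH => j jr; apply: bF; rewrite in_cons jr orbT.
Qed.

Lemma bounded_rv_indic (A : set Om) : measurable A -> bounded_rv (fun w => (\1_A w)%:C).
Proof.
move=> mA; split; first by apply: cmeasurable_real; exact: measurable_indic.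
by exists 1 => w; rewrite normc_real indicE; case: (_ \in _); rewrite ?normr1 ?normr0.
Qed.

Variable Pr : probability Om R.
Definition cexp X := cintegral Pr setT X.

Lemma bounded_rv_cintegrable X : bounded_rv X -> cintegrable Pr setT X.
Proof.
move=> [mX [K HK]]; apply: (@cintegrable_bounded _ _ _ Pr setT X K) => //.
by rewrite [X in (X < _)%E](@probability_setT _ _ _ Pr) ltry.
Qed.

Lemma cexp_ext X Y : (forall w, X w = Y w) -> cexp X = cexp Y.
Proof. by move=> XY; apply: eq_cintegral => w _. Qed.

Lemma cexpD X Y : bounded_rv X -> bounded_rv Y -> cexp (fun w => X w + Y w) = cexp X + cexp Y.
Proof. by move=> bX bY; apply: cintegralD => //; exact: bounded_rv_cintegrable. Qed.

Lemma cexpZ c X : bounded_rv X -> cexp (fun w => c * X w) = c * cexp X.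
Proof. by move=> bX; apply: cintegralZ => //; exact: bounded_rv_cintegrable. Qed.

Lemma cexp_sum (I : Type) (r : seq I) (F : I -> Om -> R[i]) : (forall i, bounded_rv (F i)) ->
  cexp (fun w => \sum_(i <- r) F i w) = \sum_(i <- r) cexp (F i).
Proof. by move=> bF; apply: cintegral_sum => // i; exact: bounded_rv_cintegrable. Qed.

Lemma cexp_conj X : bounded_rv X -> cexp (fun w => (X w)^*) = (cexp X)^*.
Proof. by move=> bX; apply: cintegral_conj => //; exact: bounded_rv_cintegrable. Qed.

Lemma cexp_indic (A : set Om) : measurable A -> cexp (fun w => (\1_A w)%:C) = (fine (Pr A))%:C.
Proof.
by move=> mA; rewrite /cexp cintegral_real /Rintegral integral_indic// setIT.
Qed.

Lemma cexp_cst c : cexp (fun=> c) = c.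
Proof.
rewrite (@cexp_ext _ (fun w => c * (\1_(@setT Om) w)%:C)).
  rewrite cexpZ; last exact: bounded_rv_indic.
  by rewrite cexp_indic// probability_setT mulr1.
by move=> w; rewrite indicT mulr1.
Qed.

End expectation.

(** * Expectations of products of independent factors *)

Section independent_family.
Local Open Scope complex_scope.
Local Open Scope ring_scope.
Context {R : realType} {d : measure_display} {Om : measurableType d}.
Variable Pr : probability Om R.
Variables (I : eqType) (dT : I -> measure_display) (T : forall k, measurableType (dT k)).
Unset Implicit Arguments.
Variables (V : forall k, Om -> T k) (m : forall k, {measure set (T k) -> \bar R}).
Variables (S : forall k, set (T k)) (f : forall k, T k -> R).
Hypotheses (mS : forall k, measurable (S k)) (mV : forall k, measurable_fun setT (V k)).
Hypotheses (VS : forall k w, S k (V k w)) (f0 : forall k x, S k x -> 0 <= f k x).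
Hypothesis jf : forall k, (m k).-integrable (S k) (EFin \o f k).
Hypothesis dens : forall k, has_density Pr (V k) (m k) (S k) (f k).
Hypothesis indep : mutually_independent Pr
  (fun k => preimage_set_system setT (V k) measurable).
Set Implicit Arguments.
Local Notation E := (cexp Pr).

Definition function_of k (X : Om -> R[i]) := exists (phi : T k -> R[i]) (K : R),
  [/\ cmeasurable (S k) phi, (forall y, S k y -> normc (phi y) <= K) &
      forall w, X w = phi (V k w)].

Lemma function_of_bounded k X : function_of k X -> bounded_rv X.
Proof.
move=> [phi [K [[mr mi] HK XE]]]; have VSk x : [set: Om] x -> S k (V k x) by [].
split; last by exists K => w; rewrite XE HK.
apply: (@eq_cmeasurable _ _ _ _ (fun w => phi (V k w))) => //.
have hr := measurable_comp_transfer (mS k) (mV k) VSk mr.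
have hi := measurable_comp_transfer (mS k) (mV k) VSk mi.
by split.
Qed.

Lemma cexp_density k (phi : T k -> R[i]) (K : R) : cmeasurable (S k) phi ->
  (forall y, S k y -> normc (phi y) <= K) ->
  E (fun w => phi (V k w)) = cintegral (m k) (S k) (fun y => phi y * (f k y)%:C).
Proof.
move=> mphi HK.
have i1 : Pr.-integrable setT (EFin \o (fun=> 1)).
  by have [] := bounded_rv_cintegrable Pr (bounded_rv_cst (1 : R[i])).
rewrite -(@cintegral_transfer _ _ _ _ _ Pr setT (m k) (S k) (V k) (fun=> 1) (f k)
  measurableT (mS k) (mV k) (fun w _ => VS k w) _ (@f0 k) i1 (@jf k) _ phi K)//.
  by apply: eq_cintegral => w _; rewrite mulr1.
move=> B mB; rewrite setTI -(dens k B mB) integral_cst ?mul1e//.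
by rewrite -[X in measurable X]setTI; exact: mV.
Qed.

Lemma cexp_mul_nneg k X (Z : Om -> R) (K : R) : function_of k X ->
  measurable_fun setT Z -> (forall w, 0 <= Z w <= K) ->
  (forall B, measurable B -> \int[Pr]_(w in V k @^-1` B) Z w =
     fine (Pr (V k @^-1` B)) * \int[Pr]_w Z w) ->
  E (fun w => X w * (Z w)%:C) = E X * (\int[Pr]_w Z w)%:C.
Proof.
move=> [phi [L [mphi HL XE]]] mZ Z01 HZ.
have mVB B : measurable B -> measurable (V k @^-1` B).
  by move=> mB; rewrite -[X in measurable X]setTI; exact: mV.
have iZ : Pr.-integrable setT (EFin \o Z).
  apply: (@integrable_of_bounded _ _ _ _ _ _ K) => //.
    by rewrite [X in (X < _)%E](@probability_setT _ _ _ Pr) ltry.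
  by move=> w _; have /andP[z0 z1] := Z01 w; rewrite ger0_norm.
set z := \int[Pr]_w Z w.
have z0 : 0 <= z by apply: Rintegral_ge0 => w _; have /andP[] := Z01 w.
rewrite (@cexp_ext _ _ _ _ _ (fun w => phi (V k w) * (Z w)%:C)); last by move=> w; rewrite XE.
rewrite (@cexp_ext _ _ _ _ X (fun w => phi (V k w)))// (cexp_density mphi HL).
rewrite (_ : E _ = cintegral (m k) (S k) (fun y => phi y * (z * f k y)%:C)).
  rewrite mulrC -cintegralZ//.
    by apply: eq_cintegral => y _; rewrite rmorphM /=; ring.
  apply: (cintegrable_bounded_mul (mS k) mphi HL); split; first exact: jf.
  exact: integrable0.
apply: (@cintegral_transfer _ _ _ _ _ Pr setT (m k) (S k) (V k) Z (fun y => z * f k y)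
  measurableT (mS k) (mV k) (fun w _ => VS k w) _ _ iZ _ _ phi L) => //.
- by move=> w _; have /andP[] := Z01 w.
- by move=> y Sy; rewrite mulr_ge0// f0.
- by apply: eq_integrable (integrableZl (mS k) z (jf k)) => //; exact: mS.
- move=> B mB; rewrite setTI.
  have iZB : Pr.-integrable (V k @^-1` B) (EFin \o Z).
    by apply: integrableS iZ => //; exact: mVB.
  have mSB : measurable (S k `&` B) by exact: measurableI.
  rewrite -[LHS]fineK; last exact: (integrable_fin_num (mVB _ mB) iZB).
  have fp : Pr (V k @^-1` B) \is a fin_num by apply: fin_num_measure; exact: mVB.
  transitivity ((fine (Pr (V k @^-1` B)) * z)%:E); first by congr (_%:E); exact: HZ.
  rewrite mulrC EFinM (fineK fp) (dens k B mB) -integralZl//.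
  by apply: integrableS (jf k) => //; exact: mS.
Qed.

(** The passage from events of [V k] to functions of it: the real and imaginary parts of [Y],
    shifted by its bound, are nonnegative weights for [cexp_mul_nneg]. *)
Lemma cexp_mul_indep k X Y : function_of k X -> bounded_rv Y ->
  (forall B, measurable B -> E (fun w => (\1_(V k @^-1` B) w)%:C * Y w) =
     (fine (Pr (V k @^-1` B)))%:C * E Y) ->
  E (fun w => X w * Y w) = E X * E Y.
Proof.
move=> fX bY HY; have [[mYr mYi] [K HK]] := bY.
have bX := function_of_bounded fX.
have mVB B : measurable B -> measurable (V k @^-1` B).
  by move=> mB; rewrite -[X in measurable X]setTI; exact: mV.
pose Zr w := complex.Re (Y w) + K; pose Zi w := complex.Im (Y w) + K.
have mZr : measurable_fun setT Zr by exact: measurable_funD.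
have mZi : measurable_fun setT Zi by exact: measurable_funD.
have Zr0 w : 0 <= Zr w <= K + K.
  have := le_trans (le_Re_normc _) (HK w); rewrite ler_norml => /andP[? ?].
  by rewrite /Zr; apply/andP; split; lra.
have Zi0 w : 0 <= Zi w <= K + K.
  have := le_trans (le_Im_normc _) (HK w); rewrite ler_norml => /andP[? ?].
  by rewrite /Zi; apply/andP; split; lra.
have [iYr iYi] := bounded_rv_cintegrable Pr bY.
have iK D : measurable D -> Pr.-integrable D (EFin \o (fun=> K)).
  move=> mD; apply: (@integrableS _ _ _ Pr setT) => //.
  by have [] := bounded_rv_cintegrable Pr (bounded_rv_cst (K%:C : R[i])).
have HB (h : Om -> R) B : measurable B -> Pr.-integrable setT (EFin \o h) ->
    \int[Pr]_w (\1_(V k @^-1` B) w * h w) = fine (Pr (V k @^-1` B)) * \int[Pr]_w h w ->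
    \int[Pr]_(w in V k @^-1` B) (h w + K) =
    fine (Pr (V k @^-1` B)) * \int[Pr]_w (h w + K).
  move=> mB ih Eh; have mB' := mVB B mB.
  have ihB : Pr.-integrable (V k @^-1` B) (EFin \o h) by apply: integrableS ih.
  rewrite (RintegralD mB' ihB (iK _ mB')) (RintegralD measurableT ih (iK _ measurableT)).
  rewrite mulrDr -Eh !Rintegral_cst//.
  have p1 : fine (Pr [set: Om]) = 1 by rewrite [X in fine X](@probability_setT _ _ _ Pr).
  rewrite p1 mulr1 [K * _]mulrC; congr (_ + _).
  by rewrite -[in LHS](setTI (V k @^-1` B)) /Rintegral integral_setI_indic.
have Er B : measurable B -> \int[Pr]_(w in V k @^-1` B) Zr w =
    fine (Pr (V k @^-1` B)) * \int[Pr]_w Zr w.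
  move=> mB; apply: HB => //; have := congr1 (@complex.Re R) (HY B mB).
  rewrite ReM /= mul0r subr0 => <-.
  by apply: eq_Rintegral => w _; rewrite ReM /= mul0r subr0.
have Ei B : measurable B -> \int[Pr]_(w in V k @^-1` B) Zi w =
    fine (Pr (V k @^-1` B)) * \int[Pr]_w Zi w.
  move=> mB; apply: HB => //; have := congr1 (@complex.Im R) (HY B mB).
  rewrite ImM /= mul0r addr0 => <-.
  by apply: eq_Rintegral => w _; rewrite ImM /= mul0r addr0.
have br : bounded_rv (fun w => (Zr w)%:C).
  by split; [exact: cmeasurable_real|exists (K + K) => w; rewrite normc_real ger0_norm;
    have /andP[] := Zr0 w].
have bi : bounded_rv (fun w => (Zi w)%:C).
  by split; [exact: cmeasurable_real|exists (K + K) => w; rewrite normc_real ger0_norm;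
    have /andP[] := Zi0 w].
have YE w : Y w = (Zr w)%:C + ('i%C * (Zi w)%:C + (- (K +i* K))).
  rewrite [LHS]complex_eta /Zr /Zi.
  by apply/eqP; rewrite eq_complex /=; apply/andP; split; apply/eqP; ring.
have cE (h : Om -> R) : E (fun w => (h w)%:C) = (\int[Pr]_w h w)%:C by exact: cintegral_real.
rewrite (@cexp_ext _ _ _ _ Y _ YE).
rewrite (@cexp_ext _ _ _ _ (fun w => X w * Y w) (fun w => X w * (Zr w)%:C +
  ('i%C * (X w * (Zi w)%:C) + (- (K +i* K)) * X w))); last first.
  by move=> w; rewrite YE; ring.
have bX1 := bounded_rvM bX br; have bX2 := bounded_rvZ 'i%C (bounded_rvM bX bi).
have bX3 := bounded_rvZ (- (K +i* K)) bX; have bi' := bounded_rvZ 'i%C bi.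
rewrite (cexpD Pr bX1 (bounded_rvD bX2 bX3)) (cexpD Pr bX2 bX3).
rewrite (cexpZ Pr _ (bounded_rvM bX bi)) (cexpZ Pr _ bX).
rewrite (cexpD Pr br (bounded_rvD bi' (bounded_rv_cst _))).
rewrite (cexpD Pr bi' (bounded_rv_cst _)) cexp_cst (cexpZ Pr _ bi) !cE.
rewrite (cexp_mul_nneg fX mZr Zr0 Er) (cexp_mul_nneg fX mZi Zi0 Ei); ring.
Qed.

(** Functions sit at the indices in [r], events at those in [s]. Induction on [r] trades one
    function for an arbitrary event of the same variable, and [cexp_mul_indep] converts back; for
    empty [r] this is the definition of independence. *)
Lemma cexp_prod_indic (r s : seq I) (X : I -> Om -> R[i]) (A : I -> set Om) :
  uniq (r ++ s) -> (forall k, k \in r -> function_of k (X k)) ->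
  (forall k, k \in s -> preimage_set_system setT (V k) measurable (A k)) ->
  E (fun w => \prod_(k <- r) X k w * \prod_(k <- s) (\1_(A k) w)%:C) =
  \prod_(k <- r) E (X k) * \prod_(k <- s) (fine (Pr (A k)))%:C.
Proof.
have mA k B : preimage_set_system setT (V k) measurable B -> measurable B.
  by move=> [C mC <-]; exact: mV.
elim: r s A => [|k r IH] s A /=.
  move=> us _ As; rewrite big_nil mul1r.
  have mAs : measurable (\bigcap_(k in [set` s]) A k).
    by apply: fin_bigcap_measurable => // k /= ks; exact: mA (As k ks).
  rewrite (@cexp_ext _ _ _ _ _ (fun w => (\1_(\bigcap_(k in [set` s]) A k) w)%:C)).
    rewrite cexp_indic// (indep s A us As) -rmorph_prod; congr (_%:C).
    elim: s {us mAs} As => [|k s IHs] As; first by rewrite !big_nil.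
    rewrite !big_cons fineM; first last.
    - rewrite big_seq; apply: (big_ind (fun x => x \is a fin_num)) => // [x y|j js].
        exact: fin_numM.
      by apply: fin_num_measure; apply: (mA j); apply: As; rewrite in_cons js orbT.
    - by apply: fin_num_measure; apply: (mA k); apply: As; rewrite mem_head.
    by rewrite IHs// => j js; apply: As; rewrite in_cons js orbT.
  move=> w; rewrite big_nil mul1r -rmorph_prod; congr (_%:C).
  elim: s {us mAs As} => [|k s IHs].
    by rewrite big_nil indicE mem_set// => j.
  rewrite big_cons IHs !indicE -natrM mulnb; congr (nat_of_bool _)%:R.
  rewrite -[LHS]in_setI; congr (w \in _).
  apply/seteqP; split => [x [xk xs] j /=|x H].
    by rewrite in_cons => /orP[/eqP ->//|]; exact: xs.
  by split; [apply: H; rewrite /= mem_head|move=> j js; apply: H; rewrite /= in_cons js orbT].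
move=> /andP[kn us] fX As.
pose Y w := \prod_(j <- r) X j w * \prod_(j <- s) (\1_(A j) w)%:C.
have fXr j : j \in r -> function_of j (X j).
  by move=> jr; apply: fX; rewrite in_cons jr orbT.
have bY : bounded_rv Y.
  apply: bounded_rvM; apply: bounded_rv_prod => j js.
    exact: function_of_bounded (fXr j js).
  by apply: bounded_rv_indic; exact: mA (As j js).
rewrite (@cexp_ext _ _ _ _ _ (fun w => X k w * Y w)); last first.
  by move=> w; rewrite big_cons mulrA.
have fXk : function_of k (X k) by apply: fX; rewrite mem_head.
rewrite (cexp_mul_indep fXk bY); first by rewrite big_cons (IH s A us fXr As) mulrA.
move=> B mB; rewrite (IH s A us fXr As).
pose A' j := if j == k then V k @^-1` B else A j.
have ks : k \notin s by apply: contra kn; rewrite mem_cat => ->; rewrite orbT.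
have As' j : j \in k :: s -> preimage_set_system setT (V j) measurable (A' j).
  rewrite in_cons /A'; case: eqVneq => [->_|_ /= js]; last exact: As.
  by exists B => //; rewrite setTI.
have us' : uniq (r ++ k :: s).
  move: us; rewrite !cat_uniq /= negb_or ks => /and3P[-> -> ->].
  by rewrite !andbT; apply: contra kn; rewrite mem_cat => ->.
have sA' (g : set Om -> R[i]) : \prod_(j <- s) g (A' j) = \prod_(j <- s) g (A j).
  rewrite !big_seq; apply: eq_bigr => j js; rewrite /A'; case: eqVneq => // jk.
  by exfalso; move/negP: ks; apply; rewrite -jk.
have A'k : A' k = V k @^-1` B by rewrite /A' eqxx.
have := IH (k :: s) A' us' fXr As'; rewrite big_cons A'k.
rewrite (sA' (fun C => (fine (Pr C))%:C)) mulrCA => <-.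
apply: cexp_ext => w; rewrite /Y big_cons A'k.
by rewrite (sA' (fun C => (\1_C w)%:C)) mulrCA.
Qed.

Lemma cexp_prod (r : seq I) (X : I -> Om -> R[i]) :
  uniq r -> (forall k, k \in r -> function_of k (X k)) ->
  E (fun w => \prod_(k <- r) X k w) = \prod_(k <- r) E (X k).
Proof.
move=> ur fX; have := @cexp_prod_indic r [::] X (fun=> setT).
rewrite cats0 big_nil mulr1 => <- //.
by apply: cexp_ext => w; rewrite big_nil mulr1.
Qed.

End independent_family.

(** * Moments of the observations *)

Section noisy_model.
Local Open Scope complex_scope.
Local Open Scope ring_scope.
Context {R : realType} {d : measure_display} {Om : measurableType d}.
Variables (mu : probability 'M[R]_3 R) (fe : 'M[R]_3 -> R).
Variables (Pr : probability Om R) (eps : nat -> Om -> 'M[R]_3) (X : nat -> Om -> 'cV[R]_3).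
Variable f : 'cV[R]_3 -> R.
Hypothesis dfe : probability_density mu SO3 fe.
Hypothesis df : probability_density (@surface R) sphere f.
Hypothesis heps : forall i, measurable_fun setT (eps i) /\ forall w, SO3 (eps i w).
Hypothesis hX : forall i, measurable_fun setT (X i) /\ forall w, sphere (X i w).
Hypothesis deps : forall i, has_density Pr (eps i) mu SO3 fe.
Hypothesis dX : forall i, has_density Pr (X i) (@surface R) sphere f.
Hypothesis indep : mutually_independent Pr (fun k : nat + nat =>
  match k with
  | inl i => preimage_set_system setT (eps i) measurable
  | inr i => preimage_set_system setT (X i) measurable
  end).
Local Notation E := (cexp Pr).

(** Rotations and directions form one independent family indexed by a disjoint union, the value type
    depending on the index. *)
Let T (k : nat + nat) : measurableType (mx_display default_measure_display) :=
  if k is inl _ then 'M[R]_(3, 3) else 'M[R]_(3, 1).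
Unset Implicit Arguments.
Let V (k : nat + nat) : Om -> T k :=
  match k with inl i => eps i | inr i => X i end.
Let m (k : nat + nat) : {measure set (T k) -> \bar R} :=
  match k with inl i => mu | inr i => @surface R end.
Let S (k : nat + nat) : set (T k) :=
  match k with inl i => @SO3 R | inr i => @sphere R end.
Let h (k : nat + nat) : T k -> R :=
  match k with inl i => fe | inr i => f end.

Set Implicit Arguments.

Lemma density_integrable d' (T' : measurableType d') (m' : {measure set T' -> \bar R})
    (S' : set T') (g : T' -> R) : probability_density m' S' g ->
  m'.-integrable S' (EFin \o g).
Proof.
move=> [mg g0 g1]; apply/integrableP; split; first exact/measurable_EFinP.
rewrite (_ : (\int[m']_(x in S') _)%E = 1%E) ?ltry// -g1; apply: eq_integral => x /set_mem Sx.
by rewrite /= ger0_norm ?g0.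
Qed.

Definition eps_function i (Z : Om -> R[i]) := exists (phi : 'M[R]_3 -> R[i]) (K : R),
  [/\ cmeasurable SO3 phi, (forall y, SO3 y -> normc (phi y) <= K) &
      forall w, Z w = phi (eps i w)].

Definition X_function i (Z : Om -> R[i]) := exists (phi : 'cV[R]_3 -> R[i]) (K : R),
  [/\ cmeasurable sphere phi, (forall y, sphere y -> normc (phi y) <= K) &
      forall w, Z w = phi (X i w)].

Let mS k : measurable (S k).
Proof. by case: k => i; [exact: measurable_SO3|exact: measurable_sphere]. Qed.
Let mV k : measurable_fun setT (V k).
Proof. by case: k => i; [case: (heps i)|case: (hX i)]. Qed.
Let VS k w : S k (V k w).
Proof. by case: k => i; [case: (heps i) => _; exact|case: (hX i) => _; exact]. Qed.
Let h0 k x : S k x -> 0 <= h k x.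
Proof. by case: k x => i x; [case: dfe => _ + _; exact|case: df => _ + _; exact]. Qed.
Let jh k : (m k).-integrable (S k) (EFin \o h k).
Proof. by case: k => i; exact: density_integrable. Qed.
Let dens k : has_density Pr (V k) (m k) (S k) (h k).
Proof. by case: k => i; [exact: deps|exact: dX]. Qed.
Let indV : mutually_independent Pr (fun k => preimage_set_system setT (V k) measurable).
Proof.
move=> r A ur Ar; apply: indep => // k kr; have := Ar k kr.
by case: k {kr}.
Qed.

Let fun_of k (Z : Om -> R[i]) := function_of V S k Z.

Let fun_of_eps i Z : eps_function i Z -> fun_of (inl i) Z.
Proof. by []. Qed.

Let fun_of_X i Z : X_function i Z -> fun_of (inr i) Z.
Proof. by []. Qed.

Let prod_rv (r : seq (nat + nat)) (Z : nat + nat -> Om -> R[i]) : uniq r ->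
  (forall k, k \in r -> fun_of k (Z k)) ->
  E (fun w => \prod_(k <- r) Z k w) = \prod_(k <- r) E (Z k).
Proof. exact: (cexp_prod mS mV VS h0 jh dens indV). Qed.

Lemma eps_function_bounded i Z : eps_function i Z -> bounded_rv Z.
Proof. by move=> fZ; exact: (function_of_bounded mS mV VS (fun_of_eps fZ)). Qed.

Lemma X_function_bounded i Z : X_function i Z -> bounded_rv Z.
Proof. by move=> fZ; exact: (function_of_bounded mS mV VS (fun_of_X fZ)). Qed.

Lemma cexp_eps i (phi : 'M[R]_3 -> R[i]) K : cmeasurable SO3 phi ->
  (forall y, SO3 y -> normc (phi y) <= K) ->
  E (fun w => phi (eps i w)) = cintegral mu SO3 (fun y => phi y * (fe y)%:C).
Proof. exact: (@cexp_density _ _ _ _ _ _ T V m S h mS mV VS h0 jh dens (inl i)). Qed.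

Lemma cexp_X i (phi : 'cV[R]_3 -> R[i]) K : cmeasurable sphere phi ->
  (forall y, sphere y -> normc (phi y) <= K) ->
  E (fun w => phi (X i w)) = cintegral (@surface R) sphere (fun y => phi y * (f y)%:C).
Proof. exact: (@cexp_density _ _ _ _ _ _ T V m S h mS mV VS h0 jh dens (inr i)). Qed.

(** Harmonic polynomials of the i-th observation have this form by [rotational_harmonics], and the
    form is stable under sums, products and conjugation. It takes the place of measurability with
    respect to the i-th observation. *)
Definition local_rv i (U : Om -> R[i]) := exists (J : finType) (a b : J -> Om -> R[i]),
  [/\ (forall j, eps_function i (a j)), (forall j, X_function i (b j)) &
      forall w, U w = \sum_j a j w * b j w].

Lemma local_rv_bounded i U : local_rv i U -> bounded_rv U.
Proof.
move=> [J [a [b [fa fb UE]]]].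
rewrite (_ : U = fun w => \sum_j a j w * b j w); last exact/funext.
apply: bounded_rv_sum => j; apply: bounded_rvM.
  exact: eps_function_bounded (fa j).
exact: X_function_bounded (fb j).
Qed.

Lemma eq_local_rv i U U' : (forall w, U w = U' w) -> local_rv i U -> local_rv i U'.
Proof. by move=> /funext ->. Qed.

Lemma local_rv_eps i Z : eps_function i Z -> local_rv i Z.
Proof.
move=> fZ; exists unit, (fun _ => Z), (fun _ _ => 1); split => //.
  move=> _; exists (fun=> 1), 1; split => [|y _|//]; first exact: cmeasurable_cst.
  by rewrite normc1.
by move=> w; rewrite (big_pred1 tt) ?mulr1// => -[].
Qed.

Lemma local_rv_cst i c : local_rv i (fun=> c).
Proof.
apply: local_rv_eps; exists (fun=> c), (normc c).
by split => //; exact: cmeasurable_cst.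
Qed.

Lemma local_rvD i U U' : local_rv i U -> local_rv i U' -> local_rv i (fun w => U w + U' w).
Proof.
move=> [J [a [b [fa fb UE]]]] [J' [a' [b' [fa' fb' UE']]]].
exists (J + J')%type, (fun j => match j with inl j => a j | inr j => a' j end),
  (fun j => match j with inl j => b j | inr j => b' j end); split.
- by case.
- by case.
- by move=> w; rewrite UE UE' big_sumType.
Qed.

Lemma local_rvM i U U' : local_rv i U -> local_rv i U' -> local_rv i (fun w => U w * U' w).
Proof.
move=> [J [a [b [fa fb UE]]]] [J' [a' [b' [fa' fb' UE']]]].
exists (J * J')%type, (fun j w => a j.1 w * a' j.2 w), (fun j w => b j.1 w * b' j.2 w); split.
- move=> [j j']; have [p [K [mp pK pE]]] := fa j; have [p' [K' [mp' pK' pE']]] := fa' j'.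
  exists (fun y => p y * p' y), (K * K'); split; first exact: cmeasurableM.
    by move=> y Sy; rewrite normcM ler_pM ?normc_ge0 ?pK ?pK'.
  by move=> w; rewrite /= pE pE'.
- move=> [j j']; have [p [K [mp pK pE]]] := fb j; have [p' [K' [mp' pK' pE']]] := fb' j'.
  exists (fun y => p y * p' y), (K * K'); split; first exact: cmeasurableM.
    by move=> y Sy; rewrite normcM ler_pM ?normc_ge0 ?pK ?pK'.
  by move=> w; rewrite /= pE pE'.
- move=> w; rewrite UE UE' big_distrlr /= pair_big /=.
  by apply: eq_bigr => -[j j'] _ /=; ring.
Qed.

Lemma local_rv_conj i U : local_rv i U -> local_rv i (fun w => (U w)^*).
Proof.
move=> [J [a [b [fa fb UE]]]].
exists J, (fun j w => (a j w)^*), (fun j w => (b j w)^*); split.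
- move=> j; have [p [K [mp pK pE]]] := fa j.
  exists (fun y => (p y)^*), K; split; first exact: cmeasurable_conj.
    by move=> y Sy; rewrite normc_conj pK.
  by move=> w; rewrite pE.
- move=> j; have [p [K [mp pK pE]]] := fb j.
  exists (fun y => (p y)^*), K; split; first exact: cmeasurable_conj.
    by move=> y Sy; rewrite normc_conj pK.
  by move=> w; rewrite pE.
- by move=> w; rewrite UE rmorph_sum; apply: eq_bigr => j _; rewrite rmorphM.
Qed.

Lemma local_rv_sum i (I : Type) (r : seq I) (F : I -> Om -> R[i]) :
  (forall k, local_rv i (F k)) -> local_rv i (fun w => \sum_(k <- r) F k w).
Proof.
move=> lF; elim: r => [|k r IH].
  by apply: eq_local_rv (local_rv_cst i 0) => w; rewrite big_nil.
by apply: eq_local_rv (local_rvD (lF k) IH) => w; rewrite big_cons.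
Qed.

Lemma cexp_eps_X i a b : eps_function i a -> X_function i b ->
  E (fun w => a w * b w) = E a * E b.
Proof.
move=> fa fb; pose Z (k : nat + nat) := if k is inl _ then a else b.
have := @prod_rv [:: inl i; inr i] Z isT; rewrite !big_cons !big_nil /= mulr1 => <-.
  by apply: cexp_ext => w; rewrite !big_cons big_nil mulr1.
by move=> k; rewrite !inE => /orP[|] /eqP ->; [exact: fun_of_eps|exact: fun_of_X].
Qed.

(** Induction on [r]: expanding one local variable by linearity replaces it by a pair of elementary
    factors, which joins the list [s]. For empty [r] only independent factors remain. *)
Lemma cexp_local_prod_elementary (r : seq nat) (s : seq (nat + nat)) (U : nat -> Om -> R[i])
    (Z : nat + nat -> Om -> R[i]) : uniq r -> uniq s ->
  (forall i, i \in r -> local_rv i (U i) /\ inl i \notin s /\ inr i \notin s) ->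
  (forall k, k \in s -> fun_of k (Z k)) ->
  E (fun w => \prod_(i <- r) U i w * \prod_(k <- s) Z k w) =
  \prod_(i <- r) E (U i) * \prod_(k <- s) E (Z k).
Proof.
elim: r s Z => [|i r IH] s Z /=.
  move=> _ us _ fZ; rewrite big_nil mul1r -(prod_rv us fZ).
  by apply: cexp_ext => w; rewrite big_nil mul1r.
move=> /andP[ir ur] us HU fZ.
have [[J [a [b [fa fb UE]]]] [ls rs]] := HU i (mem_head _ _).
pose Z' j (k : nat + nat) := if k == inl i then a j else if k == inr i then b j else Z k.
have Z's (g : (Om -> R[i]) -> R[i]) j : \prod_(k <- s) g (Z' j k) = \prod_(k <- s) g (Z k).
  rewrite !big_seq; apply: eq_bigr => k ks; rewrite /Z'.
  case: eqVneq => [kl|_]; first by exfalso; move/negP: ls; apply; rewrite -kl.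
  by case: eqVneq => // kl; exfalso; move/negP: rs; apply; rewrite -kl.
have IHj j := IH (inl i :: inr i :: s) (Z' j) ur.
have Zl j : Z' j (inl i) = a j by rewrite /Z' eqxx.
have Zr j : Z' j (inr i) = b j by rewrite /Z' /= eqxx.
have fZ' j k : k \in inl i :: inr i :: s -> fun_of k (Z' j k).
  rewrite !in_cons /Z'; case: eqVneq => [->_|_]; first exact: fun_of_eps.
  case: eqVneq => [->_|_ /=]; first exact: fun_of_X.
  exact: fZ.
have us' : uniq (inl i :: inr i :: s) by rewrite /= in_cons negb_or ls rs us.
have HU' i' : i' \in r -> local_rv i' (U i') /\
    inl i' \notin inl i :: inr i :: s /\ inr i' \notin inl i :: inr i :: s.
  move=> i'r; have [lU [l r']] := HU i' (mem_behead (s := i :: r) i'r).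
  have ne : i' != i by apply: contra ir => /eqP <-.
  by split=> //; rewrite !in_cons !negb_or l r' !andbT; split; apply/eqP => -[] /eqP; apply/negP.
have brs j : bounded_rv (fun w => \prod_(i <- r) U i w *
    \prod_(k <- inl i :: inr i :: s) Z' j k w).
  apply: bounded_rvM; apply: bounded_rv_prod => k kr.
    by apply: (@local_rv_bounded k); case: (HU' k kr).
  exact: (function_of_bounded mS mV VS (fZ' j k kr)).
rewrite (@cexp_ext _ _ _ _ _ (fun w => \sum_j \prod_(i <- r) U i w *
    \prod_(k <- inl i :: inr i :: s) Z' j k w)); last first.
  move=> w; rewrite big_cons UE !mulr_suml; apply: eq_bigr => j _.
  by rewrite !big_cons Zl Zr (Z's (fun z => z w)); ring.
rewrite cexp_sum// big_cons.
rewrite (@cexp_ext _ _ _ _ (U i) (fun w => \sum_j a j w * b j w))// cexp_sum; last first.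
  by move=> j; apply: bounded_rvM; [exact: eps_function_bounded|exact: X_function_bounded].
rewrite !mulr_suml; apply: eq_bigr => j _; rewrite (IHj j us' HU' (fZ' j)).
by rewrite !big_cons Zl Zr (Z's E) (cexp_eps_X (fa j) (fb j)); ring.
Qed.

Lemma cexp_local_prod (r : seq nat) (U : nat -> Om -> R[i]) : uniq r ->
  (forall i, i \in r -> local_rv i (U i)) ->
  E (fun w => \prod_(i <- r) U i w) = \prod_(i <- r) E (U i).
Proof.
move=> ur lU; pose Z0 (k : nat + nat) (w : Om) : R[i] := 0.
pose s0 : seq (nat + nat) := [::].
have lU' i : i \in r -> local_rv i (U i) /\ inl i \notin s0 /\ inr i \notin s0.
  by move=> /lU.
have fZ k : k \in s0 -> fun_of k (Z0 k) by [].
have := cexp_local_prod_elementary ur (isT : uniq s0) lU' fZ.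
rewrite [\prod_(k <- s0) E (Z0 k)]big_nil mulr1 => <-.
by apply: cexp_ext => w; rewrite big_nil mulr1.
Qed.

Variable D : forall l : nat, 'M[R]_3 -> 'M[R[i]]_l.*2.+1.
Hypothesis hD : rotational_harmonics D.
Local Notation Z i w := (eps i w *m X i w).

Lemma D_eps_function i l n j : eps_function i (fun w => D l (eps i w) n j).
Proof.
have [De [K [mDe DE bDe]]] := rotation_coefficients l hD.
have [_ Seps] := heps i.
exists (fun g => De g n j), K; split.
- by split; apply: measurable_funTS; case: (mDe n j).
- by move=> g Sg; exact: bDe.
- by move=> w; rewrite DE.
Qed.

Lemma Yconj_X_function i l (j : 'I_l.*2.+1) : X_function i (fun w => (Y j (X i w))^*).
Proof.
exists (fun x => (Y j x)^*), (Num.sqrt (l.*2.+1%:R / (4 * pi))); split => //.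
  by apply: cmeasurable_conj; exact: cmeasurable_Y.
by move=> y sy; rewrite normc_conj normc_Y_le.
Qed.

Lemma Yconj_observation i l (n : 'I_l.*2.+1) w :
  (Y n (Z i w))^* = \sum_j D l (eps i w) n j * (Y j (X i w))^*.
Proof. by apply: hD; [case: (heps i) => _; exact|case: (hX i) => _; exact]. Qed.

Lemma local_rv_Yconj i l (n : 'I_l.*2.+1) : local_rv i (fun w => (Y n (Z i w))^*).
Proof.
exists ('I_l.*2.+1), (fun j w => D l (eps i w) n j), (fun j w => (Y j (X i w))^*); split.
- by move=> j; exact: D_eps_function.
- by move=> j; exact: Yconj_X_function.
- by move=> w; exact: Yconj_observation.
Qed.

(** The Fourier coefficient of the density of the observations, written directly as the product of
    the two transforms. *)
Definition obs_fourier l (n : 'I_l.*2.+1) : R[i] :=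
  \sum_j rot_fourier mu D fe l n j * sphere_fourier (fun x => (f x)%:C) j.

Lemma cexp_Yconj i l (n : 'I_l.*2.+1) : E (fun w => (Y n (Z i w))^*) = obs_fourier n.
Proof.
rewrite (@cexp_ext _ _ _ _ _ (fun w => \sum_j D l (eps i w) n j * (Y j (X i w))^*)); last first.
  by move=> w; exact: Yconj_observation.
rewrite cexp_sum; last first.
  move=> j; apply: bounded_rvM; first exact: eps_function_bounded (D_eps_function i n j).
  exact: X_function_bounded (Yconj_X_function i j).
apply: eq_bigr => j _.
rewrite (cexp_eps_X (D_eps_function i n j) (Yconj_X_function i j)); congr (_ * _).
  have [De [K [mDe DE bDe]]] := rotation_coefficients l hD.
  rewrite (@cexp_ext _ _ _ _ _ (fun w => De (eps i w) n j)); last first.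
    by move=> w; rewrite DE//; case: (heps i) => _; exact.
  rewrite (@cexp_eps i (fun g => De g n j) K).
  - by rewrite mxE; apply: eq_cintegral => g Sg; rewrite DE// mulrC.
  - by split; apply: measurable_funTS; case: (mDe n j).
  - by move=> g Sg; exact: bDe.
rewrite (@cexp_X i (fun x => (Y j x)^*) (Num.sqrt (l.*2.+1%:R / (4 * pi)))).
- by apply: eq_cintegral => x _; rewrite mulrC.
- by apply: cmeasurable_conj; exact: cmeasurable_Y.
- by move=> y sy; rewrite normc_conj normc_Y_le.
Qed.

Lemma local_rv_span i g : harmonic_span g -> local_rv i (fun w => g (Z i w)).
Proof.
move=> [c [M0 H]]; have SZ w : sphere (Z i w).
  by apply: sphere_SO3; [case: (heps i) => _; exact|case: (hX i) => _; exact].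
apply: (@eq_local_rv _ (fun w => \sum_(l < M0) \sum_(n < l.*2.+1) c l n * ((Y n (Z i w))^*)^*)).
  move=> w; rewrite (H M0)//; apply: eq_bigr => l _; apply: eq_bigr => n _.
  by rewrite conjCK.
do 2! (apply: local_rv_sum => ?); apply: local_rvM; first exact: local_rv_cst.
by apply: local_rv_conj; exact: local_rv_Yconj.
Qed.

(* Truncating the Fourier series of the density of [Z] at a level beyond the degree
   of [|g|^2] does not change the second moment, so a bound on the truncated series
   is enough and no density of [Z] is needed. *)
Lemma second_moment_span_le (B : R) : (forall M, \sum_(l < M)
    Num.sqrt (\sum_(n < l.*2.+1) normc (obs_fourier n) ^+ 2) *
    Num.sqrt (l.*2.+1%:R / (4 * pi)) <= B) ->
  forall i g, harmonic_span g ->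
  complex.Re (E (fun w => (normc (g (Z i w)) ^+ 2)%:C)) <=
  B * \int[@surface R]_(x in sphere) (normc (g x) ^+ 2).
Proof.
move=> HB i g sg.
have mSph := @measurable_sphere R.
have SZ w : sphere (Z i w).
  by apply: sphere_SO3; [case: (heps i) => _; exact|case: (hX i) => _; exact].
have [c [M H]] := harmonic_spanM sg (harmonic_span_conj sg).
have {}H x : sphere x -> (normc (g x) ^+ 2)%:C =
    \sum_(l < M) \sum_(n < l.*2.+1) (c l n)^* * (Y n x)^*.
  move=> sx; rewrite -conj_real -mulc_conj (H M)// rmorph_sum; apply: eq_bigr => l _.
  by rewrite rmorph_sum; apply: eq_bigr => n _; rewrite rmorphM.
pose p x := \sum_(l < M) \sum_(n < l.*2.+1) obs_fourier n * Y n x.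
have sp : harmonic_span p.
  by do 2! (apply: harmonic_span_sum => ?); apply: harmonic_spanZ; exact: harmonic_span_Y.
have sh : harmonic_span (fun x => (normc (g x) ^+ 2)%:C).
  apply: eq_harmonic_span (harmonic_spanM sg (harmonic_span_conj sg)) => x _.
  by rewrite mulc_conj.
have EE : E (fun w => (normc (g (Z i w)) ^+ 2)%:C) =
    \sum_(a : harmonic_index M) (c (tag a) (tagged a))^* * obs_fourier (tagged a).
  rewrite (@cexp_ext _ _ _ _ _ (fun w => \sum_(a : harmonic_index M)
    (c (tag a) (tagged a))^* * (Y (tagged a) (Z i w))^*)); last first.
    by move=> w; rewrite H// (sum_harmonic_index M (fun l n => (c l n)^* * (Y n (Z i w))^*)).
  have bY (a : harmonic_index M) : bounded_rv (fun w => (Y (tagged a) (Z i w))^*).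
    exact: local_rv_bounded (local_rv_Yconj i (tagged a)).
  rewrite cexp_sum; last by move=> a; exact: bounded_rvZ (bY a).
  by apply: eq_bigr => a _; rewrite cexpZ// cexp_Yconj.
have EI : cintegral (@surface R) sphere (fun x => (normc (g x) ^+ 2)%:C * p x) =
    \sum_(a : harmonic_index M) (c (tag a) (tagged a))^* * obs_fourier (tagged a).
  rewrite (@eq_cintegral _ _ _ _ _ _ (fun x => \sum_(a : harmonic_index M)
    obs_fourier (tagged a) * \sum_(b : harmonic_index M) (c (tag b) (tagged b))^* *
      (Y (tagged a) x * (Y (tagged b) x)^*))); last first.
    move=> x sx; rewrite H// (sum_harmonic_index M (fun l n => (c l n)^* * (Y n x)^*)).
    rewrite /p (sum_harmonic_index M (fun l n => obs_fourier n * Y n x)) mulrC mulr_suml.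
    apply: eq_bigr => a _; rewrite -mulrA; congr (_ * _); rewrite mulr_sumr.
    by apply: eq_bigr => b _; ring.
  have iYY (a b : harmonic_index M) : cintegrable (@surface R) sphere
      (fun x => Y (tagged a) x * (Y (tagged b) x)^*).
    apply: cintegrable_harmonic_span; apply: harmonic_spanM; first exact: harmonic_span_Y.
    exact: harmonic_span_Yconj.
  have iS (a : harmonic_index M) : cintegrable (@surface R) sphere
      (fun x => \sum_(b : harmonic_index M) (c (tag b) (tagged b))^* *
        (Y (tagged a) x * (Y (tagged b) x)^*)).
    by apply: cintegrable_sum => // b; exact: cintegrableZ.
  rewrite cintegral_sum//; last by move=> a; exact: cintegrableZ.
  apply: eq_bigr => a _; rewrite cintegralZ// cintegral_sum//; last first.
    by move=> b; exact: cintegrableZ.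
  rewrite (bigD1 a)//= big1 ?addr0 => [|b ba].
    by rewrite cintegralZ// harmonic_index_orthonormal eqxx mulr1 mulrC.
  by rewrite cintegralZ// harmonic_index_orthonormal eq_sym (negPf ba) mulr0.
(* Cauchy-Schwarz at each degree, with [sum_normc_Y] for the harmonics. *)
have Bp x : sphere x -> complex.Re (p x) <= B.
  move=> sx; apply: le_trans (ler_norm _) _; apply: le_trans (le_Re_normc _) _.
  apply: le_trans (le_normc_sum _ _ _) _; apply: le_trans (HB M).
  apply: ler_sum => l _; rewrite -(sum_normc_Y l sx) -sqrtrM; last first.
    by apply: sumr_ge0 => n _; exact: sqr_ge0.
  rewrite -[leLHS]ger0_norm ?normc_ge0// -sqrtr_sqr ler_wsqrtr//.
  exact: cauchy_schwarz_normc.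
rewrite EE -EI /cintegral /=.
have [ig _] := cintegrable_harmonic_span sh.
have [ip _] := cintegrable_harmonic_span (harmonic_spanM sh sp).
rewrite -RintegralZl//; apply: le_Rintegral => //.
  by apply: eq_integrable (integrableZl mSph B ig).
move=> x sx; rewrite ReM /= mul0r subr0 mulrC ler_wpM2r ?sqr_ge0//.
exact: Bp.
Qed.

End noisy_model.

(** * Variance of the U-statistic *)

Section second_moment.
Local Open Scope complex_scope.
Local Open Scope ring_scope.
Context {R : realType} {d : measure_display} {Om : measurableType d}.
Variable Pr : probability Om R.
Local Notation E := (cexp Pr).

Definition moment2 (X : Om -> R[i]) : R := \int[Pr]_w (normc (X w) ^+ 2).

Lemma moment2_ge0 X : 0 <= moment2 X.
Proof. by apply: Rintegral_ge0 => w _; exact: sqr_ge0. Qed.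

Lemma integrable_normc_sqr X : bounded_rv X ->
  Pr.-integrable setT (EFin \o (fun w => normc (X w) ^+ 2)).
Proof.
move=> bX; have [h _] := bounded_rv_cintegrable Pr (bounded_rvM bX (bounded_rv_conj bX)).
by apply: eq_integrable h => // w _ /=; rewrite mulc_conj.
Qed.

Lemma moment2E X : (moment2 X)%:C = E (fun w => X w * (X w)^*).
Proof.
by rewrite -cintegral_real; apply: eq_cintegral => w _; rewrite mulc_conj.
Qed.

Lemma moment2D X Y : bounded_rv X -> bounded_rv Y ->
  moment2 (fun w => X w + Y w) <= 2 * moment2 X + 2 * moment2 Y.
Proof.
move=> bX bY; have iX := integrable_normc_sqr bX; have iY := integrable_normc_sqr bY.
have zX := integrableZl measurableT 2 iX; have zY := integrableZl measurableT 2 iY.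
rewrite /moment2 -!RintegralZl// -RintegralD//.
apply: le_Rintegral => //.
- exact: integrable_normc_sqr (bounded_rvD bX bY).
- by apply: eq_integrable (integrableD measurableT zX zY).
- by move=> w _; exact: normc_sqrD.
Qed.

Lemma moment2Z c X : bounded_rv X ->
  moment2 (fun w => c * X w) = normc c ^+ 2 * moment2 X.
Proof.
move=> bX; rewrite /moment2 -RintegralZl//; last exact: integrable_normc_sqr.
by apply: eq_Rintegral => w _; rewrite normcM exprMn.
Qed.

Lemma moment2_conj X : moment2 (fun w => (X w)^*) = moment2 X.
Proof. by apply: eq_Rintegral => w _; rewrite normc_conj. Qed.

Lemma moment2_orthogonal (P : finType) (x : P -> Om -> R[i]) (k : P -> R[i]) :
  (forall p, bounded_rv (x p)) ->
  (forall p q, E (fun w => x p w * (x q w)^*) = if p == q then k p else 0) ->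
  (moment2 (fun w => \sum_p x p w))%:C = \sum_p k p.
Proof.
move=> bx Ex; rewrite moment2E.
have bxq p q : bounded_rv (fun w => x p w * (x q w)^*).
  by apply: bounded_rvM => //; exact: bounded_rv_conj.
rewrite (@cexp_ext _ _ _ _ _ (fun w => \sum_p \sum_q x p w * (x q w)^*)); last first.
  by move=> w; rewrite rmorph_sum mulr_suml; apply: eq_bigr => p _; rewrite mulr_sumr.
rewrite cexp_sum; last by move=> p; exact: bounded_rv_sum.
apply: eq_bigr => p _; rewrite cexp_sum// (bigD1 p)//= Ex eqxx big1 ?addr0// => q qp.
by rewrite Ex eq_sym (negPf qp).
Qed.

Lemma chebyshev_normc X (A : set Om) (c : R) : bounded_rv X -> measurable A -> 0 < c ->
  (forall w, A w -> c <= normc (X w)) -> fine (Pr A) <= moment2 X / c ^+ 2.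
Proof.
move=> bX mA c0 HA; rewrite ler_pdivlMr ?exprn_gt0//.
have := cexp_indic Pr mA; rewrite /cexp cintegral_real => /complexI <-.
have iA : Pr.-integrable setT (EFin \o (\1_A : Om -> R)).
  by have [] := bounded_rv_cintegrable Pr (bounded_rv_indic mA).
rewrite mulrC -RintegralZl//; apply: le_Rintegral => //.
- by apply: eq_integrable (integrableZl measurableT (c ^+ 2) iA).
- exact: integrable_normc_sqr.
- move=> w _; rewrite indicE; case: (boolP (w \in A)) => [/set_mem Aw|_].
    by rewrite mulr1 ler_pXn2r ?nnegrE ?normc_ge0 ?(ltW c0)//; exact: HA.
  by rewrite mulr0 sqr_ge0.
Qed.

End second_moment.

(** * Hoeffding decomposition of the U-statistic *)

Section ustatistic.
Local Open Scope complex_scope.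
Local Open Scope ring_scope.
Context {R : realType} {d : measure_display} {Om : measurableType d}.
Variable Pr : probability Om R.
Local Notation E := (cexp Pr).
(* [loc i U] stands for: [U] is a function of the [i]-th of a family of independent
   variables. *)
Variable loc : nat -> (Om -> R[i]) -> Prop.
Hypothesis loc_bounded : forall i U, loc i U -> bounded_rv U.
Hypothesis loc_cst : forall i c, loc i (fun=> c).
Hypothesis locM : forall i U U', loc i U -> loc i U' -> loc i (fun w => U w * U' w).
Hypothesis loc_conj : forall i U, loc i U -> loc i (fun w => (U w)^*).
Hypothesis loc_prod : forall (r : seq nat) (U : nat -> Om -> R[i]), uniq r ->
  (forall i, i \in r -> loc i (U i)) ->
  E (fun w => \prod_(i <- r) U i w) = \prod_(i <- r) E (U i).

(** [W i] is the centred i-th vector, [G] the covariance matrix common to all [i], and [mu] the mean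
    that [ustat] adds back. *)
Variables (I : finType) (W : nat -> I -> Om -> R[i]) (G : I -> I -> R[i]) (mu : I -> R[i]).
Hypothesis locW : forall i a, loc i (W i a).
Hypothesis EW : forall i a, E (W i a) = 0.
Hypothesis EG : forall i a b, E (fun w => W i a w * (W i b w)^*) = G a b.

Lemma boundedW i a : bounded_rv (W i a).
Proof. exact: loc_bounded (locW i a). Qed.

Lemma prod_if_eq (r : seq nat) i (x : R[i]) : uniq r -> i \in r ->
  \prod_(n <- r) (if n == i then x else 1) = x.
Proof.
move=> ur ir; rewrite (bigD1_seq i)//= eqxx big1 ?mulr1// => n /negPf ni.
by rewrite ni.
Qed.

Lemma cexp_two i j U U' : i != j -> loc i U -> loc j U' ->
  E (fun w => U w * U' w) = E U * E U'.
Proof.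
move=> ij lU lU'; pose F n := if n == i then U else U'.
have Fj : F j = U' by rewrite /F eq_sym (negPf ij).
have Fi : F i = U by rewrite /F eqxx.
have ur : uniq [:: i; j] by rewrite /= inE ij.
have lF n : n \in [:: i; j] -> loc n (F n).
  by rewrite !inE => /orP[|] /eqP ->; rewrite ?Fi ?Fj.
have := loc_prod ur lF; rewrite !big_cons big_nil mulr1 Fi Fj => <-.
by apply: cexp_ext => w; rewrite !big_cons big_nil mulr1 Fi Fj.
Qed.

Lemma cexp_cross i j a b : E (fun w => W i a w * (W j b w)^*) = if i == j then G a b else 0.
Proof.
case: eqVneq => [->|ij]; first exact: EG.
by rewrite (cexp_two ij (locW i a) (loc_conj (locW j b))) EW mul0r.
Qed.

(** When the two ordered pairs differ, some index fills only one of the four positions, and its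
    centred factor has mean zero. *)
Lemma cexp_pair i j i' j' a b : (i < j)%N -> (i' < j')%N ->
  E (fun w => (W i a w * (W j a w)^*) * (W i' b w * (W j' b w)^*)^*) =
  if (i == i') && (j == j') then G a b * (G a b)^* else 0.
Proof.
move=> ij ij'.
case: ifPn => [/andP[/eqP <- /eqP <-]|ne].
  rewrite (@cexp_ext _ _ _ _ _ (fun w =>
    (W i a w * (W i b w)^*) * (W j a w * (W j b w)^*)^*)); last first.
    by move=> w; rewrite !rmorphM /= !conjCK; ring.
  have l1 : loc i (fun w => W i a w * (W i b w)^*) by apply: locM => //; exact: loc_conj.
  have l2 : loc j (fun w => W j a w * (W j b w)^*) by apply: locM => //; exact: loc_conj.
  have ne : i != j by rewrite ltn_eqF.
  by rewrite (cexp_two ne l1 (loc_conj l2)) cexp_conj ?EG//; exact: loc_bounded l2.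
pose F n w := (if n == i then W i a w else 1) * (if n == j then (W j a w)^* else 1) *
  ((if n == i' then (W i' b w)^* else 1) * (if n == j' then W j' b w else 1)).
pose r := undup [:: i; j; i'; j'].
have ur : uniq r by exact: undup_uniq.
have mr n : (n \in r) = (n \in [:: i; j; i'; j']) by rewrite mem_undup.
have lF n : n \in r -> loc n (F n).
  move=> _; apply: locM; apply: locM.
  - by case: eqVneq => [->|_]; [exact: locW|exact: loc_cst].
  - by case: eqVneq => [->|_]; [apply: loc_conj; exact: locW|exact: loc_cst].
  - by case: eqVneq => [->|_]; [apply: loc_conj; exact: locW|exact: loc_cst].
  - by case: eqVneq => [->|_]; [exact: locW|exact: loc_cst].
rewrite (@cexp_ext _ _ _ _ _ (fun w => \prod_(n <- r) F n w)); last first.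
  move=> w; rewrite /F !big_split /= !prod_if_eq ?mr ?inE ?eqxx ?orbT//.
  by rewrite rmorphM /= conjCK.
rewrite (loc_prod ur lF).
have [n nr n0] : exists2 n, n \in r & E (F n) = 0; last first.
  by rewrite (bigD1_seq n)//= n0 mul0r.
have [iN|] := boolP ((i != i') && (i != j')).
  have /andP[ii' ij0] := iN; exists i; first by rewrite mr inE eqxx.
  rewrite (@cexp_ext _ _ _ _ _ (W i a)) ?EW// => w.
  by rewrite /F eqxx (ltn_eqF ij) (negPf ii') (negPf ij0) !mulr1.
(* If [i] recurs then [j] does not: for i = i' the case j = j' is excluded, and i = j' puts j above
   both i' and j'. *)
rewrite negb_and !negbK => iE; exists j; first by rewrite mr !inE eqxx orbT.
have ji' : j != i'.
  apply/eqP => ji'; move: iE; rewrite -ji' (ltn_eqF ij) /= => /eqP iE.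
  by move: ij ij'; rewrite iE -ji'; lia.
have jj' : j != j'.
  apply/eqP => jj'; move: ne; rewrite jj' eqxx andbT => ii'.
  by move: iE; rewrite (negPf ii') /= => /eqP iE; move: ij; rewrite iE -jj' ltnn.
rewrite (@cexp_ext _ _ _ _ _ (fun w => (W j a w)^*)); last first.
  by move=> w; rewrite /F eqxx (gtn_eqF ij) (negPf ji') (negPf jj') !mulr1 mul1r.
by rewrite cexp_conj ?EW ?rmorph0//; exact: boundedW.
Qed.

Variables lam tr : R.
Hypothesis lam0 : 0 < lam.
Hypothesis HG : forall v : I -> R[i],
  moment2 Pr (fun w => \sum_a v a * W 0 a w) <= lam * \sum_a normc (v a) ^+ 2.
Hypothesis Htr : \sum_a moment2 Pr (W 0 a) <= tr.

Lemma moment2_lin i (v : I -> R[i]) : (moment2 Pr (fun w => \sum_a v a * W i a w))%:C =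
  \sum_a \sum_b v a * (v b)^* * G a b.
Proof.
rewrite moment2E (@cexp_ext _ _ _ _ _ (fun w => \sum_a \sum_b (v a * (v b)^*) *
  (W i a w * (W i b w)^*))); last first.
  move=> w; rewrite rmorph_sum mulr_suml; apply: eq_bigr => a _.
  by rewrite mulr_sumr; apply: eq_bigr => b _; rewrite rmorphM /=; ring.
have bWW a b : bounded_rv (fun w => W i a w * (W i b w)^*).
  by apply: bounded_rvM; [|apply: bounded_rv_conj]; exact: boundedW.
rewrite cexp_sum; last by move=> a; apply: bounded_rv_sum => b; exact: bounded_rvZ.
apply: eq_bigr => a _; rewrite cexp_sum; last by move=> b; exact: bounded_rvZ.
by apply: eq_bigr => b _; rewrite cexpZ// EG.
Qed.

Lemma moment2_lin_le i (v : I -> R[i]) :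
  moment2 Pr (fun w => \sum_a v a * W i a w) <= lam * \sum_a normc (v a) ^+ 2.
Proof.
apply: le_trans (HG v); rewrite le_eqVlt; apply/orP; left; apply/eqP.
by apply: complexI; rewrite !moment2_lin.
Qed.

(* [G] is positive semidefinite with [G <= lam], so that [G^2 <= lam G]. *)
Lemma sum_normc_G_le : \sum_a \sum_b normc (G a b) ^+ 2 <= lam * tr.
Proof.
rewrite exchange_big /= -subr_ge0; apply: le_trans (_ : 0 <= lam * tr -
  lam * \sum_a moment2 Pr (W 0 a)) _; first by rewrite subr_ge0 ler_wpM2l// ltW.
rewrite lerD2l lerN2 mulr_sumr; apply: ler_sum => b _.
pose q := \sum_a normc (G a b) ^+ 2; rewrite -/q.
(* The combination of the [W 0 a] given by the column [b] of [G]: its second moment is at most lam q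
   and its covariance with [W 0 b] is q, so expanding the second moment of X - lam W_b, which is
   nonnegative, yields q <= lam E|W_b|^2. *)
pose X w := \sum_a (G a b)^* * W 0 a w.
have bX : bounded_rv X.
  by apply: bounded_rv_sum => a; apply: bounded_rvZ; exact: boundedW.
have mX : moment2 Pr X <= lam * q.
  apply: le_trans (moment2_lin_le 0 _) _; rewrite ler_wpM2l ?(ltW lam0)//.
  by apply: ler_sum => a _; rewrite normc_conj.
have EXY : E (fun w => X w * (W 0 b w)^*) = q%:C.
  rewrite (@cexp_ext _ _ _ _ _ (fun w => \sum_a (G a b)^* * (W 0 a w * (W 0 b w)^*))); last first.
    by move=> w; rewrite mulr_suml; apply: eq_bigr => a _; rewrite mulrA.
  have bWW a : bounded_rv (fun w => W 0 a w * (W 0 b w)^*).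
    by apply: bounded_rvM; [|apply: bounded_rv_conj]; exact: boundedW.
  rewrite cexp_sum; last by move=> a; exact: bounded_rvZ.
  rewrite /q rmorph_sum; apply: eq_bigr => a _.
  by rewrite cexpZ// EG mulrC mulc_conj.
have := moment2_ge0 Pr (fun w => X w - lam%:C * W 0 b w).
have bl := bounded_rvZ lam%:C (boundedW 0 b).
have -> : moment2 Pr (fun w => X w - lam%:C * W 0 b w) =
    moment2 Pr X + lam ^+ 2 * moment2 Pr (W 0 b) - 2 * lam * q.
  have iX := integrable_normc_sqr Pr bX; have iY := integrable_normc_sqr Pr bl.
  have bXY := bounded_rvM bX (bounded_rv_conj bl).
  have [iXY _] := bounded_rv_cintegrable Pr bXY.
  have q1 : lam * q = \int[Pr]_w complex.Re (X w * (lam%:C * W 0 b w)^*).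
    have := congr1 (@complex.Re R) EXY; rewrite /cexp /cintegral /= => <-.
    rewrite -RintegralZl//.
      apply: eq_Rintegral => w _; rewrite rmorphM /= conj_real mulrCA [in RHS]ReM /=.
      by rewrite mul0r subr0.
    have [] := bounded_rv_cintegrable Pr (bounded_rvM bX (bounded_rv_conj (boundedW 0 b))).
    by [].
  have -> : lam ^+ 2 * moment2 Pr (W 0 b) = moment2 Pr (fun w => lam%:C * W 0 b w).
    by rewrite moment2Z ?normc_real ?gtr0_norm//; exact: boundedW.
  rewrite -mulrA q1.
  rewrite /moment2 -RintegralZl// -RintegralD//.
  rewrite -RintegralB//.
  - by apply: eq_Rintegral => w _; rewrite normc_sqrB.
  - by apply: eq_integrable (integrableD measurableT iX iY).
  - by apply: eq_integrable (integrableZl measurableT 2 iXY).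
move=> h; have {}h : lam * q <= lam * (lam * moment2 Pr (W 0 b)) by nra.
by rewrite -(ler_pM2l lam0).
Qed.

Local Notation smu := (\sum_a normc (mu a) ^+ 2).

Definition ustat N w : R[i] := 2 / (N%:R * (N%:R - 1)) *
  \sum_(i < N) \sum_(j < N | (i < j)%N) \sum_a (W i a w + mu a) * (W j a w + mu a)^*.

Lemma sum_pairs (F : numFieldType) N (c : F) :
  \sum_(i < N) \sum_(j < N | (i < j)%N) c = N%:R * (N%:R - 1) / 2 * c.
Proof.
rewrite (exchange_big_dep xpredT)//=.
rewrite (eq_bigr (fun j : 'I_N => (nat_of_ord j)%:R * c)) => [|j _]; last first.
  rewrite -(big_ord_widen N (fun _ => c) (ltnW (ltn_ord j))).
  by rewrite sumr_const card_ord mulr_natl.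
elim: N => [|N IH]; first by rewrite big_ord0 !mul0r.
by rewrite big_ord_recr /= IH -natr1; field.
Qed.

(** The two parts of the Hoeffding decomposition: [A] is the linear projection, [h] the degenerate
    kernel. *)
Let A i w := \sum_a (mu a)^* * W i a w.
Let h (p : nat * nat) w := \sum_a W p.1 a w * (W p.2 a w)^*.

Let boundedA i : bounded_rv (A i).
Proof. by apply: bounded_rv_sum => a; apply: bounded_rvZ; exact: boundedW. Qed.

Let boundedh p : bounded_rv (h p).
Proof.
by apply: bounded_rv_sum => a; apply: bounded_rvM; [|apply: bounded_rv_conj]; exact: boundedW.
Qed.

Let cexp_A i j : E (fun w => A i w * (A j w)^*) =
  if i == j then (moment2 Pr (A i))%:C else 0.
Proof.
case: eqVneq => [->|ij]; first by rewrite moment2E.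
rewrite (@cexp_ext _ _ _ _ _ (fun w => \sum_a \sum_b (mu a)^* * mu b *
  (W i a w * (W j b w)^*))); last first.
  move=> w; rewrite rmorph_sum mulr_suml; apply: eq_bigr => a _.
  by rewrite mulr_sumr; apply: eq_bigr => b _; rewrite rmorphM /= conjCK; ring.
have bWW a b : bounded_rv (fun w => W i a w * (W j b w)^*).
  by apply: bounded_rvM; [|apply: bounded_rv_conj]; exact: boundedW.
rewrite cexp_sum; last by move=> a; apply: bounded_rv_sum => b; exact: bounded_rvZ.
rewrite big1// => a _; rewrite cexp_sum; last by move=> b; exact: bounded_rvZ.
by rewrite big1// => b _; rewrite cexpZ// cexp_cross (negPf ij) mulr0.
Qed.

(** The [A i] are orthogonal: N terms with squared coefficients at most N^2. Here [k i] stands for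
    the number of pairs in which [i] holds a given position. *)
Let moment2_linear N (k : 'I_N -> nat) : (forall i, (k i <= N)%N) ->
  moment2 Pr (fun w => \sum_(i < N) (k i)%:R * A i w) <= N%:R ^+ 3 * (lam * smu).
Proof.
move=> kN; have mA i : moment2 Pr (A i) <= lam * smu.
  apply: le_trans (moment2_lin_le i _) _; rewrite ler_wpM2l ?(ltW lam0)//.
  by apply: ler_sum => a _; rewrite normc_conj.
have b (i : 'I_N) : bounded_rv (fun w => (k i)%:R * A i w) by exact: bounded_rvZ.
have := @moment2_orthogonal _ _ _ Pr 'I_N (fun i w => (k i)%:R * A i w)
  (fun i => ((k i)%:R ^+ 2 * moment2 Pr (A i))%:C) b.
rewrite -rmorph_sum => /(_ _)/complexI -> => [|i j]; last first.
  rewrite (@cexp_ext _ _ _ _ _ (fun w => (k i)%:R * (k j)%:R * (A i w * (A j w)^*))); last first.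
    by move=> w; rewrite rmorphM rmorph_nat; ring.
  rewrite cexpZ; last by apply: bounded_rvM => //; exact: bounded_rv_conj.
  rewrite cexp_A -val_eqE; case: eqVneq => [/val_inj ->|_]; last by rewrite mulr0.
  by rewrite rmorphM rmorphXn rmorph_nat expr2.
have -> : N%:R ^+ 3 * (lam * smu) = \sum_(i < N) N%:R ^+ 2 * (lam * smu).
  by rewrite sumr_const card_ord -[RHS]mulr_natl; ring.
apply: ler_sum => i _; apply: ler_pM; rewrite ?moment2_ge0 ?sqr_ge0//.
by rewrite ler_pXn2r ?nnegrE ?ler0n// ler_nat.
Qed.

(** Distinct pairs are orthogonal, and each contributes the squared Hilbert-Schmidt norm of [G];
    there are at most N^2 of them. *)
Let moment2_pairs N : moment2 Pr (fun w => \sum_(p : 'I_N * 'I_N)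
  (if (p.1 < p.2)%N then h (nat_of_ord p.1, nat_of_ord p.2) w else 0)) <=
  N%:R ^+ 2 * (lam * tr).
Proof.
pose x (p : 'I_N * 'I_N) w := if (p.1 < p.2)%N then h (nat_of_ord p.1, nat_of_ord p.2) w else 0.
pose g := \sum_a \sum_b normc (G a b) ^+ 2.
have g0 : 0 <= g by apply: sumr_ge0 => a _; apply: sumr_ge0 => b _; exact: sqr_ge0.
have bx p : bounded_rv (x p).
  by rewrite /x; case: (p.1 < p.2)%N; [exact: boundedh|exact: bounded_rv_cst].
have := @moment2_orthogonal _ _ _ Pr ('I_N * 'I_N)%type x
  (fun p => (if (p.1 < p.2)%N then g else 0)%:C) bx.
rewrite -rmorph_sum => /(_ _)/complexI -> => [|[i j] [i' j']]; last first.
  rewrite /x /=; have [ij|ij] := boolP (i < j)%N; last first.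
    rewrite (@cexp_ext _ _ _ _ _ (fun=> 0)) ?cexp_cst; last by move=> w; rewrite mul0r.
    by rewrite if_same.
  have [ij'|ij'] := boolP (i' < j')%N; last first.
    rewrite (@cexp_ext _ _ _ _ _ (fun=> 0)) ?cexp_cst; last by move=> w; rewrite rmorph0 mulr0.
    by case: eqP => // -[? ?]; subst; rewrite ij in ij'.
  rewrite (@cexp_ext _ _ _ _ _ (fun w => \sum_a \sum_b
    (W i a w * (W j a w)^*) * (W i' b w * (W j' b w)^*)^*)); last first.
    move=> w; rewrite /h /= rmorph_sum mulr_suml; apply: eq_bigr => a _.
    by rewrite mulr_sumr.
  have bWW a b : bounded_rv (fun w => (W i a w * (W j a w)^*) * (W i' b w * (W j' b w)^*)^*).
    apply: bounded_rvM; [|apply: bounded_rv_conj];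
      by apply: bounded_rvM; [|apply: bounded_rv_conj]; exact: boundedW.
  rewrite cexp_sum; last by move=> a; exact: bounded_rv_sum.
  transitivity (\sum_a \sum_b (if (i == i') && (j == j') then G a b * (G a b)^* else 0)).
    apply: eq_bigr => a _; rewrite cexp_sum//; apply: eq_bigr => b _.
    by rewrite cexp_pair.
  rewrite -pair_eqE /pair_eq /=; case: ifP => _.
    rewrite /g rmorph_sum; apply: eq_bigr => a _; rewrite rmorph_sum.
    by apply: eq_bigr => b _; rewrite mulc_conj.
  by rewrite big1// => a _; rewrite big1.
have -> : N%:R ^+ 2 * (lam * tr) = \sum_(p : 'I_N * 'I_N) lam * tr.
  by rewrite sumr_const card_prod card_ord -[RHS]mulr_natl natrM expr2.
apply: ler_sum => p _; case: ifP => _; first exact: sum_normc_G_le.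
exact: le_trans sum_normc_G_le.
Qed.

Lemma ustat_variance N : (1 < N)%N -> moment2 Pr (fun w => ustat N w - smu%:C) <=
  32 * (lam * tr) / N%:R ^+ 2 + 128 * (lam * smu) / N%:R.
Proof.
move=> N1.
have N0 : 0 < N%:R :> R by rewrite ltr0n ltnW.
have N2 : 2 <= N%:R :> R by rewrite ler_nat.
pose k (i : 'I_N) := #|[pred j : 'I_N | (i < j)%N]|.
pose k' (j : 'I_N) := #|[pred i : 'I_N | (i < j)%N]|.
have kN i : (k i <= N)%N by rewrite -[leqRHS]card_ord max_card.
have k'N i : (k' i <= N)%N by rewrite -[leqRHS]card_ord max_card.
pose S2 w := \sum_(p : 'I_N * 'I_N)
  (if (p.1 < p.2)%N then h (nat_of_ord p.1, nat_of_ord p.2) w else 0).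
pose S1 w := \sum_(i < N) (k i)%:R * A i w.
pose S1' w := \sum_(i < N) (k' i)%:R * A i w.
pose c : R := 2 / (N%:R * (N%:R - 1)).
have NN : N%:R * (N%:R - 1) != 0 :> R by rewrite mulf_neq0 ?gt_eqF//; lra.
have cE : c%:C = 2 / (N%:R * (N%:R - 1)) :> R[i].
  by rewrite /c !rmorphM fmorphV rmorphM rmorphB rmorph_nat rmorph1 rmorph_nat.
have E w : ustat N w - smu%:C = c%:C * (S2 w + (S1 w + (S1' w)^*)).
  rewrite /ustat -cE.
  have t (i j : 'I_N) : \sum_a (W i a w + mu a) * (W j a w + mu a)^* =
      h (nat_of_ord i, nat_of_ord j) w + A i w + (A j w)^* + smu%:C.
    rewrite /h /A !rmorph_sum -!big_split /=; apply: eq_bigr => a _.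
    by rewrite -mulc_conj rmorphD rmorphM /= conjCK; ring.
  under eq_bigr do under eq_bigr do rewrite t.
  under eq_bigr do rewrite !big_split /=.
  rewrite !big_split /= sum_pairs.
  have -> : \sum_(i < N) \sum_(j < N | (i < j)%N) h (nat_of_ord i, nat_of_ord j) w = S2 w.
    rewrite /S2 -big_mkcond /=.
    by rewrite (pair_big_dep xpredT (fun i j : 'I_N => (i < j)%N)
      (fun i j : 'I_N => h (nat_of_ord i, nat_of_ord j) w)).
  have -> : \sum_(i < N) \sum_(j < N | (i < j)%N) A i w = S1 w.
    by apply: eq_bigr => i _; rewrite sumr_const mulr_natl.
  have -> : \sum_(i < N) \sum_(j < N | (i < j)%N) (A j w)^* = (S1' w)^*.
    rewrite (exchange_big_dep xpredT)//= /S1' rmorph_sum; apply: eq_bigr => j _.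
    by rewrite rmorphM rmorph_nat sumr_const mulr_natl.
  have e1 : c%:C * (N%:R * (N%:R - 1) / 2 * smu%:C) = smu%:C.
    have -> : (N%:R * (N%:R - 1) / 2 : R[i]) = (N%:R * (N%:R - 1) / 2)%:C.
      by rewrite !rmorphM fmorphV rmorphB rmorph_nat rmorph1 rmorph_nat.
    rewrite -!rmorphM; congr (_%:C); rewrite /c mulrA.
    by rewrite -[2 / _]invf_div mulVf ?mul1r// mulf_neq0// invr_eq0 pnatr_eq0.
  by rewrite mulrDr e1 addrK !addrA.
have b2 : bounded_rv S2.
  by apply: bounded_rv_sum => p; case: (p.1 < p.2)%N; [exact: boundedh|exact: bounded_rv_cst].
have b1 : bounded_rv S1 by apply: bounded_rv_sum => i; exact: bounded_rvZ.
have b1' : bounded_rv (fun w => (S1' w)^*).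
  by apply: bounded_rv_conj; apply: bounded_rv_sum => i; exact: bounded_rvZ.
rewrite (_ : (fun w => _) = fun w => c%:C * (S2 w + (S1 w + (S1' w)^*))); last exact/funext.
rewrite moment2Z; last by apply: bounded_rvD => //; exact: bounded_rvD.
have := moment2D Pr b2 (bounded_rvD b1 b1'); have := moment2D Pr b1 b1'.
rewrite (moment2_conj Pr S1').
have := moment2_linear kN; have := moment2_linear k'N; have := moment2_pairs N.
rewrite -/S2 -/S1 -/S1' => h1 h2 h3 h4 h5.
set a := lam * tr in h1 *; set b := lam * smu in h2 h3 *.
(* [moment2D] used twice: a factor 2 for the pairs and 2 (2 + 2) for the two linear sums. *)
have h6 : moment2 Pr (fun w => S2 w + (S1 w + (S1' w)^*)) <=
    2 * N%:R ^+ 2 * a + 8 * N%:R ^+ 3 * b by lra.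
(* From N - 1 >= N / 2. With the factors 2 and 8 of [h6], the 16 accounts for 32 and 128. *)
have c2 : normc c%:C ^+ 2 <= 16 / N%:R ^+ 4.
  rewrite normc_real real_normK ?num_real// /c expr_div_n.
  rewrite ler_pdivlMr ?exprn_gt0// mulrAC ler_pdivrMr; last first.
    by rewrite exprn_gt0// mulr_gt0//; lra.
  rewrite exprMn (_ : N%:R ^+ 4 = N%:R ^+ 2 * N%:R ^+ 2 :> R); last by rewrite -exprD.
  rewrite [leLHS](_ : _ = N%:R ^+ 2 * (4 * N%:R ^+ 2)); last by ring.
  rewrite [leRHS](_ : _ = N%:R ^+ 2 * (16 * (N%:R - 1) ^+ 2)); last by ring.
  by rewrite ler_wpM2l ?sqr_ge0//; nra.
apply: le_trans (ler_pM _ _ c2 h6) _; rewrite ?sqr_ge0 ?moment2_ge0//.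
rewrite le_eqVlt; apply/orP; left; apply/eqP.
by move: (N%:R : R) N0 => n n0; field; rewrite gt_eqF.
Qed.

End ustatistic.

(** * Sobolev coefficients *)

Section operator_norm.
Local Open Scope complex_scope.
Local Open Scope ring_scope.
Context {R : realType} {n : nat}.
Implicit Types (A : 'M[R[i]]_n) (v : 'cV[R[i]]_n).

Lemma enorm_ge0 v : 0 <= enorm v.
Proof. exact: sqrtr_ge0. Qed.

Lemma enorm_sqr v : enorm v ^+ 2 = \sum_i normc (v i 0) ^+ 2.
Proof. by rewrite sqr_sqrtr//; apply: sumr_ge0 => i _; exact: sqr_ge0. Qed.

Lemma enormZ (c : R[i]) v : enorm (c *: v) = normc c * enorm v.
Proof.
rewrite /enorm (eq_bigr (fun i => normc c ^+ 2 * normc (v i 0) ^+ 2)).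
  by rewrite -mulr_sumr sqrtrM ?sqr_ge0// sqrtr_sqr ger0_norm ?normc_ge0.
by move=> i _; rewrite mxE normcM exprMn.
Qed.

(** A Hilbert-Schmidt bound. It shows that the set defining [opnorm] is bounded, so that its [sup]
    is a true least upper bound. *)
Lemma enorm_mul_hs A v :
  enorm (A *m v) <= Num.sqrt (\sum_i \sum_j normc (A i j) ^+ 2) * enorm v.
Proof.
rewrite -sqrtrM; last by apply: sumr_ge0 => i _; apply: sumr_ge0 => j _; exact: sqr_ge0.
rewrite ler_wsqrtr// mulr_suml; apply: ler_sum => i _; rewrite mxE.
exact: cauchy_schwarz_normc.
Qed.

Lemma enorm_mul_le A v : enorm (A *m v) <= opnorm A * enorm v.
Proof.
have [v0|v0] := eqVneq (enorm v) 0.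
  by rewrite v0 mulr0; apply: le_trans (enorm_mul_hs A v) _; rewrite v0 mulr0.
have {}v0 : 0 < enorm v by rewrite lt_def v0 enorm_ge0.
rewrite -ler_pdivrMr//.
have nV : normc (enorm v)^-1%:C = (enorm v)^-1 by rewrite normc_real gtr0_norm ?invr_gt0.
apply: ub_le_sup.
  exists (Num.sqrt (\sum_i \sum_j normc (A i j) ^+ 2)) => _ [w /= w1 <-].
  by apply: le_trans (enorm_mul_hs A w) _; rewrite ler_piMr ?sqrtr_ge0.
exists ((enorm v)^-1%:C *: v); first by rewrite /= enormZ nV mulVf ?gt_eqF.
by rewrite -scalemxAr enormZ nV mulrC.
Qed.

Lemma opnorm_ge0 A : 0 <= opnorm A.
Proof.
have e0 : enorm (0 : 'cV[R[i]]_n) = 0.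
  by rewrite /enorm big1 ?sqrtr0// => i _; rewrite mxE /= expr0n /= addr0 sqrtr0 expr0n.
apply: le_trans (ub_le_sup _ _); last first.
- by exists 0; [rewrite /= e0 ler01|reflexivity].
- exists (Num.sqrt (\sum_i \sum_j normc (A i j) ^+ 2)) => _ [w /= w1 <-].
  by apply: le_trans (enorm_mul_hs A w) _; rewrite ler_piMr ?sqrtr_ge0.
- exact: enorm_ge0.
Qed.

Lemma sum_normc_mulmx_le A v : \sum_i normc (\sum_j A i j * v j 0) ^+ 2 <=
  opnorm A ^+ 2 * \sum_j normc (v j 0) ^+ 2.
Proof.
rewrite -enorm_sqr -exprMn; apply: le_trans (_ : enorm (A *m v) ^+ 2 <= _).
  by rewrite enorm_sqr; under [leRHS]eq_bigr do rewrite mxE.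
rewrite ler_pXn2r ?nnegrE ?mulr_ge0 ?enorm_ge0 ?opnorm_ge0//; exact: enorm_mul_le.
Qed.

(** The transposed action has the same bound, by duality: with [w] the conjugate of v A and q its
    squared norm, q is the pairing of v with A w, so that q^2 <= |v|^2 |A|^2 q. *)
Lemma sum_normc_mul_le A (v : 'I_n -> R[i]) : \sum_j normc (\sum_i v i * A i j) ^+ 2 <=
  opnorm A ^+ 2 * \sum_i normc (v i) ^+ 2.
Proof.
pose w : 'cV[R[i]]_n := \col_j (\sum_i v i * A i j)^*.
set q := leLHS; set p := \sum_i _.
have q0 : 0 <= q by apply: sumr_ge0 => j _; exact: sqr_ge0.
have p0 : 0 <= p by apply: sumr_ge0 => j _; exact: sqr_ge0.
have wq : \sum_j normc (w j 0) ^+ 2 = q.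
  by apply: eq_bigr => j _; rewrite mxE normc_conj.
have qE : q%:C = \sum_i v i * (\sum_j A i j * w j 0).
  rewrite /q rmorph_sum (eq_bigr (fun j => \sum_i v i * (A i j * w j 0))).
    by rewrite exchange_big; apply: eq_bigr => i _; rewrite mulr_sumr.
  move=> j _; apply: etrans (esym (mulc_conj _)) _; rewrite mxE mulr_suml; apply: eq_bigr => i _.
  by rewrite mulrA.
have : q ^+ 2 <= p * (opnorm A ^+ 2 * q).
  have -> : q ^+ 2 = normc q%:C ^+ 2 by rewrite normc_real ger0_norm.
  rewrite qE; apply: le_trans (cauchy_schwarz_normc _ _) _.
  by rewrite ler_wpM2l// -wq; exact: sum_normc_mulmx_le.
have [->|] := eqVneq q 0; first by rewrite mulr_ge0 ?sqr_ge0.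
move=> qn; have qp : 0 < q by rewrite lt_def qn.
by rewrite mulrCA mulrA expr2 ler_pM2r// -mulrA mulrC.
Qed.

End operator_norm.

(** * Convergent power sums *)

Section power_sums.
Local Open Scope ring_scope.
Context {R : realType}.

Lemma sum_powR_le (a : R) n : 0 < a ->
  \sum_(l < n) l.+1%:R `^ (- (1 + a)) <= 1 + a^-1.
Proof.
move=> a0; suff H m : \sum_(l < m.+1) l.+1%:R `^ (- (1 + a)) <=
    1 + a^-1 - a^-1 * m.+1%:R `^ (- a).
  case: n => [|m]; first by rewrite big_ord0 addr_ge0// invr_ge0 ltW.
  by apply: le_trans (H m) _; rewrite gerBl mulr_ge0 ?powR_ge0// invr_ge0 ltW.
elim: m => [|m IH]; first by rewrite big_ord1 !powR1 mulr1 addrK.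
rewrite big_ord_recr /=; apply: le_trans (lerD IH (lexx _)) _.
set x : R := m.+2%:R; set y : R := m.+1%:R.
have y0 : 0 < y by rewrite ltr0n.
have x0 : 0 < x by rewrite ltr0n.
have xy : y = x - 1 by rewrite /x /y -[m.+2]addn1 natrD addrK.
have xE : x `^ (- (1 + a)) = x `^ (- a) / x.
  rewrite opprD addrC powRD; last by rewrite (gt_eqF x0) implybT.
  by rewrite (powR_inv1 (ltW x0)).
(* The discrete substitute for comparison with an integral: (1 - 1/x)^(-a) >= 1 + a / x, from e^z >=
   1 + z and ln(1 - 1/x) <= -1/x. *)
suff h : x `^ (- a) * (1 + a / x) <= y `^ (- a).
  have : x `^ (- a) / x <= a^-1 * (y `^ (- a) - x `^ (- a)).
    rewrite -(ler_pM2l a0) mulVKf ?gt_eqF// lerBrDl; apply: le_trans h.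
    by rewrite mulrDr mulr1 lerD2l mulrCA.
  rewrite xE mulrBr.
  move: (x `^ (- a) / x) (a^-1 * y `^ (- a)) (a^-1 * x `^ (- a)) (a^-1) => u v w t h1; lra.
have -> : y `^ (- a) = x `^ (- a) * (y / x) `^ (- a).
  by rewrite -powRM ?divr_ge0 ?ltW// mulrCA divff ?gt_eqF// mulr1.
rewrite ler_pM2l ?powR_gt0// /powR gt_eqF ?divr_gt0//.
apply: le_trans (expR_ge1Dx _); rewrite lerD2l.
have := @le_ln1Dx R (- x^-1); rewrite ltrN2 invf_lt1// ltr1n => /(_ isT).
rewrite (_ : 1 - x^-1 = y / x); first by rewrite mulNr -mulrN ler_pM2l// lerNr.
by rewrite xy mulrBl divff ?gt_eqF// mul1r.
Qed.

End power_sums.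

Lemma Y0E (R : realType) (i : 'I_1) x : @Y R 0 i x = real_complex R (Num.sqrt (4 * pi)^-1).
Proof.
rewrite /Y (ord1 i) subrr /= /spherical_harmonic_nneg !expr0 mulr1 mul1r /=.
rewrite /legendre expr0 fact0 mulr1 invr1 scale1r !derivn0 expr0 hornerC mulr1.
by rewrite !mulr1 div1r.
Qed.

(** * Truncation bias over the Sobolev ball *)

Section sobolev_coefficients.
Local Open Scope complex_scope.
Local Open Scope ring_scope.
Context {R : realType}.
Variables (s rad : R) (f : 'cV[R]_3 -> R).
Hypothesis hf : sobolev_ball s rad f.
Hypothesis hs : 1 <= s.
Local Notation fhat i := (sphere_fourier (fun x => (f x)%:C) i).
Local Notation S := ((4 * pi)^-1 + rad ^+ 2).

Definition level_energy l : R := \sum_(i < l.*2.+1) normc (fhat i) ^+ 2.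

Lemma level_energy_ge0 l : 0 <= level_energy l.
Proof. by apply: sumr_ge0 => i _; exact: sqr_ge0. Qed.

Lemma sobolev_partial M : \sum_(l < M) (1 + (l * l.+1)%:R) `^ s * level_energy l <= S.
Proof.
have [_ _ h] := hf; rewrite -lee_fin; apply: le_trans h; rewrite /sobolev_norm_sq.
rewrite -sumEFin -(big_mkord xpredT (fun l => ((1 + (l * l.+1)%:R) `^ s * level_energy l)%:E)).
under eq_bigr do rewrite /level_energy mulr_sumr -sumEFin.
apply: nneseries_lim_ge => l _ _; apply: sume_ge0 => i _.
by rewrite lee_fin mulr_ge0 ?powR_ge0 ?sqr_ge0.
Qed.

Lemma sphere_fourier0 (i : 'I_1) : normc (@sphere_fourier R (fun x => (f x)%:C) 0 i) ^+ 2 = (4 * pi)^-1.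
Proof.
have [df _ _] := hf; have [mf f0 f1] := df.
have jf := density_integrable df.
rewrite /sphere_fourier (@eq_cintegral _ _ _ _ _ _ (fun x => (Num.sqrt (4 * pi)^-1 * f x)%:C)).
  rewrite cintegral_real normc_real RintegralZl//; last exact: measurable_sphere.
  rewrite [X in _ * X](_ : _ = 1); last by rewrite /Rintegral f1.
  rewrite mulr1 real_normK ?num_real// sqr_sqrtr// invr_ge0 mulr_ge0// ltW// pi_gt0//.
by move=> x _; rewrite Y0E conj_real -rmorphM mulrC.
Qed.

Lemma level_energy0 : level_energy 0 = (4 * pi)^-1.
Proof. by rewrite /level_energy big_ord1 sphere_fourier0. Qed.

Lemma sobolev_weight_ge l (L : nat) : (L <= l)%N ->
  L%:R `^ (2 * s) <= (1 + (l * l.+1)%:R) `^ s :> R.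
Proof.
move=> Ll; rewrite powRrM powR_mulrn//.
apply: ge0_ler_powR; rewrite ?nnegrE ?addr_ge0 ?sqr_ge0//; first by rewrite (le_trans _ hs).
by rewrite -natrX nat1r ler_nat; nia.
Qed.

Lemma sobolev_tail (L M : nat) : (0 < L)%N ->
  \sum_(L.+1 <= l < M) level_energy l <= L%:R `^ (- (2 * s)) * S.
Proof.
move=> L0; have LL : 0 < L%:R `^ (2 * s) :> R by rewrite powR_gt0 ?ltr0n.
rewrite powRN -ler_pdivrMl ?invr_gt0// invrK mulr_sumr.
apply: le_trans (sobolev_partial M).
have [LM|ML] := leqP L.+1 M; last first.
  rewrite big_geq ?(ltnW ML)//; apply: sumr_ge0 => l _.
  by rewrite mulr_ge0 ?powR_ge0 ?level_energy_ge0.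
rewrite -(big_mkord xpredT (fun l => (1 + (l * l.+1)%:R) `^ s * level_energy l)).
rewrite [leRHS](@big_cat_nat _ _ _ L.+1)//= ler_wpDl//.
  by apply: sumr_ge0 => l _; rewrite mulr_ge0 ?powR_ge0 ?level_energy_ge0.
rewrite big_nat [leRHS]big_nat; apply: ler_sum => l /andP[Ll _].
by rewrite ler_wpM2r ?level_energy_ge0// sobolev_weight_ge// ltnW.
Qed.

(** The squared distance to the uniform density is the squared norm of [f] minus 1/(4 pi), and 1/(4
    pi) is also the energy at degree 0. Parseval leaves the degrees from 1 on, and those beyond [L]
    go into [sobolev_tail]. *)
Lemma sobolev_bias (L : nat) : (0 < L)%N ->
  (l2norm_sq (fun x => (f x - f_unif x)%:C) <=
  (\sum_(1 <= l < L.+1) level_energy l + L%:R `^ (- (2 * s)) * S)%:E)%E.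
Proof.
move=> L0; have [df [[mf1 mf2 jf2] _] _] := hf; have [mf f0 f1] := df.
have jf := density_integrable df; have mSph := @measurable_sphere R.
have {}jf2 : (@surface R).-integrable sphere (EFin \o (fun x => f x ^+ 2)).
  apply/integrableP; split.
    by apply/measurable_EFinP; exact: measurable_funX.
  apply: le_lt_trans jf2; rewrite /l2norm_sq le_eqVlt; apply/orP; left; apply/eqP.
  apply: eq_integral => x _; rewrite normc_real real_normK ?num_real//.
  by rewrite /= ger0_norm ?sqr_ge0.
have pi4 : 0 < 4 * pi :> R by rewrite mulr_gt0// pi_gt0.
have E : l2norm_sq (fun x => (f x - f_unif x)%:C) =
    (\int[@surface R]_(x in sphere) (f x ^+ 2) - (4 * pi)^-1)%:E.
  have jc := surface_integrable_cst ((4 * pi)^-1 ^+ 2 : R).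
  have jz := integrableZl mSph (2 * (4 * pi)^-1) jf.
  have -> : l2norm_sq (fun x => (f x - f_unif x)%:C) = (\int[@surface R]_(x in sphere)
      (f x ^+ 2 - 2 * (4 * pi)^-1 * f x + (4 * pi)^-1 ^+ 2)%:E)%E.
    apply: eq_integral => x /set_mem sx; rewrite normc_real real_normK ?num_real//.
    by rewrite /f_unif indicE mem_set// mulr1; congr EFin; ring.
  rewrite -[LHS]fineK; last first.
    have j1 : (@surface R).-integrable sphere
        (EFin \o (fun x => f x ^+ 2 - 2 * (4 * pi)^-1 * f x)).
      by apply: eq_integrable (integrableB mSph jf2 jz).
    have j2 : (@surface R).-integrable sphere
        (EFin \o (fun x => f x ^+ 2 - 2 * (4 * pi)^-1 * f x + (4 * pi)^-1 ^+ 2)).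
      by apply: eq_integrable (integrableD mSph j1 jc).
    exact: integrable_fin_num j2.
  congr EFin; rewrite -/(Rintegral _ _ _).
  rewrite RintegralD//; last by apply: eq_integrable (integrableB mSph jf2 jz).
  rewrite RintegralB// RintegralZl//.
  have -> : \int[@surface R]_(x in sphere) f x = 1 by rewrite /Rintegral f1.
  have -> : \int[@surface R]_(x in sphere) ((4 * pi)^-1 ^+ 2) = (4 * pi)^-1.
    (* The area 4 pi of the sphere is read off the normalization of the constant harmonic. *)
    have := @cintegral_Y_conj R 0 0 0 0.
    rewrite (@eq_cintegral _ _ _ _ _ _ (fun x => ((4 * pi)^-1)%:C)) => [|x _]; last first.
      rewrite Y0E conj_real -rmorphM -expr2 sqr_sqrtr// invr_ge0 ltW//.
    rewrite cintegral_real => /(congr1 (@complex.Re R)) /= h.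
    by rewrite expr2 RintegralZl ?h ?mulr1//; exact: surface_integrable_cst.
  by lra.
rewrite E lee_fin lerBlDr; apply/ler_addgt0Pr => e e0.
have [M0 /(_ (maxn M0 L.+1) (leq_maxl _ _))] := parseval_le f0 jf jf2 e0.
move=> /le_trans; apply; rewrite lerD2r.
set M := maxn _ _; have LM : (L.+1 <= M)%N by exact: leq_maxr.
rewrite -(big_mkord xpredT (fun l => level_energy l)) big_ltn ?(leq_trans _ LM)//.
rewrite level_energy0 (@big_cat_nat _ _ _ L.+1)//=.
have := sobolev_tail M L0; lra.
Qed.

End sobolev_coefficients.

(** * Fourier series of the density of the observations *)

Section observation_series.
Local Open Scope complex_scope.
Local Open Scope ring_scope.
Context {R : realType}.
Variables (mu : probability 'M[R]_3 R) (fe : 'M[R]_3 -> R).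
Variable D : forall l : nat, 'M[R]_3 -> 'M[R[i]]_l.*2.+1.
Local Notation F := (rot_fourier mu D fe).
Variables (nu d0 d1 : R).
Hypothesis nu0 : 0 < nu.
Hypothesis hF : ordinary_smooth F nu d0 d1.
Variables (s rad : R) (f : 'cV[R]_3 -> R).
Hypothesis hf : sobolev_ball s rad f.
Hypothesis hs : 1 <= s.

(** The degree 0 term, then x y <= (x^2 + y^2) / 2 at the other degrees: the Sobolev sum bounds the
    x^2, and d1^2 times the sum of l^(-1 - 2 nu), which is at most 1 + 1/(2 nu), bounds the y^2. *)
Definition observation_bound : R := opnorm (F 0%N) / (4 * pi) +
  ((4 * pi)^-1 + rad ^+ 2 + d1 ^+ 2 * (1 + (2 * nu)^-1)) / 2.

Lemma quarter_pi_le l : l.+1.*2.+1%:R / (4 * pi) <= l.+1%:R :> R.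
Proof.
have p0 := pi_gt0 R; have p2 := pi_ge2 R.
rewrite ler_pdivrMr ?mulr_gt0// -[l.+1.*2.+1]addn1 -muln2 natrD natrM.
have : 1 <= l.+1%:R :> R by rewrite ler1n.
by move: (l.+1%:R : R) => x x1; nra.
Qed.

Lemma obs_series_le M : \sum_(l < M)
    Num.sqrt (\sum_(n < l.*2.+1) normc (obs_fourier mu fe f D n) ^+ 2) *
    Num.sqrt (l.*2.+1%:R / (4 * pi)) <= observation_bound.
Proof.
have p0 := pi_gt0 R; have p40 : 0 < 4 * pi :> R by rewrite mulr_gt0.
have eE l : Num.sqrt (\sum_(n < l.*2.+1) normc (obs_fourier mu fe f D n) ^+ 2) <=
    opnorm (F l) * Num.sqrt (level_energy f l).
  have -> : opnorm (F l) * Num.sqrt (level_energy f l) =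
      Num.sqrt (opnorm (F l) ^+ 2 * level_energy f l).
    by rewrite sqrtrM ?sqr_ge0// sqrtr_sqr ger0_norm ?opnorm_ge0.
  rewrite ler_wsqrtr//.
  have := sum_normc_mulmx_le (F l) (\col_j sphere_fourier (fun x => (f x)%:C) j).
  under eq_bigr do under eq_bigr do rewrite mxE.
  by under [X in _ <= _ * X]eq_bigr do rewrite mxE.
case: M => [|M].
  rewrite big_ord0 addr_ge0// ?divr_ge0 ?opnorm_ge0 ?(ltW p40)//.
  apply: addr_ge0; first by rewrite addr_ge0 ?sqr_ge0// invr_ge0 ltW.
  by rewrite mulr_ge0 ?sqr_ge0// addr_ge0// invr_ge0 mulr_ge0// ltW.
rewrite big_ord_recl; apply: lerD.
  apply: le_trans (ler_wpM2r (sqrtr_ge0 _) (eE 0%N)) _.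
  by rewrite (level_energy0 hf) div1r -mulrA -expr2 sqr_sqrtr// invr_ge0 ltW.
have H (l : nat) : Num.sqrt (\sum_(n < l.+1.*2.+1) normc (obs_fourier mu fe f D n) ^+ 2) *
    Num.sqrt (l.+1.*2.+1%:R / (4 * pi)) <=
    ((1 + (l.+1 * l.+2)%:R) `^ s * level_energy f l.+1 +
     d1 ^+ 2 * l.+1%:R `^ (- (1 + 2 * nu))) / 2.
  have l0 : 0 < l.+1%:R :> R by rewrite ltr0n.
  set t := Num.sqrt (level_energy f l.+1); set q := Num.sqrt (_ / (4 * pi)).
  have t2 : t ^+ 2 = level_energy f l.+1 by rewrite sqr_sqrtr ?level_energy_ge0.
  have q2 : q ^+ 2 <= l.+1%:R.
    by rewrite sqr_sqrtr ?quarter_pi_le// divr_ge0// ltW.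
  apply: le_trans (ler_wpM2r (sqrtr_ge0 _) (eE l.+1)) _; rewrite -/t.
  have [_ /(_ l.+1 isT) [_ oF]] := hF; have o0 := opnorm_ge0 (F l.+1).
  set o := opnorm _ in oF o0 *.
  have x1 : l.+1%:R ^+ 2 * t ^+ 2 <= (1 + (l.+1 * l.+2)%:R) `^ s * level_energy f l.+1.
    rewrite t2 ler_wpM2r ?level_energy_ge0//.
    apply: le_trans (sobolev_weight_ge hs (leqnn l.+1)); rewrite -powR_mulrn//.
    by rewrite ler_powR ?ler1n// ler_peMr.
  have x2 : (o * q / l.+1%:R) ^+ 2 <= d1 ^+ 2 * l.+1%:R `^ (- (1 + 2 * nu)).
    have -> : l.+1%:R `^ (- (1 + 2 * nu)) = (l.+1%:R `^ (- nu)) ^+ 2 * l.+1%:R / l.+1%:R ^+ 2 :> R.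
      rewrite expr2 -powRD; last by rewrite (gt_eqF l0) implybT.
      rewrite expr2 invfM mulrA mulfK ?gt_eqF// -(powR_inv1 (ltW l0)) -powRD; last first.
        by rewrite (gt_eqF l0) implybT.
      by congr (_ `^ _); ring.
    rewrite !exprMn exprVn [leRHS]mulrA ler_pM2r ?invr_gt0 ?exprn_gt0// [leRHS]mulrA -[X in _ <= X * _]exprMn.
    apply: (ler_pM (sqr_ge0 _) (sqr_ge0 _)) => //.
    by rewrite ler_pXn2r// nnegrE (le_trans o0).
  (* A weight l is moved onto the energy, where s >= 1 pays for it; the other factor is then
     O(l^(-nu - 1/2)). *)
  have : o * t * q = (l.+1%:R * t) * (o * q / l.+1%:R).
    by move: (l.+1%:R : R) l0 => x x0; field; rewrite gt_eqF.
  move: x1 x2; rewrite -exprMn; set x := _ * t; set y := _ / l.+1%:R => x1 x2 ->.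
  have := sqr_ge0 (x - y); rewrite sqrrB; lra.
apply: le_trans (ler_sum _ (fun (l : 'I_M) _ => H l)) _.
rewrite -mulr_suml ler_pM2r ?invr_gt0// big_split /=; apply: lerD.
  have := sobolev_partial hf M.+1; rewrite big_ord_recl; apply: le_trans.
  by rewrite lerDr mulr_ge0 ?powR_ge0 ?level_energy_ge0.
by rewrite -mulr_sumr ler_wpM2l ?sqr_ge0//; apply: sum_powR_le; rewrite mulr_gt0.
Qed.

End observation_series.

(** * The test statistic *)

Section centering.
Local Open Scope complex_scope.
Local Open Scope ring_scope.
Context {R : realType} {d : measure_display} {Om : measurableType d}.
Variable Pr : probability Om R.

Lemma moment2_center X : bounded_rv X ->
  moment2 Pr (fun w => X w - cexp Pr X) <= moment2 Pr X.
Proof.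
move=> bX; have [m mE] : exists m, m = cexp Pr X by exists (cexp Pr X).
rewrite -mE.
have bC := bounded_rv_conj bX; have bXX := bounded_rvM bX bC.
suff E : (moment2 Pr (fun w => X w - m))%:C = (moment2 Pr X - normc m ^+ 2)%:C.
  by have /complexI -> := E; rewrite gerBl sqr_ge0.
rewrite moment2E rmorphB /= moment2E.
rewrite (@cexp_ext _ _ _ _ _ (fun w => X w * (X w)^* +
  (- m^* * X w + (- m * (X w)^* + m * m^*)))); last first.
  by move=> w; rewrite rmorphB /=; ring.
have b1 := bounded_rvZ (- m^*) bX; have b2 := bounded_rvZ (- m) bC.
have b3 := bounded_rv_cst (m * m^*) : bounded_rv (fun _ : Om => m * m^*).
rewrite (cexpD Pr bXX (bounded_rvD b1 (bounded_rvD b2 b3))) (cexpD Pr b1 (bounded_rvD b2 b3)).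
rewrite (cexpD Pr b2 b3) (cexpZ _ _ bX) (cexpZ _ _ bC) cexp_cst (cexp_conj _ bX) -mE; congr (_ + _).
by rewrite -mulc_conj; ring.
Qed.

End centering.

(** * Mean and variance of the test statistic *)

Section test_statistic.
Local Open Scope complex_scope.
Local Open Scope ring_scope.
Context {R : realType} {d : measure_display} {Om : measurableType d}.
Variables (mu : probability 'M[R]_3 R) (fe : 'M[R]_3 -> R).
Variables (Pr : probability Om R) (eps : nat -> Om -> 'M[R]_3) (X : nat -> Om -> 'cV[R]_3).
Variable f : 'cV[R]_3 -> R.
Hypothesis dfe : probability_density mu SO3 fe.
Hypothesis df : probability_density (@surface R) sphere f.
Hypothesis heps : forall i, measurable_fun setT (eps i) /\ forall w, SO3 (eps i w).
Hypothesis hX : forall i, measurable_fun setT (X i) /\ forall w, sphere (X i w).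
Hypothesis deps : forall i, has_density Pr (eps i) mu SO3 fe.
Hypothesis dX : forall i, has_density Pr (X i) (@surface R) sphere f.
Hypothesis indep : mutually_independent Pr (fun k : nat + nat =>
  match k with
  | inl i => preimage_set_system setT (eps i) measurable
  | inr i => preimage_set_system setT (X i) measurable
  end).
Local Notation E := (cexp Pr).
Variable D : forall l : nat, 'M[R]_3 -> 'M[R[i]]_l.*2.+1.
Hypothesis hD : rotational_harmonics D.
Local Notation Z i w := (eps i w *m X i w).
Local Notation F := (rot_fourier mu D fe).
Variables (nu d0 d1 : R).
Hypothesis nu0 : 0 < nu.
Hypothesis d00 : 0 < d0.
Hypothesis hF : ordinary_smooth F nu d0 d1.
Local Notation fhat i := (sphere_fourier (fun x => (f x)%:C) i).

Lemma harmonic_span_Phi l (n : 'I_l.*2.+1) : harmonic_span (Phi F n).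
Proof. by apply: harmonic_span_sum => j; apply: harmonic_spanZ; exact: harmonic_span_Yconj. Qed.

Lemma span_rv i g : harmonic_span g -> local_rv eps X i (fun w => g (Z i w)).
Proof. exact: (local_rv_span heps hX hD). Qed.

Lemma span_bounded i g : harmonic_span g -> bounded_rv (fun w => g (Z i w)).
Proof. by move=> sg; exact: (local_rv_bounded heps hX (span_rv i sg)). Qed.

Lemma cexp_Phi i l (n : 'I_l.*2.+1) : E (fun w => Phi F n (Z i w)) = fhat n.
Proof.
have bY j : bounded_rv (fun w => (@Y R l j (Z i w))^*).
  by apply: (@span_bounded i (fun x => (Y j x)^*)); exact: harmonic_span_Yconj.
rewrite /Phi cexp_sum; last by move=> j; exact: bounded_rvZ.
have [/(_ l) uF _] := hF.
transitivity ((invmx (F l) *m (F l *m \col_j fhat j)) n 0).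
  rewrite mxE; apply: eq_bigr => j _; rewrite cexpZ//; congr (_ * _).
  rewrite (cexp_Yconj dfe df heps hX deps dX indep hD) mxE.
  by apply: eq_bigr => k _; congr (_ * _); rewrite mxE.
by rewrite mulKmx// mxE.
Qed.

(** Identical distribution of the observations, seen through harmonic polynomials: both sides are
    the same combination of [obs_fourier]. *)
Lemma cexp_span_eq i g : harmonic_span g ->
  E (fun w => g (Z i w)) = E (fun w => g (Z 0 w)).
Proof.
move=> sg; have [c [M H]] := harmonic_span_conj sg.
have SZ k w : sphere (Z k w).
  by apply: sphere_SO3; [case: (heps k) => _; exact|case: (hX k) => _; exact].
suff EE k : E (fun w => g (Z k w)) =
    \sum_(l < M) \sum_(n < l.*2.+1) (c l n)^* * obs_fourier mu fe f D n by rewrite !EE.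
have bY l (n : 'I_l.*2.+1) : bounded_rv (fun w => (@Y R l n (Z k w))^*).
  by apply: (@span_bounded k (fun x => (Y n x)^*)); exact: harmonic_span_Yconj.
rewrite (@cexp_ext _ _ _ _ _ (fun w =>
    \sum_(l < M) \sum_(n < l.*2.+1) (c l n)^* * (Y n (Z k w))^*)); last first.
  move=> w; rewrite -[LHS]conjCK (H M)// rmorph_sum; apply: eq_bigr => l _.
  by rewrite rmorph_sum; apply: eq_bigr => n _; rewrite rmorphM.
rewrite cexp_sum; last by move=> l; apply: bounded_rv_sum => n; exact: bounded_rvZ (bY _ _).
apply: eq_bigr => l _; rewrite cexp_sum; last by move=> n; exact: bounded_rvZ (bY _ _).
apply: eq_bigr => n _; rewrite cexpZ//; congr (_ * _).
exact: (cexp_Yconj dfe df heps hX deps dX indep hD).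
Qed.

Variables (s rad : R).
Hypothesis hf : sobolev_ball s rad f.
Hypothesis hs : 1 <= s.
Variable L : nat.
Hypothesis L0 : (0 < L)%N.

(** Degrees 1 to [L] are stored shifted down by one, degree 0 being absent from the statistic. *)
Definition frequency := {l : 'I_L & 'I_(nat_of_ord l).+1.*2.+1}.
Let PhiL (a : frequency) : 'cV[R]_3 -> R[i] := Phi F (tagged a).
Let muL (a : frequency) : R[i] := fhat (tagged a).
Let W i a w : R[i] := PhiL a (Z i w) - muL a.

Lemma sum_frequency (V : nmodType) (H : forall l : nat, 'I_l.*2.+1 -> V) :
  \sum_(1 <= l < L.+1) \sum_(i < l.*2.+1) H l i = \sum_(a : frequency) H (tag a).+1 (tagged a).
Proof.
rewrite big_add1 /= big_mkord.
exact: (sig_big_dep xpredT (fun _ => xpredT) (fun l : 'I_L => H l.+1)).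
Qed.

Lemma frequency_orthonormal (a b : frequency) :
  cintegral (@surface R) sphere (fun x => Y (tagged a) x * (Y (tagged b) x)^*) = (a == b)%:R.
Proof.
rewrite cintegral_Y_conj; congr (nat_of_bool _)%:R.
apply/andP/eqP => [|->]; last by rewrite !eqxx.
case: a b => [l i] [l' j] /= [/eqP[/val_inj ll] /eqP ij].
by subst l'; congr existT; exact: val_inj.
Qed.

Definition inverse_norm : R := d0^-1 * L%:R `^ nu.

Lemma opnorm_inv_le (l : 'I_L) : opnorm (invmx (F l.+1)) <= inverse_norm.
Proof.
have [_ /(_ l.+1 isT) [h _]] := hF; apply: le_trans h _.
rewrite ler_wpM2l ?invr_ge0 ?(ltW d00)//; by apply: ge0_ler_powR; rewrite ?nnegrE ?ler0n ?ler_nat ?(ltW nu0).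
Qed.

Lemma opnorm_inv_sqr_le (l : 'I_L) : opnorm (invmx (F l.+1)) ^+ 2 <= inverse_norm ^+ 2.
Proof.
rewrite ler_pXn2r ?opnorm_inv_le ?nnegrE ?opnorm_ge0//.
by rewrite (le_trans (opnorm_ge0 _) (opnorm_inv_le l)).
Qed.

Let span_PhiL a : harmonic_span (PhiL a).
Proof. exact: harmonic_span_Phi. Qed.

Let bPhiL i a : bounded_rv (fun w => PhiL a (Z i w)).
Proof. exact: span_bounded. Qed.

Let span_W a : harmonic_span (fun x => PhiL a x - muL a).
Proof. by apply: harmonic_spanD => //; exact: harmonic_span_cst. Qed.

Let bW i a : bounded_rv (W i a).
Proof. exact: (span_bounded i (span_W a)). Qed.

Let EW i a : E (W i a) = 0.
Proof.
rewrite (@cexp_ext _ _ _ _ _ (fun w => PhiL a (Z i w) + - muL a))// cexpD//.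
  by rewrite cexp_Phi cexp_cst subrr.
exact: bounded_rv_cst.
Qed.

Let G a b := E (fun w => W 0 a w * (W 0 b w)^*).

Let EG i a b : E (fun w => W i a w * (W i b w)^*) = G a b.
Proof.
exact: (cexp_span_eq i (harmonic_spanM (span_W a) (harmonic_span_conj (span_W b)))).
Qed.

(** At each degree the combination has coefficients v F^-1 in the conjugate harmonics. Conjugating
    the whole sum makes orthonormality applicable, and [sum_normc_mul_le] bounds the transposed
    action of F^-1. *)
Lemma integral_lin_Phi (v : frequency -> R[i]) :
  \int[@surface R]_(x in sphere) (normc (\sum_a v a * PhiL a x) ^+ 2) <=
  inverse_norm ^+ 2 * \sum_a normc (v a) ^+ 2.
Proof.
pose v' (l : 'I_L) (n : 'I_(nat_of_ord l).+1.*2.+1) : R[i] := v (Tagged (fun l : 'I_L => 'I_(nat_of_ord l).+1.*2.+1) n).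
pose c (l : 'I_L) (j : 'I_(nat_of_ord l).+1.*2.+1) := \sum_n v' l n * invmx (F l.+1) n j.
pose c' (b : frequency) : R[i] := (c (tag b) (tagged b))^*.
have E x : normc (\sum_a v a * PhiL a x) = normc (\sum_(b : frequency) c' b * Y (tagged b) x).
  rewrite -[RHS]normc_conj; congr (normc _); rewrite rmorph_sum.
  have -> : \sum_a v a * PhiL a x = \sum_(l < L) \sum_n v' l n * Phi F n x.
    rewrite (sig_big_dep xpredT (fun _ => xpredT)
      (fun (l : 'I_L) (n : 'I_l.+1.*2.+1) => v' l n * Phi F n x)) /=.
    by apply: eq_bigr => -[l n] _.
  have -> : \sum_(b : frequency) (c' b * Y (tagged b) x)^* =
      \sum_(l < L) \sum_(j < l.+1.*2.+1) c l j * (Y j x)^*.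
    rewrite (sig_big_dep xpredT (fun _ => xpredT)
      (fun (l : 'I_L) (j : 'I_l.+1.*2.+1) => c l j * (Y j x)^*)) /=.
    by apply: eq_bigr => b _; rewrite rmorphM /= conjCK.
  apply: eq_bigr => l _; rewrite /Phi.
  under eq_bigr do rewrite mulr_sumr.
  rewrite exchange_big; apply: eq_bigr => j _; rewrite mulr_suml.
  by apply: eq_bigr => n _; rewrite mulrA.
under eq_Rintegral do rewrite E.
rewrite (cintegral_orthonormal_sqr c' _ frequency_orthonormal); last first.
  by move=> b; exact: harmonic_span_Y.
have -> : \sum_(b : frequency) normc (c' b) ^+ 2 =
    \sum_(l < L) \sum_(j < l.+1.*2.+1) normc (c l j) ^+ 2.
  rewrite (sig_big_dep xpredT (fun _ => xpredT)
    (fun (l : 'I_L) (j : 'I_l.+1.*2.+1) => normc (c l j) ^+ 2)) /=.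
  by apply: eq_bigr => b _; rewrite normc_conj.
have -> : \sum_a normc (v a) ^+ 2 = \sum_(l < L) \sum_n normc (v' l n) ^+ 2.
  rewrite (sig_big_dep xpredT (fun _ => xpredT)
    (fun (l : 'I_L) (j : 'I_l.+1.*2.+1) => normc (v' l j) ^+ 2)) /=.
  by apply: eq_bigr => -[l n] _.
rewrite mulr_sumr; apply: ler_sum => l _; apply: le_trans (sum_normc_mul_le _ _) _.
by rewrite ler_wpM2r ?opnorm_inv_sqr_le// sumr_ge0// => n _; exact: sqr_ge0.
Qed.

(** Each of the [L] degrees contributes at most the squared norm of F^-1 times (2l + 1)/(4 pi) <= l
    <= L. *)
Lemma sum_normc_Phi x : sphere x ->
  \sum_(a : frequency) normc (PhiL a x) ^+ 2 <= inverse_norm ^+ 2 * L%:R ^+ 2.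
Proof.
move=> sx; have := sum_frequency (fun l (n : 'I_l.*2.+1) => normc (Phi F n x) ^+ 2).
rewrite /PhiL => <-; rewrite big_add1 /= big_mkord.
apply: le_trans (_ : \sum_(l < L) inverse_norm ^+ 2 * L%:R <= _); last first.
  by rewrite sumr_const card_ord -[leLHS]mulr_natr -mulrA -expr2.
apply: ler_sum => l _.
have := sum_normc_mulmx_le (invmx (F l.+1)) (\col_j (Y j x)^*).
rewrite [X in _ <= _ * X](eq_bigr (fun j => normc (@Y R l.+1 j x) ^+ 2)); last first.
  by move=> j _; rewrite mxE normc_conj.
rewrite sum_normc_Y// (eq_bigr (fun n : 'I_l.+1.*2.+1 => normc (Phi F n x) ^+ 2)); last first.
  by move=> n _; congr (normc _ ^+ 2); apply: eq_bigr => j _; rewrite mxE.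
move=> h; apply: le_trans h _; apply: ler_pM; rewrite ?sqr_ge0 ?opnorm_inv_sqr_le//.
  by rewrite divr_ge0// mulr_ge0// pi_ge0.
by apply: le_trans (quarter_pi_le l) _; rewrite ler_nat.
Qed.

Local Notation B := (observation_bound mu fe D nu d1 rad).

(** Centring decreases the second moment, and [second_moment_span_le] replaces the law of the
    observation by B times surface measure. *)
Let HG (v : frequency -> R[i]) : moment2 Pr (fun w => \sum_a v a * W 0 a w) <=
  (B * inverse_norm ^+ 2) * \sum_a normc (v a) ^+ 2.
Proof.
pose g x := \sum_a v a * PhiL a x.
have sg : harmonic_span g by apply: harmonic_span_sum => a; exact: harmonic_spanZ.
have bg : bounded_rv (fun w => g (Z 0 w)) by exact: span_bounded.
have Eg : E (fun w => g (Z 0 w)) = \sum_a v a * muL a.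
  rewrite cexp_sum => [|a]; last exact: bounded_rvZ.
  by apply: eq_bigr => a _; rewrite cexpZ// cexp_Phi.
have -> : (fun w => \sum_a v a * W 0 a w) = (fun w => g (Z 0 w) - E (fun w => g (Z 0 w))).
  by apply/funext => w; rewrite Eg -sumrB; apply: eq_bigr => a _; rewrite mulrBr.
apply: le_trans (moment2_center Pr bg) _.
have HB := obs_series_le nu0 hF hf hs.
have B0 : 0 <= B by have := HB 0%N; rewrite big_ord0.
have := second_moment_span_le dfe df heps hX deps dX indep hD HB 0 sg.
rewrite /cexp cintegral_real /= => h; apply: le_trans h _.
by rewrite -mulrA ler_wpM2l// integral_lin_Phi.
Qed.

Let Htr : \sum_a moment2 Pr (W 0 a) <= inverse_norm ^+ 2 * L%:R ^+ 2.
Proof.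
apply: le_trans (_ : \sum_a moment2 Pr (fun w => PhiL a (Z 0 w)) <= _).
  apply: ler_sum => a _; have := moment2_center Pr (bPhiL 0 a).
  by rewrite (cexp_Phi 0 (tagged a)).
have SZ w : sphere (Z 0 w).
  by apply: sphere_SO3; [case: (heps 0) => _; exact|case: (hX 0) => _; exact].
rewrite -lecR rmorph_sum.
have bb a : bounded_rv (fun w => PhiL a (Z 0 w) * (PhiL a (Z 0 w))^*).
  by apply: bounded_rvM => //; exact: bounded_rv_conj.
rewrite (eq_bigr _ (fun a _ => moment2E Pr (fun w => PhiL a (Z 0 w)))) -cexp_sum//.
rewrite (@cexp_ext _ _ _ _ _ (fun w => (\sum_a normc (PhiL a (Z 0 w)) ^+ 2)%:C)); last first.
  by move=> w; rewrite rmorph_sum; apply: eq_bigr => a _; rewrite mulc_conj.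
rewrite /cexp cintegral_real lecR.
have <- : \int[Pr]_w (inverse_norm ^+ 2 * L%:R ^+ 2) = inverse_norm ^+ 2 * L%:R ^+ 2.
  by have := cexp_cst Pr (inverse_norm ^+ 2 * L%:R ^+ 2)%:C; rewrite /cexp cintegral_real => /complexI.
apply: le_Rintegral => //.
- have := bounded_rv_sum (index_enum frequency) bb => /(bounded_rv_cintegrable Pr)[+ _].
  apply: eq_integrable => // w _ /=; congr EFin.
  by rewrite Re_sum; apply: eq_bigr => a _; rewrite mulc_conj.
- by have [] := bounded_rv_cintegrable Pr (bounded_rv_cst (inverse_norm ^+ 2 * L%:R ^+ 2)%:C : bounded_rv (fun _ : Om => _)).
- by move=> w _; exact: sum_normc_Phi.
Qed.

Lemma T_stat_ustat N w : T_stat F N (fun i => Z i w) L = ustat W muL N w.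
Proof.
rewrite /T_stat (sum_frequency (fun l (n : 'I_l.*2.+1) => 2 / (N%:R * (N%:R - 1)) *
  \sum_(i1 < N) \sum_(i2 < N | (i1 < i2)%N) Phi F n (Z i1 w) * (Phi F n (Z i2 w))^*)).
rewrite -mulr_sumr; congr (_ * _); rewrite exchange_big; apply: eq_bigr => i _.
rewrite exchange_big; apply: eq_bigr => j _; apply: eq_bigr => a _.
by rewrite /W !subrK.
Qed.

Lemma T_stat_bounded N : bounded_rv (fun w => T_stat F N (fun i => Z i w) L).
Proof.
rewrite (_ : (fun w => _) = fun w => ustat W muL N w); last by apply/funext => w; exact: T_stat_ustat.
apply: bounded_rvZ; apply: bounded_rv_sum => i.
rewrite (_ : (fun w => _) = fun w => \sum_(j < N) if (i < j)%N then
  \sum_a (W i a w + muL a) * (W j a w + muL a)^* else 0); last first.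
  by apply/funext => w; rewrite big_mkcond.
apply: bounded_rv_sum => j; case: (i < j)%N; last exact: bounded_rv_cst.
have bWmu k a : bounded_rv (fun w => W k a w + muL a).
  by apply: bounded_rvD => //; exact: bounded_rv_cst.
by apply: bounded_rv_sum => a; apply: bounded_rvM => //; exact: bounded_rv_conj.
Qed.

Lemma observation_bound_gt0 : 0 < B.
Proof.
have p4 : 0 < 4 * pi :> R by rewrite mulr_gt0// pi_gt0.
rewrite /observation_bound ltr_wpDl ?divr_ge0 ?opnorm_ge0 ?(ltW p4)// divr_gt0//.
apply: ltr_pwDl; last first.
  by rewrite mulr_ge0 ?sqr_ge0// addr_ge0// invr_ge0 mulr_ge0// ltW.
by rewrite ltr_pwDl ?sqr_ge0// invr_gt0.
Qed.

Lemma T_stat_variance N : (1 < N)%N ->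
  moment2 Pr (fun w => T_stat F N (fun i => Z i w) L - (\sum_(1 <= l < L.+1) level_energy f l)%:C) <=
  32 * (B * inverse_norm ^+ 2 * (inverse_norm ^+ 2 * L%:R ^+ 2)) / N%:R ^+ 2 +
  128 * (B * inverse_norm ^+ 2 * \sum_(1 <= l < L.+1) level_energy f l) / N%:R.
Proof.
move=> N1; rewrite (sum_frequency (fun l (n : 'I_l.*2.+1) => normc (fhat n) ^+ 2)).
rewrite (_ : (fun w => _) = fun w => ustat W muL N w - (\sum_a normc (muL a) ^+ 2)%:C); last first.
  by apply/funext => w; rewrite T_stat_ustat.
have in0 : 0 < inverse_norm by rewrite mulr_gt0 ?invr_gt0// powR_gt0 ?ltr0n.
have lam0 : 0 < B * inverse_norm ^+ 2 by rewrite mulr_gt0 ?observation_bound_gt0 ?exprn_gt0.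
have locW i a : local_rv eps X i (W i a) := span_rv i (span_W a).
exact: (ustat_variance (local_rv_bounded heps hX) (local_rv_cst eps X) (@local_rvM _ _ _ eps X)
  (@local_rv_conj _ _ _ eps X) (cexp_local_prod dfe df heps hX deps dX indep)
  muL locW EW EG lam0 HG Htr N1).
Qed.

End test_statistic.

(** * Error probabilities *)

Section resolution_asymptotics.
Local Open Scope ring_scope.
Context {R : realType}.

Lemma near_ln (c : R) : \forall N \near \oo, c <= ln (N%:R : R).
Proof.
near=> N; have NC : expR c <= N%:R by near: N; exact: nbhs_infty_ger.
by rewrite -[c]expRK ler_ln ?posrE ?expR_gt0// (lt_le_trans (expR_gt0 c)).
Unshelve. all: by end_near. Qed.

Lemma near_loglog (c : R) : \forall N \near \oo, c <= loglog R N.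
Proof.
near=> N; have NC : expR c <= ln (N%:R : R) by near: N; exact: near_ln.
by rewrite /loglog -[c]expRK ler_ln ?posrE ?expR_gt0// (lt_le_trans (expR_gt0 c)).
Unshelve. all: by end_near. Qed.

Lemma near_loglog_le (c : R) : 0 < c ->
  \forall N \near \oo, loglog R N <= c * ln (N%:R : R).
Proof.
move=> c0; have c20 : 0 < c / 2 by rewrite divr_gt0.
near=> N; have y0 : 1 <= ln (N%:R : R) by near: N; exact: near_ln.
have yc : - ln (c / 2) / (c / 2) <= ln (N%:R : R) by near: N; exact: near_ln.
have {}y0 : 0 < ln (N%:R : R) by exact: lt_le_trans y0.
move: yc; rewrite ler_pdivrMr// => yc.
(* The inequality ln y < y at y = (c / 2) ln N; the other half of [c] absorbs -ln(c / 2). *)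
have := @ln_sublinear R (c / 2 * ln N%:R); rewrite mulr_gt0// => /(_ isT).
rewrite lnM ?posrE// -/(loglog R N); lra.
Unshelve. all: by end_near. Qed.

Lemma ceil_abs (x : R) : 0 <= x ->
  x <= (`|Num.ceil x|%N)%:R /\ (`|Num.ceil x|%N)%:R < x + 1.
Proof.
move=> x0; rewrite natr_absz ger0_norm; last by rewrite ceil_ge0 (lt_le_trans _ x0).
by have /andP[h1 h2] := ceil_itv x; rewrite intrB in h1; rewrite h2 -ltrBlDr.
Qed.

Lemma ln2_gt0 : 0 < ln (2 : R).
Proof. by rewrite ln_gt0// ltr1n. Qed.

(** There are at most j_max + 1 resolutions and j_max < ln N / ln 2 + 1; the remaining 2 is absorbed
    because ln N >= 1. *)
Lemma near_size_resolutions : \forall N \near \oo,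
  (size (resolutions R N))%:R <= ((ln 2)^-1 + 2) * ln (N%:R : R).
Proof.
have l2 := ln2_gt0.
near=> N; have y1 : 1 <= ln (N%:R : R) by near: N; exact: near_ln.
have l1 : 1 <= loglog R N by near: N; exact: near_loglog.
have ly : loglog R N <= 2^-1 * ln (N%:R : R) by near: N; exact: near_loglog_le.
have l0 : 0 < loglog R N by exact: lt_le_trans l1.
have N0 : 0 < N%:R :> R.
  by rewrite ltr0n lt0n; apply/eqP => N0; move: y1; rewrite N0 ln0// ler10.
have lll : ln (loglog R N) < loglog R N by exact: ln_sublinear.
have lll0 : 0 <= ln (loglog R N) by exact: ln_ge0.
rewrite size_map size_iota.
have E : log2 (N%:R * loglog R N `^ (- (3 / 2))) =
    (ln N%:R - 3 / 2 * ln (loglog R N)) / ln 2.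
  by rewrite /log2 lnM ?posrE ?powR_gt0// ln_powR mulNr.
have [|_ h] := @ceil_abs (log2 (N%:R * loglog R N `^ (- (3 / 2)))).
  by rewrite E divr_ge0 ?(ltW l2)//; lra.
apply: le_trans (_ : (j_max R N).+1%:R <= _); first by rewrite ler_nat leq_subr.
rewrite -natr1; apply: le_trans (lerD (ltW h) (lexx 1)) _; rewrite E.
have : (ln N%:R - 3 / 2 * ln (loglog R N)) / ln 2 <= (ln 2)^-1 * ln N%:R.
  by rewrite mulrC ler_pM2l ?invr_gt0//; lra.
move=> h1; rewrite mulrDl; lra.
Unshelve. all: by end_near. Qed.

Variables s nu : R.
Hypothesis hs : 1 <= s.
Hypothesis hnu : 0 < nu.

Lemma resolutions_gt0 N L : L \in resolutions R N -> (0 < L)%N.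
Proof. by move=> /mapP[j _ ->]; rewrite expn_gt0. Qed.

(* The resolution is the largest power of two below [(N / sqrt(log log N))^p], with
   [p = 1 / (2 s + 2 nu + 1)]. *)
Lemma near_resolution : \forall N \near \oo, exists2 L, L \in resolutions R N &
  t_sq nu N L <= psi_ad s nu N /\
  L%:R `^ (- (2 * s)) <= 2 `^ (2 * s) * psi_ad s nu N.
Proof.
have l2 := ln2_gt0; have l22 : ln (2 : R) < 2 by exact: ln_sublinear.
pose q := 2 * s + 2 * nu + 1; pose p := q^-1.
have q3 : 3 <= q by rewrite /q; move: hs hnu; lra.
have q0 : 0 < q by exact: lt_le_trans q3.
have p0 : 0 < p by rewrite invr_gt0.
have p1 : p <= 3^-1 by rewrite lef_pV2 ?posrE.
near=> N.
(* With the bound p / 4 on log log N, this leaves ln M room for ln(log log N) + 2 ln 2, so that the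
   integer part of log2 M is not below j_min. *)
have y8 : 8 / p <= ln (N%:R : R) by near: N; exact: near_ln.
have y1 : 1 <= ln (N%:R : R) by near: N; exact: near_ln.
have l1 : 1 <= loglog R N by near: N; exact: near_loglog.
have ly : loglog R N <= p / 4 * ln (N%:R : R).
  by near: N; apply: near_loglog_le; rewrite divr_gt0.
have l0 : 0 < loglog R N by exact: lt_le_trans l1.
have N0 : 0 < N%:R :> R.
  by rewrite ltr0n lt0n; apply/eqP => N0; move: y1; rewrite N0 ln0// ler10.
have lll : ln (loglog R N) < loglog R N by exact: ln_sublinear.
have lll0 : 0 <= ln (loglog R N) by exact: ln_ge0.
have s0 : 0 < Num.sqrt (loglog R N) by rewrite sqrtr_gt0.
pose V := N%:R / Num.sqrt (loglog R N); have V0 : 0 < V by rewrite divr_gt0.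
have lnV : ln V = ln N%:R - ln (loglog R N) / 2.
  by rewrite /V ln_div ?posrE// -powR12_sqrt ?(ltW l0)// ln_powR mulrC.
pose M := V `^ p; have M0 : 0 < M by exact: powR_gt0.
have lnME : ln M = p * ln V by rewrite ln_powR.
have jminE : log2 (loglog R N) = ln (loglog R N) / ln 2 by [].
have jmaxE : log2 (N%:R * loglog R N `^ (- (3 / 2))) =
    (ln N%:R - 3 / 2 * ln (loglog R N)) / ln 2.
  by rewrite /log2 lnM ?posrE ?powR_gt0// ln_powR mulNr.
move: y8 ly; rewrite ler_pdivrMr//.
move: (ln N%:R) (ln (loglog R N)) y1 lll lll0 lnV jminE jmaxE
  => y z y1 zl z0 lnV jminE jmaxE y8 ly.
have yp : p * y <= 3^-1 * y by rewrite ler_pM2r//; lra.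
have zp : p * z <= 3^-1 * z by exact: ler_wpM2r.
have c1 : z + 2 * ln 2 <= ln M by rewrite lnME lnV mulrBr; nra.
have c2 : ln M <= y - 3 / 2 * z by rewrite lnME lnV mulrBr; nra.
have lM0 : 0 <= ln M by apply: le_trans c1; rewrite addr_ge0 ?mulr_ge0 ?(ltW l2).
have x0 : 0 <= ln M / ln 2 by rewrite divr_ge0 ?(ltW l2).
have /andP[jx xj] := truncn_itv x0; set j := Num.trunc _ in jx xj.
have psiE : psi_ad s nu N = M `^ (- (2 * s)).
  by rewrite /psi_ad /M -/V -powRrM; congr (_ `^ _); exact: mulrC.
have L0 : 0 < (2 ^ j)%:R :> R by rewrite ltr0n expn_gt0.
have lnL : ln (2 ^ j)%:R = j%:R * ln 2 :> R by rewrite natrX -powR_mulrn// ln_powR.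
exists (2 ^ j)%N.
  apply: map_f; rewrite mem_index_iota; apply/andP; split.
    rewrite -ltnS -(ltr_nat R); apply: lt_trans xj.
    have [|_ /lt_le_trans] := @ceil_abs (log2 (loglog R N)).
      by rewrite jminE divr_ge0 ?(ltW l2).
    apply; rewrite jminE ler_pdivlMr// mulrDl divfK ?gt_eqF// mul1r.
    by apply: le_trans c1; rewrite lerD2l ler_peMl ?(ltW l2)// ler1n.
  rewrite ltnS -(ler_nat R); apply: le_trans jx _.
  have [|h _] := @ceil_abs (log2 (N%:R * loglog R N `^ (- (3 / 2)))).
    by rewrite jmaxE divr_ge0 ?(ltW l2)// (le_trans lM0).
  by apply: le_trans h; rewrite jmaxE ler_pM2r ?invr_gt0.
have jM : (2 ^ j)%:R <= M by rewrite -ler_ln ?posrE// lnL -ler_pdivlMr.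
have Mj : M / 2 <= (2 ^ j)%:R.
  rewrite ler_pdivrMr// -ler_ln ?posrE ?mulr_gt0// lnM ?posrE// lnL.
  by move: (ltW xj); rewrite ler_pdivrMr// -natr1 mulrDl mul1r.
(* Since t_L^2 = L^(2 nu + 1) / V, the bound L <= M gives t_L^2 <= M^(2 nu + 1 - q) = M^(-2 s),
   which is [psi_ad]. *)
have VE : V^-1 = M `^ (- q) by rewrite powRN -powRrM mulVf ?gt_eqF// powRr1 ?(ltW V0).
split.
  rewrite psiE /t_sq -mulrA (_ : Num.sqrt _ / _ = V^-1); last by rewrite invf_div.
  rewrite (_ : - (2 * s) = (2 * nu + 1) + - q); last by rewrite /q; ring.
  rewrite [leRHS]powRD; last by rewrite (gt_eqF M0) implybT.
  rewrite VE ler_pM2r ?powR_gt0//; apply: ge0_ler_powR; rewrite ?nnegrE ?(ltW L0) ?(ltW M0)//.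
  by rewrite addr_ge0// mulr_ge0// ltW.
rewrite psiE !powRN ler_pdivlMr ?powR_gt0// mulrC ler_pdivrMr ?powR_gt0//.
rewrite -powRM ?(ltW L0)//; apply: ge0_ler_powR; rewrite ?nnegrE ?mulr_ge0 ?(ltW M0) ?(ltW L0)//.
  by rewrite (le_trans _ hs).
by rewrite mulrC -ler_pdivrMr.
Unshelve. all: by end_near. Qed.

End resolution_asymptotics.

(** * Measurability of the rejection region and the union bound *)

Section rejection_region.
Local Open Scope ring_scope.
Context {R : realType} {d : measure_display} {Om : measurableType d}.
Variable Pr : probability Om R.

Lemma measurable_gt_cst (h : Om -> R) (c : R) : measurable_fun setT h ->
  measurable [set w | c < h w].
Proof.
move=> mh; have := mh measurableT _ (measurable_itv `]c, +oo[); rewrite setTI.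
by congr measurable; apply/seteqP; split => w /=; rewrite in_itv/= andbT.
Qed.

Lemma measurable_bigmax (r : seq nat) (g : nat -> Om -> R) :
  (forall L, measurable_fun setT (g L)) ->
  measurable_fun setT (fun w => \big[Num.max/0]_(L <- r) g L w).
Proof.
move=> mg; elim: r => [|L r IH].
  by under eq_fun do rewrite big_nil; exact: measurable_cst.
by under eq_fun do rewrite big_cons; exact: measurable_maxr.
Qed.

(** The union bound. Nonnegativity of [c] keeps the starting value 0 of the maximum from exceeding
    it. *)
Lemma probability_bigmax_gt (r : seq nat) (g : nat -> Om -> R) (c : R) : 0 <= c ->
  (forall L, measurable_fun setT (g L)) ->
  fine (Pr [set w | c < \big[Num.max/0]_(L <- r) g L w]) <=
  \sum_(L <- r) fine (Pr [set w | c < g L w]).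
Proof.
move=> c0 mg; elim: r => [|L r IH].
  rewrite (_ : [set _ | _] = set0) ?measure0 ?big_nil//.
  by rewrite -subset0 => w /=; rewrite big_nil ltNge c0.
rewrite big_cons; apply: le_trans (lerD (lexx _) IH).
set A := [set w | c < g L w]; set B := [set w | c < \big[Num.max/0]_(L0 <- r) g L0 w].
have mA : measurable A by exact: measurable_gt_cst.
have mB : measurable B by apply: measurable_gt_cst; exact: measurable_bigmax.
rewrite (_ : [set _ | _] = A `|` B); last first.
  apply/seteqP; split => w /=; rewrite big_cons lt_max; first by move=> /orP.
  by move=> h; apply/orP.
rewrite -fineD ?fin_num_measure// fine_le ?fin_numD ?fin_num_measure ?measureU2//.
by exact: measurableU.
Qed.

End rejection_region.

(** * Errors of the first and second kind *)

Section error_bounds.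
Local Open Scope complex_scope.
Local Open Scope ring_scope.
Context {R : realType} {d : measure_display} {Om : measurableType d}.
Variables (mu : probability 'M[R]_3 R) (fe : 'M[R]_3 -> R).
Variables (eps : nat -> Om -> 'M[R]_3) (X : nat -> Om -> 'cV[R]_3).
Hypothesis heps : forall i, measurable_fun setT (eps i) /\ forall w, SO3 (eps i w).
Hypothesis hX : forall i, measurable_fun setT (X i) /\ forall w, sphere (X i w).
Variable D : forall l : nat, 'M[R]_3 -> 'M[R[i]]_l.*2.+1.
Hypothesis hD : rotational_harmonics D.
Local Notation Z i w := (eps i w *m X i w).
Local Notation F := (rot_fourier mu D fe).
Variables (nu K0 : R).
Hypothesis K00 : 0 < K0.
Local Notation kappa := (Num.sqrt (2 / K0)).
Local Notation T N L w := (T_stat F N (fun i => Z i w) L).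
Local Notation D_N N w := (D_stat F nu K0 N (fun i => Z i w)).

Lemma measurable_T_stat N L : measurable_fun setT (fun w => normc (T N L w)).
Proof. by apply: measurable_normc; have [] := T_stat_bounded mu fe (@f_unif R) heps hX hD L N. Qed.

Lemma measurable_T_ratio N L : measurable_fun setT (fun w => normc (T N L w) / t_sq nu N L).
Proof. by apply: measurable_funM; [exact: measurable_T_stat|exact: measurable_cst]. Qed.

Lemma D_N_reject N : [set w | D_N N w = 1%N] =
  [set w | kappa < \big[Num.max/0]_(L <- resolutions R N) (normc (T N L w) / t_sq nu N L)].
Proof. by apply/seteqP; split => w /=; rewrite /D_stat; case: (_ < _). Qed.

Lemma D_N_accept N : [set w | D_N N w = 0%N] = ~` [set w | D_N N w = 1%N].
Proof. by apply/seteqP; split => w /=; rewrite /D_stat; case: (_ < _). Qed.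

Lemma measurable_D_N N k : measurable [set w | D_N N w = k].
Proof.
have m1 : measurable [set w | D_N N w = 1%N].
  rewrite D_N_reject; apply: measurable_gt_cst; apply: measurable_bigmax.
  exact: measurable_T_ratio.
case: k => [|[//|k]]; first by rewrite D_N_accept; exact: measurableC.
rewrite (_ : [set _ | _] = set0)//; rewrite -subset0 => w /=.
by rewrite /D_stat; case: (_ < _).
Qed.

Lemma t_sq_gt0 N L : (0 < N)%N -> (0 < L)%N -> 0 < loglog R N -> 0 < t_sq nu N L.
Proof.
by move=> N0 L0 l0; rewrite divr_gt0 ?ltr0n// mulr_gt0 ?sqrtr_gt0// powR_gt0 ?ltr0n.
Qed.

Lemma type_one (Pr : probability Om R) : deviation_constant Pr F nu (fun i w => Z i w) K0 ->
  exists2 K1 : R, 0 < K1 & \forall N \near \oo,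
    fine (Pr [set w | D_N N w = 1%N]) <= K1 / ln N%:R.
Proof.
move=> [_ [K1 K10 H]]; exists (((ln 2)^-1 + 2) * K1).
  by rewrite mulr_gt0// addr_gt0// invr_gt0 ln2_gt0.
near=> N.
have y1 : 1 <= ln (N%:R : R) by near: N; exact: near_ln.
have l1 : 1 <= loglog R N by near: N; exact: near_loglog.
have y0 : 0 < ln (N%:R : R) by exact: lt_le_trans y1.
have l0 : 0 < loglog R N by exact: lt_le_trans l1.
have N0 : (0 < N)%N by rewrite lt0n; apply/eqP => N0; move: y1; rewrite N0 ln0// ler10.
have sz : (size (resolutions R N))%:R <= ((ln 2)^-1 + 2) * ln (N%:R : R).
  by near: N; exact: near_size_resolutions.
have HL : forall L, L \in resolutions R N ->
    fine (Pr [set w | kappa < normc (T N L w) / t_sq nu N L]) <= K1 / ln N%:R ^+ 2.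
  have : forall L, L \in resolutions R N ->
      let u := Num.sqrt (2 * K0^-1 * loglog R N) in
      (Pr [set w | (L%:R `^ (2 * nu + 1) * u / N%:R < normc (T N L w))%R]
         <= (K1 * expR (- K0 * u ^+ 2))%:E)%E by near: N; exact: H.
  move=> h L Lr; have := h L Lr; have L0 := resolutions_gt0 Lr.
  have k0 : 0 <= 2 * K0^-1 by rewrite mulr_ge0// invr_ge0 ltW.
  rewrite /= sqr_sqrtr; last by rewrite mulr_ge0// ltW.
  have -> : K1 * expR (- K0 * (2 * K0^-1 * loglog R N)) = K1 / ln N%:R ^+ 2.
    congr (_ * _); rewrite (_ : - K0 * _ = - (2%:R * loglog R N)); last first.
      by field; rewrite gt_eqF.
    by rewrite expRN mulr_natl mulr2n expRD -expr2 /loglog lnK ?posrE.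
  (* The deviation level L^(2 nu + 1) u / N is kappa t_L^2, so both events coincide. *)
  have -> : [set w | L%:R `^ (2 * nu + 1) * Num.sqrt (2 * K0^-1 * loglog R N) / N%:R <
      normc (T N L w)] = [set w | kappa < normc (T N L w) / t_sq nu N L].
    have -> : L%:R `^ (2 * nu + 1) * Num.sqrt (2 * K0^-1 * loglog R N) / N%:R =
        kappa * t_sq nu N L by rewrite sqrtrM// /t_sq; ring.
    by apply/seteqP; split => w /=; rewrite ltr_pdivlMr ?t_sq_gt0.
  have mA : measurable [set w | kappa < normc (T N L w) / t_sq nu N L].
    by apply: measurable_gt_cst; exact: measurable_T_ratio.
  by rewrite -lee_fin fineK ?fin_num_measure.
rewrite D_N_reject; apply: le_trans (probability_bigmax_gt _ _ _ _) _.
- exact: sqrtr_ge0.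
- by move=> L; exact: measurable_T_ratio.
rewrite big_seq; apply: le_trans (ler_sum _ HL) _; rewrite -big_seq big_const_seq count_predT.
rewrite iter_addr_0 -[leLHS]mulr_natl.
apply: le_trans (ler_wpM2r _ sz) _; first by rewrite divr_ge0 ?sqr_ge0// ltW.
rewrite le_eqVlt; apply/orP; left; apply/eqP.
by move: (_^-1 + 2) (ln N%:R) y0 => c y y0; field; rewrite gt_eqF.
Unshelve. all: by end_near. Qed.

Variables (d0 d1 s rad C : R).
Hypothesis nu0 : 0 < nu.
Hypothesis d00 : 0 < d0.
Hypothesis hF : ordinary_smooth F nu d0 d1.
Hypothesis hs : 1 <= s.
Hypothesis hC : kappa + ((4 * pi)^-1 + rad ^+ 2) * 2 `^ (2 * s) < C.
Local Notation B := (observation_bound mu fe D nu d1 rad).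
(** What remains of [C] after the Sobolev bias: at the chosen resolution m >= C' psi >= C' t_L^2. *)
Let C' := C - ((4 * pi)^-1 + rad ^+ 2) * 2 `^ (2 * s).

(** The variance bound with m / C' in place of t, over the squared gap (1 - kappa / C')^2 m^2, both
    in units of m^2. *)
Definition type_two_constant : R :=
  (32 * B * d0^-1 ^+ 4 / C' ^+ 2 + 128 * B * d0^-1 ^+ 2 / C') / (1 - kappa / C') ^+ 2.

Let B0 : 0 < B. Proof. exact: observation_bound_gt0. Qed.

Let kC : kappa < C'. Proof. by rewrite ltrBrDr. Qed.

Let C'0 : 0 < C'. Proof. exact: le_lt_trans (sqrtr_ge0 _) kC. Qed.

Let delta0 : 0 < 1 - kappa / C'. Proof. by rewrite subr_gt0 ltr_pdivrMr// mul1r. Qed.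

Lemma type_two_constant_gt0 : 0 < type_two_constant.
Proof.
have d10 : 0 < d0^-1 by rewrite invr_gt0.
by rewrite divr_gt0 ?exprn_gt0// addr_gt0// divr_gt0 ?exprn_gt0// !mulr_gt0 ?exprn_gt0.
Qed.

(** From t <= m / C' the gap m - kappa t is at least (1 - kappa / C') m, and both variance terms are
    at most a constant times m^2 / q; for the first, q >= 1 gives (t / q)^2 <= (m / C')^2 / q. *)
Lemma variance_ratio (psi t q m V : R) : 0 < t -> t <= psi -> 1 <= q -> C' * psi <= m ->
  V <= 32 * B * d0^-1 ^+ 4 * (t / q) ^+ 2 + 128 * B * d0^-1 ^+ 2 * (t / q) * m ->
  V / (m - kappa * t) ^+ 2 <= type_two_constant / q /\ 0 < m - kappa * t.
Proof.
move=> t0 tpsi q1 psim HV; have q0 : 0 < q by exact: lt_le_trans q1.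
have tm : t <= m / C'.
  by rewrite ler_pdivlMr// mulrC (le_trans _ psim)// ler_pM2l.
have m0 : 0 < m by move: (lt_le_trans t0 tm); rewrite pmulr_lgt0// invr_gt0.
have gap : (1 - kappa / C') * m <= m - kappa * t.
  rewrite mulrBl mul1r lerD2l lerN2 -mulrA [C'^-1 * m]mulrC ler_wpM2l ?sqrtr_ge0//.
have gap0 : 0 < (1 - kappa / C') * m by rewrite mulr_gt0.
have g0 : 0 < m - kappa * t by exact: lt_le_trans gap.
split=> //; rewrite ler_pdivrMr ?exprn_gt0//.
have d10 : 0 < d0^-1 by rewrite invr_gt0.
set a := 32 * B * d0^-1 ^+ 4 in HV; set b := 128 * B * d0^-1 ^+ 2 in HV.
have a0 : 0 < a by rewrite !mulr_gt0 ?exprn_gt0.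
have b0 : 0 < b by rewrite !mulr_gt0 ?exprn_gt0.
apply: le_trans (_ : type_two_constant / q * ((1 - kappa / C') * m) ^+ 2 <= _); last first.
  apply: (ler_wpM2l (ltW (divr_gt0 type_two_constant_gt0 q0))).
  by rewrite ler_pXn2r ?nnegrE ?(ltW gap0) ?(ltW g0).
have -> : type_two_constant / q * ((1 - kappa / C') * m) ^+ 2 =
    a * ((m / C') ^+ 2 / q) + b * (m / C' / q) * m.
  rewrite /type_two_constant -/a -/b; move: delta0; move: (1 - _) => D0 D00.
  by field; rewrite !gt_eqF.
apply: le_trans HV _; apply: lerD.
  rewrite ler_pM2l// expr_div_n ler_pM ?sqr_ge0 ?invr_ge0 ?sqr_ge0//.
  - by rewrite ler_pXn2r ?nnegrE ?divr_ge0 ?(ltW t0) ?(ltW m0) ?(ltW C'0).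
  - by rewrite lef_pV2 ?posrE ?exprn_gt0// expr2 ler_peMl ?(ltW q0).
by rewrite ler_pM2r// ler_pM2l// ler_pM2r ?invr_gt0.
Qed.

Variables (Pr : probability Om R) (f : 'cV[R]_3 -> R).
Hypothesis dfe : probability_density mu SO3 fe.
Hypothesis deps : forall i, has_density Pr (eps i) mu SO3 fe.
Hypothesis dX : forall i, has_density Pr (X i) (@surface R) sphere f.
Hypothesis indep : mutually_independent Pr (fun k : nat + nat =>
  match k with
  | inl i => preimage_set_system setT (eps i) measurable
  | inr i => preimage_set_system setT (X i) measurable
  end).

Lemma type_two N L : (1 < N)%N -> 1 <= loglog R N -> L \in resolutions R N ->
  t_sq nu N L <= psi_ad s nu N ->
  L%:R `^ (- (2 * s)) <= 2 `^ (2 * s) * psi_ad s nu N ->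
  alternatives s rad (C * psi_ad s nu N) f ->
  fine (Pr [set w | D_N N w = 0%N]) <= type_two_constant / Num.sqrt (loglog R N).
Proof.
move=> N1 l1 Lr tpsi Lpsi [hf rho].
have [df _ _] := hf; have L0 := resolutions_gt0 Lr; have N0 : (0 < N)%N by exact: ltnW.
have l0 : 0 < loglog R N by exact: lt_le_trans l1.
set q := Num.sqrt (loglog R N); have q1 : 1 <= q by rewrite -sqrtr1 ler_wsqrtr.
have q0 : 0 < q by exact: lt_le_trans q1.
have t0 := t_sq_gt0 N0 L0 l0; set t := t_sq nu N L in t0 tpsi *.
pose m : R := \sum_(1 <= l < L.+1) level_energy f l.
set psi := psi_ad s nu N in tpsi Lpsi rho *.
have S0 : 0 <= (4 * pi)^-1 + rad ^+ 2 :> R.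
  by rewrite addr_ge0 ?sqr_ge0// invr_ge0 mulr_ge0// pi_ge0.
have psim : C' * psi <= m.
  have := le_trans rho (sobolev_bias hf hs L0); rewrite -/m lee_fin => h1.
  rewrite mulrBl lerBlDr (le_trans h1)// lerD2l.
  by rewrite mulrC -mulrA ler_wpM2l.
have HV := T_stat_variance dfe df heps hX deps dX indep hD nu0 d00 hF hf hs L0 N1.
rewrite -/m in HV.
set V := moment2 Pr _ in HV.
have [|hr g0] := @variance_ratio psi t q m V t0 tpsi q1 psim.
  have NR : 0 < N%:R :> R by rewrite ltr0n.
  have LR : 1 <= L%:R :> R by rewrite ler1n.
  have m0 : 0 <= m by apply: sumr_ge0 => l _; exact: level_energy_ge0.
  have tq : t / q = (L%:R `^ nu) ^+ 2 * L%:R / N%:R.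
    rewrite /t /t_sq -/q (_ : 2 * nu + 1 = nu + nu + 1); last by ring.
    rewrite !powRD; try by rewrite (gt_eqF (lt_le_trans ltr01 LR)) implybT.
    by rewrite powRr1// mulrAC mulfK ?gt_eqF.
  apply: le_trans HV _; rewrite tq /inverse_norm; apply: lerD.
    rewrite le_eqVlt; apply/orP; left; apply/eqP.
    by move: (N%:R : R) NR (_ `^ nu) => n n0 a; field; rewrite !gt_eqF.
  (* The linear variance term carries L^(2 nu) where t / q carries L^(2 nu + 1); the missing factor
     is L >= 1. *)
  have w0 : 0 <= 128 * B * d0^-1 ^+ 2 * (L%:R `^ nu) ^+ 2 * m / N%:R.
    rewrite divr_ge0 ?(ltW NR)// mulr_ge0// mulr_ge0 ?sqr_ge0// mulr_ge0 ?sqr_ge0//.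
    by rewrite mulr_ge0// ltW.
  have := ler_wpM2l w0 LR; rewrite mulr1; congr (_ <= _); ring.
apply: le_trans hr; rewrite /V.
pose A := [set w | D_N N w = 0%N].
apply: (chebyshev_normc Pr _ (measurable_D_N N 0)) => //.
  apply: bounded_rvD; first exact: (T_stat_bounded mu fe (@f_unif R) heps hX hD L N).
  exact: bounded_rv_cst.
move=> w; rewrite /= /D_stat => Dw.
have Tt : normc (T N L w) <= kappa * t.
  rewrite -ler_pdivrMr//; move/eqP: Dw; rewrite eqb0 -leNgt; apply: le_trans.
  exact: (@bigmax_sup_seq _ _ _ _ _ L xpredT _ (fun L => normc (T N L w) / t_sq nu N L)).
(* On acceptance Re T <= |T| <= kappa t, so |T - m| >= m - Re T >= m - kappa t, which is the event
   for Chebyshev's inequality. *)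
have hT := le_trans (ler_norm _) (le_Re_normc (T N L w)).
apply: le_trans (le_Re_normc _); rewrite ReD /= ler_normr; apply/orP; right.
lra.
Qed.

End error_bounds.

Unset Implicit Arguments.

Theorem theorem3 (R : realType)
    (mu : probability 'M[R]_3 R) (hmu : haar_probability mu)
    (D : forall l : nat, 'M[R]_3 -> 'M[R[i]]_l.*2.+1)
    (hD : rotational_harmonics D)
    (fe : 'M[R]_3 -> R)
    (d : measure_display) (Om : measurableType d)
    (P : ('cV[R]_3 -> R) -> probability Om R)
    (eps : nat -> Om -> 'M[R]_3) (X : nat -> Om -> 'cV[R]_3)
    (hmodel : noisy_sphere_model mu fe P eps X)
    (nu d0 d1 : R) (hnu : 0 < nu) (hd0 : 0 < d0) (hd1 : 0 < d1)
    (hfe : ordinary_smooth (rot_fourier mu D fe) nu d0 d1)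
    (s rad : R) (hs : 1 <= s) (hrad : 0 < rad)
    (K0 : R)
    (hK0 : deviation_constant (P (@f_unif R)) (rot_fourier mu D fe) nu
             (fun i w => eps i w *m X i w) K0)
    (C : R)
    (hC : Num.sqrt (2 * K0^-1) + ((4 * pi)^-1 + rad ^+ 2) * 2 `^ (2 * s) < C) :
  let D_N (N : nat) (w : Om) : nat :=
    D_stat (rot_fourier mu D fe) nu K0 N (fun i => eps i w *m X i w) in
  (fine (P (@f_unif R) [set w | D_N N w = 1%N]) +
   sup [set fine (P f [set w | D_N N w = 0%N])
         | f in alternatives s rad (C * psi_ad s nu N)])
  @[N --> \oo] --> (0 : R).
Proof.
move=> D_N; have [dfe heps hX hP] := hmodel; have [K00 _] := hK0.
have [K1 K10 HK1] := type_one heps hX hD K00 hK0.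
pose K2 := type_two_constant mu fe D nu K0 d0 d1 s rad C.
have K20 : 0 < K2 by exact: type_two_constant_gt0.
apply/cvgr0Pnorm_le => e e0; near=> N.
have y1 : 1 <= ln (N%:R : R) by near: N; exact: near_ln.
have l1 : 1 <= loglog R N by near: N; exact: near_loglog.
(* This threshold and the next one bring each error below e / 2. *)
have yK : K1 / (e / 2) <= ln (N%:R : R) by near: N; exact: near_ln.
have lK : (K2 / (e / 2)) ^+ 2 <= loglog R N by near: N; exact: near_loglog.
have I1 : fine (P (@f_unif R) [set w | D_N N w = 1%N]) <= K1 / ln N%:R.
  by near: N.
have N1 : (1 < N)%N by near: N; exact: nbhs_infty_gt.
(* The resolution is fixed before the density, which makes the bound on the second error uniform
   over the class. *)
have [L Lr [tpsi Lpsi]] : exists2 L, L \in resolutions R N &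
    t_sq nu N L <= psi_ad s nu N /\ L%:R `^ (- (2 * s)) <= 2 `^ (2 * s) * psi_ad s nu N.
  by near: N; exact: near_resolution.
have q0 : 0 < Num.sqrt (loglog R N) by rewrite sqrtr_gt0 (lt_le_trans ltr01).
have e20 : 0 < e / 2 by rewrite divr_gt0.
have e1 : K1 / ln N%:R <= e / 2.
  by rewrite ler_pdivrMr ?(lt_le_trans ltr01 y1)// mulrC -ler_pdivrMr.
have e2 : K2 / Num.sqrt (loglog R N) <= e / 2.
  rewrite ler_pdivrMr// mulrC -ler_pdivrMr// -[leLHS]ger0_norm ?(ltW (divr_gt0 K20 e20))//.
  by rewrite -sqrtr_sqr ler_wsqrtr.
set E := (X in sup X).
have Eub : ubound E (e / 2).
  move=> _ [f fA <-]; apply: le_trans e2; have [[df _ _] _] := fA.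
  have [deps dX indep] := hP f df.
  exact: (type_two heps hX hD hnu hd0 hfe hs hC dfe deps dX indep N1 l1 Lr tpsi Lpsi fA).
have Esup : 0 <= sup E <= e / 2.
  (* If there is no alternative at this [N], the supremum has the value 0. *)
  have [->|/set0P ne] := eqVneq E set0; first by rewrite sup0 lexx ltW.
  rewrite ge_sup// andbT; have [x Ex] := ne.
  by apply: le_trans (ub_le_sup (ex_intro _ _ Eub) Ex); case: Ex => f _ <-; exact: fine_ge0.
have /andP[E0 E1] := Esup.
rewrite ger0_norm; last by rewrite addr_ge0// fine_ge0.
by rewrite [e]splitr lerD// (le_trans I1).
Unshelve. all: by end_near. Qed.
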